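(* Let $\mathcal{D}(\bar A)=(\mathcal{X},\mathcal{E}_{\bar A})$ be a state digraph with $\mathcal{X}=\{x_1,\dots,x_n\}$, let $\mathcal{F}$ be an arbitrary minimal feasible solution, let $\rho$ be the total number of sensitive links associated with $\mathcal{F}$, $\mathcal{I}=\{1,\dots,\rho\}$, and let $\mathcal{Z}_j$ and $\mathcal{V}^l_j$ ($j=1,\dots,n$) be the sets defined in the context. Consider the set covering problem of minimizing $|\mathcal{J}|$ over $\mathcal{J}\subset\{1,\dots,n\}$ subject to $\mathcal{I}\subset\bigcup_{j\in\mathcal{J}}\mathcal{V}^l_j$, assumed to admit at least one feasible $\mathcal{J}$. Then this set covering problem can be constructed with complexity $\mathcal{O}(|\mathcal{X}|^6)$. Further, a feasible but approximate solution $\mathcal{J}'$ of this minimum set covering problem can be constructed using an $\mathcal{O}(|\mathcal{X}|^3)$ complexity algorithm such that $$\mathcal{F}'=\bigcup_{j\in\mathcal{J}'}\mathcal{Z}_j\ \cup\ \mathcal{F}$$ is an $l$-robust feasible solution, and the performance ratio, i.e., the ratio between $|\mathcal{F}'|$ and the size of a minimal (minimum-cardinality) $l$-robust feasible solution containing $\mathcal{F}$, is bounded by the harmonic number $H(\rho)=\sum_{k=1}^{\rho}\frac1k$.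
   Context: Symbol $\subset$ allows equality. Structural observability. A structural matrix $\bar A\in\{0,\star\}^{n\times n}$ is a pattern: $0$ denotes a fixed zero and $\star$ an independent real parameter (any real value). For $\mathcal{J}\subset\{1,\dots,n\}$, $\mathbb{I}_n(\mathcal{J})$ consists of the rows of the $n\times n$ identity matrix indexed by $\mathcal{J}$, and $\bar{\mathbb{I}}_n(\mathcal{J})$ is its pattern. The pair $(\bar A,\bar{\mathbb{I}}_n(\mathcal{J}))$ is structurally observable if there is a real matrix $A'$ with $A'_{ij}=0$ whenever $[\bar A]_{i,j}=0$ such that the system $\dot x=A'x$, $y=\mathbb{I}_n(\mathcal{J})x$ is observable. The state digraph is $\mathcal{D}(\bar A)=(\mathcal{X},\mathcal{E}_{\bar A})$, $\mathcal{X}=\{x_1,\dots,x_n\}$, $\mathcal{E}_{\bar A}=\{(x_i,x_j):[\bar A]_{j,i}\ne0\}$. A set $\mathcal{F}=\bigcup_{j\in\mathcal{J}}\{x_j\}$ is a feasible solution for $\mathcal{D}(\bar A)$ if $(\bar A,\bar{\mathbb{I}}_n(\mathcal{J}))$ is structurally observable; it is a minimal feasible solution if it has the minimum cardinality among feasible solutions. Links. For an edge $(x_i,x_j)\in\mathcal{E}_{\bar A}$, the (directed) link is $\mathcal{L}_{i,j}=\{(x_i,x_j)\}$, and $\bar A_{-(i,j)}$ denotes the structural matrix whose state digraph (the corrupted state digraph) is $\mathcal{D}(\bar A_{-(i,j)})=(\mathcal{X},\mathcal{E}_{\bar A}\setminus\mathcal{L}_{i,j})$. A set $\mathcal{F}^l\subset\mathcal{X}$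 is an $l$-robust feasible solution if it is a feasible solution for $\mathcal{D}(\bar A_{-(i,j)})$ for every link $\mathcal{L}_{i,j}\subset\mathcal{E}_{\bar A}$. A link $\mathcal{L}_{i,j}$ is sensitive with respect to a minimal feasible solution $\mathcal{F}$ of $\mathcal{D}(\bar A)$ if $\mathcal{F}$ is not a feasible solution of $\mathcal{D}(\bar A_{-(i,j)})$. The sensitive links are denoted $\mathcal{L}_{l_j,r_j}$, $j=1,\dots,\rho$. Graph notions. A path is a directed path with distinct vertices $v_1\to\dots\to v_k$ ($k\ge1$; an isolated vertex is a degenerate path), with tip $v_k$; a cycle is a path together with an edge from its tip to its root $v_1$ (self-loops are cycles). A P&C decomposition of a digraph is a collection of vertex-disjoint paths and cycles (subgraphs) spanning all vertices; it is minimum if its number of paths is least possible. An SCC is a strongly connected component; a sink-SCC is an SCC with no edge from its vertices to another SCC. Decomposition of $\mathcal{F}$. A minimal feasible solution is written (by a known characterization) as $\mathcal{F}=\mathcal{T}\cup\mathcal{S}^\circ$, relative to a minimum P&C decomposition $\Xi$ of $\mathcal{D}(\bar A)$: $\mathcal{T}=\mathcal{T}(\Xi)$ is the set of tips of the paths in $\Xi$, and $\mathcal{S}^\circ$ consists of one state variable from each sink-SCC containing no element of $\mathcal{T}$. Such a decomposition is fixed. Classification of sensitive links. The sensitive links $\mathcal{L}_{l_j,r_j}$, $j=1,\dots,\rho$, are ordered so that the first $r$ are those of case (i): there is no minimum P&C decomposition of $\mathcal{D}(\bar A_{-(l_j,r_j)})$ whose tips of paths are all contained in $\mathcal{F}$;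 and those with $j=r+1,\dots,\rho$ are of case (ii): there is a minimum P&C decomposition of $\mathcal{D}(\bar A_{-(l_j,r_j)})$ whose tips are all contained in $\mathcal{F}$, while the number of sink-SCCs without tips of the paths increases by $1$ due to the link failure. These two cases are mutually exclusive and cover all sensitive links. Back-ups. For $i\le r$, the tip-completions are $\Gamma^{\mathcal{T}}_i=\{x\in\mathcal{X}:\mathcal{T}\cup\{x\}$ contains the set of tips of the paths of a minimum P&C decomposition of $\mathcal{D}(\bar A_{-(l_i,r_i)})\}$, and the set of back-ups is $\Theta^i_{\mathcal{F}}=\{\{\gamma\}:\gamma\in\Gamma^{\mathcal{T}}_i\}$. For $r<i\le\rho$, the sink-completions are $\Gamma^{\mathcal{S}}_i=\{x\in\mathcal{X}: x$ belongs to the same SCC as $x_{l_i}$ in $\mathcal{D}(\bar A_{-(l_i,r_i)})\}$, and $\Theta^i_{\mathcal{F}}=\{\{\gamma\}:\gamma\in\Gamma^{\mathcal{S}}_i\}$. Covering data. $\mathcal{Z}_j=\{x_j\}$ and $\mathcal{V}^l_j=\{i\in\mathcal{I}:\mathcal{Z}_j\in\Theta^i_{\mathcal{F}}\}$ for $j=1,\dots,n$.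
   Formalization: The ratio bound is stated only for ρ ≥ 1 (for ρ = 0 it fails, as H(0) = 0), and in case (ii) the sink-SCCs counted are those containing no element of F rather than no tip, since otherwise the two cases need not cover all sensitive links. *)

(* Defs.v *)
From HB Require Import structures.
From mathcomp Require Import all_boot all_order all_algebra.
From mathcomp Require Import all_classical all_reals all_analysis.

Set Implicit Arguments.
Unset Strict Implicit.
Unset Printing Implicit Defensive.

Import Order.TTheory GRing.Theory Num.Theory.
Import numFieldNormedType.Exports.

Local Open Scope ring_scope.

Definition trajectory (R : realType) (n : nat) (A : 'M[R]_n)
    (x : R -> 'cV[R]_n) : Prop :=
  forall (t : R) (i : 'I_n),
    is_derive t (1 : R) (fun s : R => x s i ord0) ((A *m x t) i ord0).

Definition observable (R : realType) (n p : nat)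
    (A : 'M[R]_n) (C : 'M[R]_(p, n)) : Prop :=
  forall x z : R -> 'cV[R]_n,
    trajectory A x -> trajectory A z ->
    (forall t : R, 0 <= t -> C *m x t = C *m z t) ->
    x 0 = z 0.

Definition identity_rows (R : realType) (n : nat) (J : {set 'I_n}) :
    'M[R]_(#|J|, n) :=
  rowsub (fun k : 'I_#|J| => enum_val k) 1%:M.

(* A structural matrix is a boolean matrix, [true] marking a free parameter;
   the state variable [x_i] is identified with its index [i : 'I_n]. *)
Definition feasible (R : realType) (n : nat) (A : 'M[bool]_n)
    (J : {set 'I_n}) : Prop :=
  exists A' : 'M[R]_n,
    (forall i j : 'I_n, A i j = false -> A' i j = 0)
    /\ observable A' (identity_rows R J).

Definition minimal_feasible (R : realType) (n : nat) (A : 'M[bool]_n)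
    (F : {set 'I_n}) : Prop :=
  feasible R A F
  /\ forall G : {set 'I_n}, feasible R A G -> (#|F| <= #|G|)%N.

(* Edges go from column index to row index. *)
Definition state_edge (n : nat) (A : 'M[bool]_n) : rel 'I_n :=
  fun i j => A j i.

Definition remove_link (n : nat) (A : 'M[bool]_n) (l : 'I_n * 'I_n) :
    'M[bool]_n :=
  \matrix_(a, b) (A a b && ((b, a) != l)).

Definition link_robust (R : realType) (n : nat) (A : 'M[bool]_n)
    (F : {set 'I_n}) : Prop :=
  forall l : 'I_n * 'I_n,
    state_edge A l.1 l.2 -> feasible R (remove_link A l) F.

Definition minimal_link_robust_above (R : realType) (n : nat)
    (A : 'M[bool]_n) (F G : {set 'I_n}) : Prop :=
  [/\ F \subset G, link_robust R A G
    & forall G' : {set 'I_n},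
        F \subset G' -> link_robust R A G' -> (#|G| <= #|G'|)%N].

Definition sensitive (R : realType) (n : nat) (A : 'M[bool]_n)
    (F : {set 'I_n}) (l : 'I_n * 'I_n) : Prop :=
  state_edge A l.1 l.2 /\ ~ feasible R (remove_link A l) F.

Definition pc_decomposition (n : nat) (A : 'M[bool]_n)
    (ps cs : seq (seq 'I_n)) : Prop :=
  [/\ all (fun p => (p != [::]) && sorted (state_edge A) p) ps,
      all (fun c => (c != [::]) && path.cycle (state_edge A) c) cs,
      uniq (flatten (ps ++ cs))
    & forall x : 'I_n, x \in flatten (ps ++ cs)].

Definition min_pc_decomposition (n : nat) (A : 'M[bool]_n)
    (ps cs : seq (seq 'I_n)) : Prop :=
  pc_decomposition A ps cs
  /\ forall ps' cs' : seq (seq 'I_n),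
       pc_decomposition A ps' cs' -> (size ps <= size ps')%N.

(* The default value of [last] is irrelevant, [p] being nonempty. *)
Definition tips (n : nat) (ps : seq (seq 'I_n)) : {set 'I_n} :=
  [set x | has (fun p => (p != [::]) && (last x p == x)) ps].

Definition tips_within (n : nat) (A : 'M[bool]_n) (U : {set 'I_n}) : Prop :=
  exists ps cs : seq (seq 'I_n),
    min_pc_decomposition A ps cs /\ tips ps \subset U.

Definition scc (n : nat) (A : 'M[bool]_n) (x : 'I_n) : {set 'I_n} :=
  [set y | connect (state_edge A) x y && connect (state_edge A) y x].

Definition sink_sccs (n : nat) (A : 'M[bool]_n) : {set {set 'I_n}} :=
  [set Q in [set scc A x | x : 'I_n]
     | [forall x in Q, forall y, state_edge A x y ==> (y \in Q)]].

Definition sink_representatives (n : nat) (A : 'M[bool]_n)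
    (T S : {set 'I_n}) : Prop :=
  (forall Q : {set 'I_n},
     Q \in sink_sccs A -> [disjoint Q & T] -> #|S :&: Q| = 1%N)
  /\ (forall x : 'I_n, x \in S ->
        exists Q : {set 'I_n},
          [/\ Q \in sink_sccs A, [disjoint Q & T] & x \in Q]).

Definition tip_sensitive (n : nat) (A : 'M[bool]_n) (F : {set 'I_n})
    (l : 'I_n * 'I_n) : Prop :=
  ~ tips_within (remove_link A l) F.

(* The sink-SCCs still to be covered are counted relative to the whole of [F]:
   counting those without elements of the tip set only would miss a link whose
   failure shrinks a sink-SCC away from the representative it has in [F]. *)
Definition uncovered_sinks (n : nat) (A : 'M[bool]_n) (F : {set 'I_n}) : nat :=
  #|[set Q in sink_sccs A | [disjoint Q & F]]|.

Definition sink_sensitive (n : nat) (A : 'M[bool]_n) (F : {set 'I_n})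
    (l : 'I_n * 'I_n) : Prop :=
  tips_within (remove_link A l) F
  /\ uncovered_sinks (remove_link A l) F = (uncovered_sinks A F).+1.

(* The sensitive links, numbered from 0, those of the first kind being the
   first [r]. *)
Definition sensitive_links (R : realType) (n : nat) (A : 'M[bool]_n)
    (F : {set 'I_n}) (rho r : nat) (lk : rho.-tuple ('I_n * 'I_n)) : Prop :=
  [/\ uniq lk,
      forall l : 'I_n * 'I_n, (l \in lk) <-> sensitive R A F l,
      (r <= rho)%N,
      forall k : 'I_rho, (k < r)%N -> tip_sensitive A F (tnth lk k)
    & forall k : 'I_rho, (r <= k)%N -> sink_sensitive A F (tnth lk k)].

Definition tip_completions (n : nat) (A : 'M[bool]_n) (T : {set 'I_n})
    (l : 'I_n * 'I_n) : {set 'I_n} :=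
  [set x | `[< tips_within (remove_link A l) (x |: T) >]].

Definition sink_completions (n : nat) (A : 'M[bool]_n) (l : 'I_n * 'I_n) :
    {set 'I_n} :=
  scc (remove_link A l) l.1.

Definition backups (n : nat) (A : 'M[bool]_n) (T : {set 'I_n})
    (rho r : nat) (lk : rho.-tuple ('I_n * 'I_n)) (k : 'I_rho) :
    {set {set 'I_n}} :=
  [set [set g] | g in if (k < r)%N then tip_completions A T (tnth lk k)
                      else sink_completions A (tnth lk k)].

Definition Zset (n : nat) (j : 'I_n) : {set 'I_n} := [set j].

Definition Vset (n : nat) (A : 'M[bool]_n) (T : {set 'I_n})
    (rho r : nat) (lk : rho.-tuple ('I_n * 'I_n)) (j : 'I_n) : {set 'I_rho} :=
  [set k | Zset j \in backups A T r lk k].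

Definition covering (n : nat) (A : 'M[bool]_n) (T : {set 'I_n})
    (rho r : nat) (lk : rho.-tuple ('I_n * 'I_n)) (J : {set 'I_n}) : Prop :=
  [set: 'I_rho] \subset \bigcup_(j in J) Vset A T r lk j.

Definition harmonic_number (R : realType) (m : nat) : R :=
  \sum_(1 <= k < m.+1) k%:R^-1.

(* A random access machine with uniform cost, presented as a structured
   language: numbered registers, numbered two-dimensional arrays, and unit-cost
   instructions.  The only arithmetic operations are successor and predecessor,
   so that after [t] steps no value exceeds the largest value or constant
   read by more than [t], which is what makes unit costs realistic. *)

Inductive expr : Type :=
| Const of nat
| Reg of nat
| Cell of nat & expr & expr
| Succ of expr
| Pred of expr
| Equal of expr & expr
| Less of expr & expr.

Inductive prog : Type :=
| Skip
| Assign of nat & expr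
| Store of nat & expr & expr & expr
| Seq of prog & prog
| If of expr & prog & prog
| While of expr & prog.

Record machine : Type := Machine {
  reg : nat -> nat;
  arr : nat -> nat -> nat -> nat
}.

Local Open Scope nat_scope.

Fixpoint eval (s : machine) (e : expr) : nat :=
  match e with
  | Const c => c
  | Reg x => reg s x
  | Cell a e1 e2 => arr s a (eval s e1) (eval s e2)
  | Succ e1 => (eval s e1).+1
  | Pred e1 => (eval s e1).-1
  | Equal e1 e2 => eval s e1 == eval s e2
  | Less e1 e2 => eval s e1 < eval s e2
  end.

Fixpoint cost (e : expr) : nat :=
  match e with
  | Const _ | Reg _ => 1
  | Succ e1 | Pred e1 => (cost e1).+1
  | Cell _ e1 e2 | Equal e1 e2 | Less e1 e2 => (cost e1 + cost e2).+1
  end.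

Definition set_reg (s : machine) (x v : nat) : machine :=
  Machine (fun y => if y == x then v else reg s y) (arr s).

Definition set_arr (s : machine) (a i j v : nat) : machine :=
  Machine (reg s)
    (fun b k l => if [&& b == a, k == i & l == j] then v else arr s b k l).

(* [exec s p t s']: from [s], program [p] halts in [s'] after [t] steps. *)
Inductive exec : machine -> prog -> nat -> machine -> Prop :=
| ExecSkip s :
    exec s Skip 1 s
| ExecAssign s x e :
    exec s (Assign x e) (cost e).+1 (set_reg s x (eval s e))
| ExecStore s a e1 e2 e :
    exec s (Store a e1 e2 e) (cost e1 + cost e2 + cost e).+1
      (set_arr s a (eval s e1) (eval s e2) (eval s e))
| ExecSeq s1 s2 s3 p q t u :
    exec s1 p t s2 -> exec s2 q u s3 -> exec s1 (Seq p q) (t + u).+1 s3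
| ExecIfTrue s s' e p q t :
    eval s e != 0 -> exec s p t s' -> exec s (If e p q) (cost e + t).+1 s'
| ExecIfFalse s s' e p q t :
    eval s e = 0 -> exec s q t s' -> exec s (If e p q) (cost e + t).+1 s'
| ExecWhileTrue s1 s2 s3 e p t u :
    eval s1 e != 0 -> exec s1 p t s2 -> exec s2 (While e p) u s3 ->
    exec s1 (While e p) (cost e + t + u).+1 s3
| ExecWhileFalse s e p :
    eval s e = 0 -> exec s (While e p) (cost e).+1 s.

(* Registers and cells that are not mentioned are arbitrary. *)
Definition stores_set (n : nat) (s : machine) (a : nat) (U : {set 'I_n}) :
    Prop :=
  forall i : 'I_n, arr s a i 0 = (i \in U).

Definition stores_digraph (n : nat) (s : machine) (A : 'M[bool]_n)
    (F T : {set 'I_n}) : Prop :=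
  [/\ reg s 0 = n,
      forall i j : 'I_n, arr s 0 i j = state_edge A i j,
      stores_set s 1 F
    & stores_set s 2 T].

Definition stores_covering_problem (n : nat) (s : machine) (A : 'M[bool]_n)
    (T : {set 'I_n}) (rho r : nat) (lk : rho.-tuple ('I_n * 'I_n)) : Prop :=
  [/\ reg s 1 = rho,
      reg s 2 = r,
      forall k : 'I_rho, arr s 3 k 0 = (tnth lk k).1
                         /\ arr s 3 k 1 = (tnth lk k).2
    & forall (j : 'I_n) (k : 'I_rho),
        arr s 4 j k = (k \in Vset A T r lk j)].

(* Main.v *)
Require Import Defs.
From HB Require Import structures.
From mathcomp Require Import all_boot all_order all_algebra.
From mathcomp Require Import all_classical all_reals all_analysis.
From mathcomp Require Import complex.
From mathcomp Require Import zify ring lra.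

Set Implicit Arguments.
Unset Strict Implicit.
Unset Printing Implicit Defensive.

Import Order.TTheory GRing.Theory Num.Theory.
Import numFieldNormedType.Exports.

Local Open Scope ring_scope.

(** Everything rests on Lin's theorem ([feasibleP]): [J] is feasible if and only
    if every state reaches [J] and the states outside [J] can be matched with
    distinct successors. The necessity comes from two kinds of invisible
    eigenvectors. For the sufficiency, the matching is closed up to a permutation
    whose cycles get distinct weights, hence disjoint spectra, and are linked
    towards [J] by single edges; every eigenvector is then visible in [J]
    ([orbit_forest_eigen0]). Observability itself is translated into eigenvectors
    by the trajectories [e^(at) (u cos bt - w sin bt)] in one direction, and by
    differentiating the outputs in the other.

    The states without a successor in a maximum matching are the tips of a
    minimum decomposition ([tips_withinP]). Fix a matching [f] of the
    non-tips. The failure of a link can hurt in two independent ways. If the link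
    is [(a, f a)], then [a] must be matched again, along an alternating path; if
    no such path ends in [F] or at a free successor, then the vertices on the
    alternating paths from [a] are exactly the tip-completions
    ([release_setE]). Besides, the tail of the link may be cut off from [F]; then
    what it still reaches is exactly its component after the failure
    ([sink_completionsE]), and one more output is needed in it. So a set
    containing [F] is robust if and only if it meets all release sets and all cut
    off parts ([link_robust_above]).

    A covering of the back-ups need not do this: a link whose failure costs a tip
    can cut off a part as well, and its back-ups, being those of the first kind,
    ignore that part. The approximate cover is therefore computed for a larger
    family of constraints, in which every cut off part is added, including those of
    the links of the first kind. The parts form a laminar family
    ([tail_reach_laminar]), so the minimal ones are pairwise disjoint and
    hitting them is enough; a vertex then meets at most [rho + 1]
    constraints ([coverage_le]).

    The greedy choice is analysed by a potential: if the elements of a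
    solution [G] are charged [H(c)] when they meet [c] open constraints,
    each greedy step costs 1 and lowers the total charge by at least 1
    ([cover_price_step]). Applied to the [g] elements that a
    minimum robust set adds to [F], this gives at most [g H(rho + 1)] choices.
    The excess over [H(rho)] is absorbed by [F] itself, which is nonempty,
    because [g <= rho]: the tails of the sensitive links always form a solution
    ([tails_robust], [harmonic_ratio]).

    The programs only use loops that count up to [n] or [rho], and
    [rho <= 2 n], as a vertex is the tail of at most one link of each kind
    ([rho_le2n]). So the cost is bounded by a constant times [(2 n) ^ d] with [d]
    the depth of the nesting of loops ([exec_compile]); [d] is 4 for
    the construction, which computes a matching by augmenting paths and then runs
    one search for each non-tip and for each link, and it is 3 for the
    approximation. *)

(** * Matchings of a relation and alternating paths *)

Section Matchings.

Import boot.fintype boot.finset.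

Local Open Scope nat_scope.

Variable T : finType.
Implicit Types (e : rel T) (D L : {set T}) (f g : T -> T).

(** A relation on [T] is read as a bipartite graph between two copies of [T];
    [D] is the set of left vertices that are matched. *)
Definition matching e D f : Prop :=
  {in D &, injective f} /\ {in D, forall x, e x (f x)}.

Definition matchable e D : Prop := exists f, matching e D f.

(** Two steps of an alternating path, merged into one: from a left vertex [i]
    to the left vertex [j] that is matched with a neighbour of [i]. *)
Definition exchange e D f : rel T := fun i j => (j \in D) && e i (f j).

Definition update f x y : T -> T := fun z => if z == x then y else f z.

Definition unmatched D f y : bool := y \notin f @: D.

Lemma matching_sub e D D' f :
  D' \subset D -> matching e D f -> matching e D' f.
Proof.
move=> /subsetP sD [fi fe]; split=> [x y xD yD|x xD]; last exact/fe/sD.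
by apply: fi; apply: sD.
Qed.

Lemma matchable_sub e D D' : D' \subset D -> matchable e D -> matchable e D'.
Proof. by move=> sD [f fP]; exists f; apply: matching_sub fP. Qed.

Lemma matching_subrel e e' D f :
  {in D, forall x, e x (f x) -> e' x (f x)} -> matching e D f -> matching e' D f.
Proof. by move=> ee' [fi fe]; split=> // x xD; apply/ee'/fe. Qed.

Lemma matching_update e D f x y :
  matching e (D :\ x) f -> unmatched (D :\ x) f y -> e x y ->
  matching e (x |: D) (update f x y).
Proof.
move=> [fi fe] yf exy; split=> [u v|u]; rewrite /update !inE.
  have ne z : z != x -> z \in D -> f z <> y.
    by move=> zx zD fz; move/imsetP: yf; case; exists z; rewrite ?inE ?zx.
  case: (eqVneq u x) => [->|ux]; case: (eqVneq v x) => [->|vx] //=.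
  - by move=> _ vD /esym /(ne v vx vD).
  - by move=> uD _ /(ne u ux uD).
  - by move=> uD vD; apply: fi; rewrite !inE ?ux ?vx.
by case: (eqVneq u x) => [->|ux] //= uD; apply: fe; rewrite !inE ux.
Qed.

(** One step of augmentation, read from the free end of the path: giving [y]
    to the matched vertex [z] releases the previous partner of [z]. *)
Lemma augment_step e D f z y :
  matching e D f -> z \in D -> unmatched D f y -> e z y ->
  matching e D (update f z y) /\ unmatched D (update f z y) (f z).
Proof.
move=> fP zD yf ezy.
split.
  have zDE : z |: D = D by apply/setUidPr; rewrite sub1set.
  rewrite -{1}zDE.
  apply: matching_update => //; first by apply: matching_sub fP; apply: subD1set.
  by apply: contra yf => /imsetP[u]; rewrite !inE => /andP[_ uD] ->; apply: imset_f.
apply/imsetP=> -[u uD]; rewrite /update; case: (eqVneq u z) => [_ fz|uz fz].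
  by move/imsetP: yf; case; exists z.
by move: uz; rewrite (fP.1 z u zD uD fz) eqxx.
Qed.

Lemma exchange_update e D f z y p x :
  z \notin p -> path (exchange e D f) x p ->
  path (exchange e D (update f z y)) x p.
Proof.
elim: p x => //= w p IH x; rewrite inE negb_or => /andP[zw zp] /andP[xw wp].
rewrite IH // andbT; move: xw; rewrite /exchange /update.
by rewrite eq_sym (negPf zw).
Qed.

(** The classical augmentation along an alternating path from an uncovered left
    vertex [x] to a free right vertex [y]. *)
Lemma augment_path e D f x p y :
  matching e D f -> x \notin D -> path (exchange e D f) x p ->
  unmatched D f y -> e (last x p) y -> matchable e (x |: D).
Proof.
move=> fP xD /shortenP[q xq xqu _] yf; elim/last_ind: q => [|q z IH] /= in f fP xq xqu y yf *.
  move=> exy; exists (update f x y); apply: matching_update => //.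
    by apply: matching_sub fP; apply: subD1set.
  by apply: contra yf => /imsetP[u]; rewrite !inE => /andP[_ uD] ->; apply: imset_f.
rewrite last_rcons => ezy; move: xq; rewrite rcons_path => /andP[xq /andP[zD ez]].
have [f1P y1f] := augment_step fP zD yf ezy.
move: xqu; rewrite mem_rcons inE negb_or rcons_uniq.
move=> /andP[/andP[_ xq'] /andP[zq qu]].
have xq1 := exchange_update y zq xq.
by apply: (IH _ f1P xq1 _ _ y1f ez); rewrite /= xq'.
Qed.

(** If no neighbour of [L] is free and [L] is closed under exchange, then the
    neighbours of [L] are the partners of the matched part of [L]. *)
Lemma card_closed_matching e D f L D' :
  (forall i j, i \in L -> exchange e D f i j -> j \in L) ->
  (forall i y, i \in L -> e i y -> ~~ unmatched D f y) ->
  matching e D f -> matchable e D' -> #|L :&: D'| <= #|L :&: D|.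
Proof.
move=> Lc Lf [fi fe] [g [gi ge]].
have <- : #|f @: (L :&: D)| = #|L :&: D|.
  by apply: card_in_imset => u v; rewrite !inE => /andP[_ uD] /andP[_ vD]; apply: fi.
have <- : #|g @: (L :&: D')| = #|L :&: D'|.
  by apply: card_in_imset => u v; rewrite !inE => /andP[_ uD] /andP[_ vD]; apply: gi.
apply: subset_leq_card; apply/subsetP=> _ /imsetP[u /[!inE] /andP[uL uD] ->].
have := Lf _ _ uL (ge _ uD); rewrite negbK => /imsetP[v vD gv].
rewrite gv; apply: imset_f; rewrite inE vD andbT; apply: (Lc u) => //.
by rewrite /exchange vD -gv ge.
Qed.

Definition exchange_reach e D f x : {set T} :=
  [set z | connect (exchange e D f) x z].

Lemma exchange_reach_closed e D f x i j :
  i \in exchange_reach e D f x -> exchange e D f i j ->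
  j \in exchange_reach e D f x.
Proof. by rewrite !inE => xi ij; apply: connect_trans xi (connect1 ij). Qed.

Lemma exchange_reach_sub e D f x : exchange_reach e D f x \subset x |: D.
Proof.
apply/subsetP=> z; rewrite !inE => /connectP[p xp ->].
elim/last_ind: p xp => [|p w _] /=; first by rewrite eqxx.
by rewrite rcons_path last_rcons => /andP[_ /andP[-> _]]; rewrite orbT.
Qed.

Lemma augment_reach e D f x z y :
  matching e D f -> x \notin D -> z \in exchange_reach e D f x ->
  unmatched D f y -> e z y -> matchable e (x |: D).
Proof.
move=> fP xD; rewrite inE => /connectP[p xp ->] yf ey.
exact: augment_path fP xD xp yf ey.
Qed.

(** An alternating path ending at a matched vertex [z] lets [x] take the place
    of [z]. *)
Lemma swap_reach e D f x z :
  matching e D f -> x \notin D -> z \in exchange_reach e D f x ->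
  matchable e ((x |: D) :\ z).
Proof.
move=> fP xD; rewrite inE => /connectP[p + ->].
move=> /shortenP[q xq xqu _]; elim/last_ind: q xq xqu => [|q w _] /=.
  by move=> _ _; exists f; apply: matching_sub fP; apply/subsetP=> u;
     rewrite !inE => /andP[/negPf ->].
rewrite last_rcons rcons_path mem_rcons inE negb_or rcons_uniq.
move=> /andP[xq /andP[wD ew]] /andP[/andP[xw xq'] /andP[wq qu]].
have -> : (x |: D) :\ w = x |: (D :\ w).
  by apply/setP=> u; rewrite !inE; case: (eqVneq u x) => // ->; rewrite xw.
apply: (@augment_path _ _ f _ q (f w)) => //.
- by apply: matching_sub fP; apply: subD1set.
- by rewrite !inE (negPf xD) andbF.
- elim: q x xq wq {qu xq' xD xw ew} => //= v q IH x /andP[/andP[vD ev] vq].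
  rewrite inE negb_or => /andP[wv wq]; rewrite IH // andbT.
  by rewrite /exchange !inE eq_sym wv vD.
- apply/imsetP=> -[u /[!inE] /andP[uw uD] fu]; move: uw.
  by rewrite (fP.1 w u wD uD fu) eqxx.
Qed.

(** The augmentation axiom of the transversal matroid of [e]. *)
Lemma matchable_extend e D D' :
  matchable e D -> matchable e D' -> #|D| < #|D'| ->
  exists2 x, x \notin D & matchable e (x |: D).
Proof.
move=> [f fP] D'P ltDD'.
pose L := [set z | [exists x, (x \notin D) && (z \in exchange_reach e D f x)]].
have [|] := boolP [exists z in L, [exists y, unmatched D f y && e z y]].
  case/exists_inP=> z /[!inE] /existsP[x /andP[xD xz]] /existsP[y /andP[yf ey]].
  by exists x => //; apply: augment_reach xz yf ey.
move=> /exists_inPn noL; move: ltDD'; rewrite ltnNge => /negP[].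
have LD : #|L :&: D'| <= #|L :&: D|.
  apply: (card_closed_matching (e := e) (f := f)) => //.
  - move=> i j; rewrite !inE => /existsP[x /andP[xD xi]] ij.
    by apply/existsP; exists x; rewrite xD (exchange_reach_closed xi).
  - move=> i y iL ey; apply/negP=> yf; have /negP[] := noL _ iL.
    by apply/existsP; exists y; rewrite yf.
rewrite -(cardsID L D') -(cardsID L D) ![_ :&: L]setIC leq_add //.
apply: subset_leq_card; apply/subsetP=> u /[!inE] /andP[uL _].
rewrite uL /=; apply: contraR uL => uD.
by apply/existsP; exists u; rewrite uD inE connect0.
Qed.

Lemma matchable_maximum e D :
  matchable e D ->
  exists D', [/\ D \subset D', matchable e D'
                & forall D'', matchable e D'' -> #|D''| <= #|D'|].
Proof.
move: {2}(#|~: D|) (leqnn #|~: D|) => k; elim: k D => [|k IH] D.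
  rewrite leqn0 cards_eq0 => /eqP DC DP; exists D; split=> // D'' _.
  by apply: subset_leq_card; rewrite -(setCK D) DC setC0 subsetT.
move=> Dk DP; have [[D'' D''P ltD]|nD] :=
    pselect (exists2 D'', matchable e D'' & #|D| < #|D''|).
  have [x xD xDP] := matchable_extend DP D''P ltD.
  have [|D' [sD D'P D'm]] := IH _ _ xDP.
    rewrite -ltnS (leq_trans _ Dk) //; apply: proper_card; apply/properP; split.
      by rewrite setCS subsetUr.
    by exists x; rewrite !inE ?xD ?eqxx.
  by exists D'; split=> //; apply: subset_trans sD; apply: subsetUr.
exists D; split=> // D'' D''P; rewrite leqNgt; apply/negP=> ltD; apply: nD.
by exists D''.
Qed.

(** A set [C] with at most [#|C| - 1] neighbours blocks every set containing
    it; [x] is the unmatched element of [C]. *)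
Lemma blocked_reach e D f x D' :
  matching e D f -> x \notin D ->
  (forall i y, i \in exchange_reach e D f x -> e i y -> ~~ unmatched D f y) ->
  exchange_reach e D f x \subset D' -> ~ matchable e D'.
Proof.
move=> fP xD nf sCD D'P.
have := card_closed_matching (@exchange_reach_closed e D f x) nf fP D'P.
rewrite (setIidPl sCD) leqNgt => /negP[]; apply: proper_card.
apply/properP; split; first exact: subsetIl.
by exists x; rewrite !inE ?connect0 // (negPf xD) andbF.
Qed.

End Matchings.

(** * Path and cycle decompositions as matchings *)

Section Decompositions.

Import boot.fintype boot.finset.

Local Open Scope nat_scope.

Section Blocks.

Variable T : eqType.
Implicit Types (c p : seq T) (ss : seq (seq T)).

Lemma uniq_flatten_block ss c : uniq (flatten ss) -> c \in ss -> uniq c.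
Proof.
elim: ss => //= d ss IH; rewrite cat_uniq inE => /and3P[ud _ us].
by case/orP=> [/eqP->//|]; apply: IH.
Qed.

Lemma uniq_flatten_inj ss c d x :
  uniq (flatten ss) -> c \in ss -> d \in ss -> x \in c -> x \in d -> c = d.
Proof.
elim: ss => //= b ss IH; rewrite cat_uniq => /and3P[_ /hasPn nb us].
have off a : a \in ss -> x \in a -> x \notin b.
  by move=> sa ax; apply: nb; apply/flattenP; exists a.
rewrite !inE => /orP[/eqP->|cs] /orP[/eqP->|ds] //; last exact: IH.
  by move=> xb /(off _ ds); rewrite xb.
by move=> /(off _ cs) /negPf->.
Qed.

Lemma next_sorted (e : rel T) p x :
  sorted e p -> x \in p -> x != last x p -> e x (next p x).
Proof.
case: p => // h t /(pathP h) ht xp; rewrite next_nth xp => xl.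
set i := index x (h :: t).
have ih : i < size (h :: t) by rewrite index_mem.
have it : i < size t.
  move: ih; rewrite /= ltnS leq_eqVlt => /orP[/eqP it|//].
  by move: xl; rewrite [last _ _](last_nth h h t) -it /i nth_index ?eqxx.
by have := ht i it; rewrite /i nth_index.
Qed.

End Blocks.

Variables (n : nat) (A : 'M[bool]_n).
Implicit Types (ps cs : seq (seq 'I_n)) (D U : {set 'I_n}).

Lemma tips_cons h t ps : tips ((h :: t) :: ps) = last h t |: tips ps.
Proof. by apply/setP=> x; rewrite !inE /= eq_sym. Qed.

Lemma tips_perm ps ps' : perm_eq ps ps' -> tips ps = tips ps'.
Proof.
by move=> pp; apply/setP=> x; rewrite !inE; apply: eq_has_r; apply: perm_mem.
Qed.

Lemma tips_flatten ps x : x \in tips ps -> x \in flatten ps.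
Proof.
rewrite inE => /hasP[[//|h t] pps /= /eqP <-].
by apply/flattenP; exists (h :: t); rewrite ?mem_last.
Qed.

Lemma card_tips ps : [::] \notin ps -> uniq (flatten ps) -> #|tips ps| = size ps.
Proof.
elim: ps => [_ _|[|h t] ps IH]; first by rewrite (_ : tips [::] = set0) ?cards0 //; apply/setP=> x; rewrite !inE.
  by rewrite inE.
rewrite inE /= => nps.
rewrite -[_ && _]/(uniq ((h :: t) ++ flatten ps)) cat_uniq => /and3P[_ /hasPn ht us].
rewrite tips_cons cardsU1 IH //; case: (boolP (_ \in _)) => //= /tips_flatten.
by move=> /ht; rewrite mem_last.
Qed.

Lemma pc_paths_nonempty ps cs : pc_decomposition A ps cs -> [::] \notin ps.
Proof. by case=> /allP pP _ _ _; apply/negP=> /pP. Qed.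

Lemma pc_card_tips ps cs : pc_decomposition A ps cs -> #|tips ps| = size ps.
Proof.
move=> pc; rewrite (card_tips (pc_paths_nonempty pc)) //.
by case: pc => _ _ + _; rewrite flatten_cat cat_uniq => /and3P[].
Qed.

(** [next] closes up the paths too, which makes the successor function injective
    on all states. *)
Lemma pc_successor ps cs :
  pc_decomposition A ps cs ->
  exists2 f, injective f & {in ~: tips ps, forall x, state_edge A x (f x)}.
Proof.
move=> [psP csP us full]; set ss := ps ++ cs in us full.
pose block x := nth [::] ss (find (fun c => x \in c) ss).
have hb x : has (fun c => x \in c) ss.
  by apply/hasP; have /flattenP[c cs' xc] := full x; exists c.
have bP x : x \in block x by apply: (nth_find [::] (hb x)).
have bss x : block x \in ss by apply: mem_nth; rewrite -has_find.
exists (fun x => next (block x) x) => [x y xy|x].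
  have bxy : block x = block y.
    apply: (uniq_flatten_inj us (bss x) (bss y) (x := next (block x) x)).
      by rewrite mem_next.
    by rewrite xy mem_next.
  have ub := uniq_flatten_block us (bss x).
  by rewrite -(prev_next ub x) xy bxy prev_next // -bxy.
rewrite inE => xt; move: (bss x); rewrite mem_cat => /orP[bp|bc].
  have /andP[b0 bs] := allP psP _ bp.
  apply: next_sorted => //; apply: contra xt => /eqP xl.
  by rewrite inE; apply/hasP; exists (block x); rewrite // b0 -xl eqxx.
by have /andP[_ bcy] := allP csP _ bc; apply: next_cycle.
Qed.

Lemma pc_matching ps cs :
  pc_decomposition A ps cs -> matchable (state_edge A) (~: tips ps).
Proof.
by move=> /pc_successor[f fi fe]; exists f; split=> // x y _ _; apply: fi.
Qed.

Lemma pc_perm ps ps' cs :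
  perm_eq ps ps' -> pc_decomposition A ps cs -> pc_decomposition A ps' cs.
Proof.
move=> pp [psP csP us full].
have pf : perm_eq (flatten (ps ++ cs)) (flatten (ps' ++ cs)).
  by apply: perm_flatten; rewrite perm_cat2r.
split=> //; first by rewrite -(perm_all _ pp).
  by rewrite -(perm_uniq pf).
by move=> x; rewrite -(perm_mem pf).
Qed.

Lemma pc_close h s ps cs :
  pc_decomposition A ((h :: s) :: ps) cs -> state_edge A (last h s) h ->
  pc_decomposition A ps ((h :: s) :: cs).
Proof.
move=> [/= /andP[hs psP] csP us full] e.
have pf : perm_eq (flatten (((h :: s) :: ps) ++ cs)) (flatten (ps ++ ((h :: s) :: cs))).
  by apply: perm_flatten; rewrite perm_sym perm_catC /= perm_cons perm_catC.
split=> //=; first by rewrite rcons_path hs e.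
  by rewrite -(perm_uniq pf).
by move=> x; rewrite -(perm_mem pf).
Qed.

Lemma pc_join h s y t ps cs :
  pc_decomposition A ((h :: s) :: (y :: t) :: ps) cs ->
  state_edge A (last h s) y ->
  pc_decomposition A ((h :: s ++ y :: t) :: ps) cs.
Proof.
move=> [/= /and3P[hs yt psP] csP us full] e; split=> //=.
- by rewrite cat_path hs /= e yt psP.
- by rewrite -catA.
- by move=> x; have := full x; rewrite -!cat_cons -catA.
Qed.

(** Adding the matched edges one at a time to the decomposition into single
    vertices: the edge from [x] to [f x] leaves the tip of a path and enters the
    root of a path, so that it closes a path or joins two of them. *)
Lemma matching_pc D f :
  matching (state_edge A) D f ->
  exists ps cs, [/\ pc_decomposition A ps cs, tips ps = ~: D
    & forall y, y \notin f @: D -> exists t, y :: t \in ps].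
Proof.
move: {2}#|D| (erefl #|D|) => k; elim: k D => [|k IH] D Dk fP.
  have /eqP := Dk; rewrite cards_eq0 => /eqP D0.
  have fl : flatten ([seq [:: x] | x <- enum 'I_n] ++ [::]) = enum 'I_n.
    by rewrite cats0 -[RHS]map_id flatten_map1.
  exists [seq [:: x] | x <- enum 'I_n], [::]; split.
  - split=> //; first by apply/allP=> _ /mapP[x _ ->].
      by rewrite fl enum_uniq.
    by move=> x; rewrite fl mem_enum.
  - apply/setP=> x; rewrite D0 !inE; apply/hasP; exists [:: x] => //=.
    by apply: map_f; rewrite mem_enum.
  - by move=> y _; exists [::]; apply: map_f; rewrite mem_enum.
have [x xD] : exists x, x \in D by apply/card_gt0P; rewrite Dk.
have Dk' : #|D :\ x| = k by have := cardsD1 x D; rewrite xD Dk add1n => -[].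
have [ps [cs [pc tE hE]]] := IH _ Dk' (matching_sub (subD1set D x) fP).
have exf : state_edge A x (f x) by apply: fP.2.
have fxn : f x \notin f @: (D :\ x).
  by apply/imsetP=> -[u /[!inE] /andP[ux uD] /(fP.1 _ _ xD uD) xu]; rewrite xu eqxx in ux.
have [t tps] := hE _ fxn.
have : x \in tips ps by rewrite tE !inE eqxx.
rewrite inE => /hasP[[//|h s] hps /= /eqP lx].
have fD y : y \notin f @: D -> y \notin f @: (D :\ x) /\ y != f x.
  move=> yD; split.
    by apply: contra yD; apply/subsetP/imsetS/subD1set.
  by apply: contraNneq yD => ->; apply: imset_f.
have [E|ne] := eqVneq (h :: s) (f x :: t).
  have pp := perm_to_rem hps; move: (E) => [hf _].
  have pc' := pc_perm pp pc.
  exists (rem (h :: s) ps), ((h :: s) :: cs); split.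
  - by apply: pc_close => //; rewrite lx hf.
  - have := tE; rewrite (tips_perm pp) tips_cons lx => /setP tE'.
    apply/setP=> u; have := tE' u; rewrite !inE.
    case: (eqVneq u x) => [-> _|ux] //=.
    rewrite xD; apply/negP => xt.
    have : x \in tips (rem (h :: s) ps) by rewrite inE.
    move=> /tips_flatten xf; case: pc' => _ _ + _.
    rewrite -[flatten _]/((h :: s) ++ flatten (rem (h :: s) ps ++ cs)) cat_uniq.
    move=> /and3P[_ /hasPn nf _]; move: (nf x).
    have xh : x \in h :: s by rewrite -lx mem_last.
    by rewrite flatten_cat mem_cat xf /= xh => /(_ isT).
  - move=> y /fD[/hE[t' yt'] yf]; exists t'.
    move: yt'; rewrite (perm_mem pp) inE => /orP[/eqP[yh _]|//].
    by rewrite yh hf eqxx in yf.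
set rest := rem (f x :: t) (rem (h :: s) ps).
have pp : perm_eq ps [:: h :: s, f x :: t & rest].
  rewrite (perm_trans (perm_to_rem hps)) // perm_cons perm_to_rem //.
  by move: tps; rewrite (perm_mem (perm_to_rem hps)) inE eq_sym (negPf ne).
have pc' := pc_perm pp pc.
exists ((h :: s ++ f x :: t) :: rest), cs; split.
- by apply: pc_join => //; rewrite lx.
- have := tE; rewrite (tips_perm pp) !tips_cons lx last_cat /= => /setP tE'.
  apply/setP=> u; have := tE' u; rewrite !inE.
  case: (eqVneq u x) => [-> _|ux] //=; rewrite xD.
  case: pc' => _ _ + _.
  rewrite -[flatten _]/((h :: s) ++ (f x :: t) ++ flatten (rest ++ cs)) cat_uniq.
  move=> /and3P[_ /hasPn nf _].
  have xh : x \in h :: s by rewrite -lx mem_last.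
  apply/negP=> /orP[/eqP xl|xt].
    by move: (nf x); rewrite mem_cat {1}xl mem_last /= xh => /(_ isT).
  have : x \in tips rest by rewrite inE.
  move=> /tips_flatten xf; move: (nf x).
  by rewrite mem_cat flatten_cat (mem_cat x (flatten rest)) xf orbT /= xh => /(_ isT).
- move=> y /fD[/hE[t' yt'] yf].
  move: yt'; rewrite (perm_mem pp) !inE => /or3P[/eqP[-> _]|/eqP[yh _]|yr].
  + by exists (s ++ f x :: t); rewrite inE eqxx.
  + by rewrite yh eqxx in yf.
  + by exists t'; rewrite inE yr orbT.
Qed.

(** A matching extends to a permutation, along the paths and cycles that it
    forms. *)
Lemma matchable_injective D :
  matchable (state_edge A) D ->
  exists2 f, injective f & {in D, forall x, state_edge A x (f x)}.
Proof.
move=> [f /matching_pc[ps [cs [/pc_successor + tE _]]]].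
by rewrite tE setCK.
Qed.

(** The number of paths is the number of unmatched states, and a matching of
    the states outside [U] extends to a maximum one. *)
Lemma tips_withinP U : tips_within A U <-> matchable (state_edge A) (~: U).
Proof.
split=> [[ps [cs [[pc _] sU]]]|UP].
  by apply: matchable_sub (pc_matching pc); rewrite setCS.
have [D [sD [f fP] Dmax]] := matchable_maximum UP.
have [ps [cs [pc tE _]]] := matching_pc fP.
exists ps, cs; split; last by rewrite tE -(setCK U) setCS.
split=> // ps' cs' pc'; rewrite -(pc_card_tips pc) -(pc_card_tips pc') tE.
have := Dmax _ (pc_matching pc').
by rewrite -(leq_add2r #|~: D|) cardsC -(cardsC (tips ps')) addnC leq_add2r.
Qed.

End Decompositions.

(** * Effect of one edge deletion *)

Section EdgeDeletion.

Import boot.fintype boot.finset.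

Variable T : finType.
Implicit Types (e : rel T) (D F U X : {set T}) (f : T -> T) (l : T * T).

Definition del_edge e l : rel T := fun i j => e i j && ((i, j) != l).

Lemma del_edge_sub e l : subrel (del_edge e l) e.
Proof. by move=> i j /andP[]. Qed.

(** ** Deletion of a matched edge *)

Section MatchedEdge.

Variables (e : rel T) (tp F : {set T}) (f : T -> T).
Hypotheses (fP : matching e (~: tp) f) (tpF : tp \subset F).

(** When [(a, f a)] is deleted, [a] loses its partner and [f a] becomes free;
    these are the vertices that can release their partner in favour of [a]. *)
Definition release_set a : {set T} :=
  exchange_reach (del_edge e (a, f a)) (~: tp :\ a) f a.

Definition free_neighbour a z : bool :=
  [exists y, unmatched (~: tp :\ a) f y && del_edge e (a, f a) z y].

Definition repairable a : bool :=
  [exists z in release_set a, (z \in F) || free_neighbour a z].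

Let matching_del a : matching (del_edge e (a, f a)) (~: tp :\ a) f.
Proof.
apply: matching_subrel (matching_sub (subD1set _ a) fP) => x /[!inE] /andP[xa _] ex.
by rewrite /del_edge ex; apply: contra xa => /eqP[->].
Qed.

Let restore a : a \notin tp -> a |: (~: tp :\ a) = ~: tp.
Proof. by move=> ap; rewrite setD1K // inE. Qed.

(** The deletions that no set of tips inside [F] survives. *)
Definition critical_edge l : bool :=
  [&& l.1 \notin tp, l.2 == f l.1 & ~~ repairable l.1].

Lemma critical_edgeE l : critical_edge l -> (l.1, f l.1) = l.
Proof. by case: l => a b /and3P[_ /eqP /= <- _]. Qed.

Lemma release_setxx a : a \in release_set a.
Proof. by rewrite inE connect0. Qed.

Lemma release_set_disjoint a : ~~ repairable a -> [disjoint release_set a & F].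
Proof.
move=> /exists_inPn nr; apply/pred0Pn => -[z /= /andP[za zF]].
by have := nr _ za; rewrite zF.
Qed.

Lemma release_set_blocks a D :
  ~~ repairable a -> release_set a \subset D ->
  ~ matchable (del_edge e (a, f a)) D.
Proof.
move=> /exists_inPn nr; apply: blocked_reach (matching_del a) _ _.
  by rewrite !inE eqxx.
move=> i y ia ey; apply/negP=> yf; have := nr _ ia; rewrite negb_or => /andP[_ /negP[]].
by apply/existsP; exists y; rewrite yf.
Qed.

Lemma release_set_swap a x :
  a \notin tp -> x \in release_set a ->
  matchable (del_edge e (a, f a)) (~: (x |: tp)).
Proof.
move=> ap xa; have -> : ~: (x |: tp) = ~: tp :\ x by rewrite setCU setDE setIC.
rewrite -(restore ap); apply: swap_reach (matching_del a) _ xa.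
by rewrite !inE eqxx.
Qed.

(** Only the deletion of an edge of the matching can do harm, and it does when
    its tail cannot be matched again without unmatching a vertex outside [F]. *)
Lemma unmatchable_del l :
  ~ matchable (del_edge e l) (~: F) <->
  [/\ l.1 \notin tp, l.2 = f l.1 & ~~ repairable l.1].
Proof.
case: l => a b /=; split=> [nm|[ap -> nr]]; last first.
  apply: (release_set_blocks nr); rewrite -disjoints_subset.
  exact: release_set_disjoint.
have sFt : ~: F \subset ~: tp by rewrite setCS.
have [ap|ap] := boolP (a \in tp).
  case: nm; apply: matchable_sub sFt _; exists f; apply: matching_subrel fP => x.
  by rewrite inE => xp ex; rewrite /del_edge ex; apply: contraNneq xp => -[->].
have [bE|bn] := eqVneq b (f a); last first.
  case: nm; apply: matchable_sub sFt _; exists f; apply: matching_subrel fP => x.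
  move=> _ ex; rewrite /del_edge ex; apply: contra bn => /eqP[xa <-].
  by rewrite xa.
split=> //; apply/negP=> /exists_inP[z za /orP[zF|]].
  case: nm; rewrite bE; apply: matchable_sub (release_set_swap ap za).
  by rewrite setCS subUset sub1set zF.
move=> /existsP[y /andP[yf ey]]; case: nm; rewrite bE.
apply: matchable_sub sFt _; rewrite -(restore ap).
by apply: augment_reach za yf ey; rewrite ?inE ?eqxx.
Qed.

Lemma matchable_del_above a U :
  a \notin tp -> ~~ repairable a -> tp \subset U ->
  matchable (del_edge e (a, f a)) (~: U) <-> ~~ [disjoint release_set a & U].
Proof.
move=> ap nr sU; split=> [m|/pred0Pn[x /= /andP[xa xU]]].
  apply/negP; rewrite disjoints_subset => sr.
  exact: release_set_blocks nr sr m.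
apply: matchable_sub (release_set_swap ap xa).
by rewrite setCS subUset sub1set xU.
Qed.

End MatchedEdge.

(** ** Deletion of an edge and reachability *)

Definition reaches e X : Prop := forall x, exists2 y, y \in X & connect e x y.

Definition tail_reach e l : {set T} := [set z | connect (del_edge e l) l.1 z].

Lemma tail_reachxx e l : l.1 \in tail_reach e l.
Proof. by rewrite inE connect0. Qed.

Lemma tail_reach_closed e l i j :
  i \in tail_reach e l -> e i j -> (i, j) != l -> j \in tail_reach e l.
Proof.
rewrite !inE => li ij nl; apply: connect_trans li (connect1 _).
by rewrite /del_edge ij.
Qed.

Section Reach.

Variables (e : rel T) (F : {set T}).
Hypothesis eF : reaches e F.

(** A vertex cut off from [F] had all its paths to [F] through the deleted
    edge, so it still reaches the tail of that edge. *)
Lemma connect_tail l x :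
  (forall y, y \in F -> ~~ connect (del_edge e l) x y) ->
  connect (del_edge e l) x l.1.
Proof.
have [y yF /connectP[p]] := eF x; elim: p x => [|z p IH] x /=.
  by move=> _ <- /(_ _ yF); rewrite connect0.
case/andP=> xz zp yl nx; have [xl|xl] := eqVneq (x, z) l.
  by rewrite -xl connect0.
have xz' : connect (del_edge e l) x z by apply: connect1; rewrite /del_edge xz.
apply: (connect_trans xz'); apply: (IH _ zp yl) => w wF.
by apply: contra (nx w wF); apply: (connect_trans xz').
Qed.

Lemma reaches_del l U :
  F \subset U ->
  reaches (del_edge e l) U <-> ~~ [disjoint tail_reach e l & U].
Proof.
move=> /subsetP sU; split=> [/(_ l.1)[y yU ly]|/pred0Pn[u /= /andP[lu uU]] x].
  by apply/pred0Pn; exists y; rewrite /= inE ly.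
have [/exists_inP[y yF xy]|/exists_inPn nx] :=
    boolP [exists y in F, connect (del_edge e l) x y].
  by exists y => //; apply: sU.
exists u => //; move: lu; rewrite inE; apply: connect_trans.
exact: connect_tail.
Qed.

Lemma tail_reach_back l x :
  [disjoint tail_reach e l & F] -> x \in tail_reach e l ->
  connect (del_edge e l) x l.1.
Proof.
move=> /pred0P dF; rewrite inE => lx; apply: connect_tail => y yF.
apply/negP=> xy; have := dF y; rewrite /= yF inE andbT.
by rewrite (connect_trans lx xy).
Qed.

(** At most one edge out of a vertex is indispensable for reaching [F]: a
    simple path to [F] uses only one of them. *)
Lemma cut_edge_inj l l' :
  [disjoint tail_reach e l & F] -> [disjoint tail_reach e l' & F] ->
  l.1 = l'.1 -> l = l'.
Proof.
case: l l' => [a b] [a' b'] /= dl dl' aa'; rewrite -{a'}aa' in dl' *.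
have [y yF /connectP[q aq yq]] := eF a.
case/shortenP: aq yq => p ap aup _ yp.
case: p => [|c p] /= in ap aup yp.
  by move/pred0P: dl => /(_ y); rewrite /= yF yp inE connect0.
move: ap aup => /andP[ac cp] /andP[nap _].
have safe k : k.1 = a -> k != (a, c) -> connect (del_edge e k) a y.
  case: k => _ d /= -> dc; apply/connectP; exists (c :: p) => //=.
  rewrite /del_edge ac eq_sym dc /=; elim: p c cp nap {dc yp ac} => //= z p IH c.
  case/andP=> cz zp; rewrite inE negb_or => /andP[ac' azp].
  by rewrite cz IH // andbT; apply: contra ac' => /eqP[->].
have uncut k : k.1 = a -> [disjoint tail_reach e k & F] -> k = (a, c).
  move=> ka /pred0P dk; apply/eqP/negPn/negP=> /(safe k ka) ay.
  by have := dk y; rewrite /= yF inE ka ay.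
exact: etrans (uncut (a, b) erefl dl) (esym (uncut (a, b') erefl dl')).
Qed.

(** The sets cut off from [F] form a laminar family: if neither of two
    intersecting ones contained the other, each deleted edge would stay inside
    the other set, and their union would be cut off from [F] before any
    deletion. *)
Lemma tail_reach_laminar l l' :
  [disjoint tail_reach e l & F] -> [disjoint tail_reach e l' & F] ->
  ~~ [disjoint tail_reach e l & tail_reach e l'] ->
  (tail_reach e l \subset tail_reach e l') || (tail_reach e l' \subset tail_reach e l).
Proof.
move=> dl dl' /pred0Pn[z /= /andP[zl zl']].
have leave k k' v : [disjoint tail_reach e k & F] -> v \in tail_reach e k ->
    v \in tail_reach e k' -> ~~ (tail_reach e k \subset tail_reach e k') ->
    k'.2 \in tail_reach e k.
  move=> dk vk vk' /subsetPn[w wk wk'].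
  have : connect (del_edge e k) v w.
    by apply: connect_trans (tail_reach_back dk vk) _; rewrite inE in wk.
  case/connectP=> p; elim: p => [|u p IH] /= in v vk vk' *.
    by move=> _ wv; rewrite wv vk' in wk'.
  case/andP=> vu up wp; have eu := del_edge_sub vu.
  have uk : u \in tail_reach e k.
    by move: vk; rewrite !inE => kv; apply: connect_trans kv (connect1 vu).
  have [vuk|vuk] := eqVneq (v, u) k'; first by rewrite -vuk.
  exact: IH uk (tail_reach_closed vk' eu vuk) up wp.
apply/orP; have [|ns] := boolP (_ \subset tail_reach e l'); first by left.
right; apply/negPn/negP=> ns'.
have l2 := leave _ _ _ dl' zl' zl ns'; have l2' := leave _ _ _ dl zl zl' ns.
have [y yF /connectP[p]] := eF z.
suff cl x : x \in tail_reach e l :|: tail_reach e l' -> path e x p -> last x p \in tail_reach e l :|: tail_reach e l'.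
  move=> zp yp; have := cl z; rewrite inE zl => /(_ isT zp); rewrite -yp.
  by rewrite inE => /orP[ly|ly]; [move/pred0P: dl|move/pred0P: dl'] => /(_ y);
     rewrite /= ly yF.
elim: p x => //= u p IH x xU /andP[xu]; apply: IH; move: xU.
rewrite !in_setU => /orP[xl|xl].
  have [E|nl] := eqVneq (x, u) l; last by rewrite (tail_reach_closed xl xu nl).
  by rewrite -{1}E /= in l2; rewrite l2 orbT.
have [E|nl] := eqVneq (x, u) l'; last by rewrite (tail_reach_closed xl xu nl) orbT.
by rewrite -{1}E /= in l2'; rewrite l2'.
Qed.

End Reach.

End EdgeDeletion.

(** * Observability and eigenvectors *)

Section Hautus.

Variable R : realType.
Local Notation C := R[i].
Local Open Scope complex_scope.

Definition complex_mx m n (M : 'M[R]_(m, n)) : 'M[C]_(m, n) :=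
  map_mx (real_complex R) M.

(** No eigenvector is invisible at the outputs: the criterion of Popov,
    Belevitch and Hautus. *)
Definition eigen_visible n p (A : 'M[R]_n) (M : 'M[R]_(p, n)) : Prop :=
  forall (lam : C) (v : 'cV[C]_n),
    complex_mx A *m v = lam *: v -> complex_mx M *m v = 0 -> v = 0.

(** Over a closed field, a nonzero unobservable vector [v] yields an invisible
    eigenvector: if [q] is of least degree with [q(A) v = 0] and [lam] is a root
    of [q], then [(q / (X - lam))(A) v] is one. *)
Lemma unobservable_eigenvector n p (A : 'M[C]_n) (M : 'M[C]_(p, n)) (v : 'cV[C]_n) :
  v != 0 -> (forall k, M *m iter k (mulmx A) v = 0) ->
  exists lam (u : 'cV[C]_n), [/\ u != 0, A *m u = lam *: u & M *m u = 0].
Proof.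
case: n => [|n] in A M v *; first by rewrite [v]flatmx0 eqxx.
move=> v0 Mv.
have Mq q : M *m (horner_mx A q *m v) = 0.
  elim/poly_ind: q v {v0} Mv => [|q c IH] v Mv; first by rewrite rmorph0 mul0mx mulmx0.
  rewrite rmorphD rmorphM /= horner_mx_X horner_mx_C mulmxDl mulmxDr.
  rewrite -mulmxA IH ?add0r; first by rewrite mul_scalar_mx -scalemxAr (Mv 0%N) scaler0.
  by move=> k; rewrite -iterSr Mv.
pose P k := `[< exists q : {poly C}, [/\ q != 0, size q = k & horner_mx A q *m v = 0] >].
have exP : exists k, P k.
  exists (size (char_poly A)); apply/asboolP; exists (char_poly A); split=> //.
    exact/monic_neq0/char_poly_monic.
  by rewrite Cayley_Hamilton mul0mx.
case: (ex_minnP exP) => k /asboolP[q [q0 qk qv] kmin].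
have /closed_rootP[lam] : size q != 1%N.
  apply: contra v0 => /size_poly1P[c c0 qc]; move: qv; rewrite qc horner_mx_C mul_scalar_mx.
  by move/eqP; rewrite scaler_eq0 (negPf c0).
move=> /factor_theorem[r qr].
have r0 : r != 0 by apply: contra q0; rewrite qr => /eqP->; rewrite mul0r.
exists lam, (horner_mx A r *m v); split; last exact: Mq.
  apply/eqP=> rv; have : (k <= size r)%N by apply: kmin; apply/asboolP; exists r.
  by rewrite -qk qr size_Mmonic ?monicXsubC // size_XsubC addn2 ltnn.
move: qv; rewrite qr mulrC rmorphM /= rmorphB /= horner_mx_X horner_mx_C.
rewrite -[_ * _ *m v]mulmxA mulmxBl mul_scalar_mx => /eqP; rewrite subr_eq0.
by move/eqP.
Qed.

Lemma mulmx_parts m n p (M : 'M[R]_(m, n)) (v : 'M[C]_(n, p)) :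
  map_mx (@complex.Re R) (complex_mx M *m v) = M *m map_mx (@complex.Re R) v /\
  map_mx (@complex.Im R) (complex_mx M *m v) = M *m map_mx (@complex.Im R) v.
Proof.
have ReD : {morph (@complex.Re R) : x y / x + y} by move=> [x y] [z w].
have ImD : {morph (@complex.Im R) : x y / x + y} by move=> [x y] [z w].
split; apply/matrixP=> i j; rewrite !mxE ?(big_morph _ ReD (erefl _)) ?(big_morph _ ImD (erefl _)).
  by apply: eq_bigr => k _; rewrite !mxE; case: (v k j) => ? ? /=; rewrite mul0r subr0.
by apply: eq_bigr => k _; rewrite !mxE; case: (v k j) => ? ? /=; rewrite mul0r addr0.
Qed.

Lemma complex_eigen_parts n (A : 'M[R]_n) (v : 'cV[C]_n) a b :
  complex_mx A *m v = (a +i* b) *: v ->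
  A *m map_mx (@complex.Re R) v = a *: map_mx (@complex.Re R) v - b *: map_mx (@complex.Im R) v /\
  A *m map_mx (@complex.Im R) v = a *: map_mx (@complex.Im R) v + b *: map_mx (@complex.Re R) v.
Proof.
have [<- <-] := mulmx_parts A v => ->.
by split; apply/matrixP=> i j; rewrite !mxE; case: (v i j).
Qed.

Lemma complex_mx_parts0 m n (v : 'M[C]_(m, n)) :
  map_mx (@complex.Re R) v = 0 -> map_mx (@complex.Im R) v = 0 -> v = 0.
Proof.
move=> /matrixP vr /matrixP vi; apply/matrixP=> i j.
by have := vr i j; have := vi i j; rewrite !mxE; case: (v i j) => x y /= -> ->.
Qed.

(** The real solution [e^(at) (u cos bt - w sin bt)] attached to the eigenvector
    [u + i w] of eigenvalue [a + i b]. *)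
Definition eigen_trajectory n (u w : 'cV[R]_n) (a b t : R) : 'cV[R]_n :=
  \col_i (expR (a * t) * (cos (b * t) * u i ord0 - sin (b * t) * w i ord0)).

Lemma eigen_trajectoryP n (A : 'M[R]_n) (u w : 'cV[R]_n) a b :
  A *m u = a *: u - b *: w -> A *m w = a *: w + b *: u ->
  trajectory A (eigen_trajectory u w a b).
Proof.
move=> Au Aw t i.
have -> : A *m eigen_trajectory u w a b t =
    expR (a * t) *: (cos (b * t) *: (a *: u - b *: w)
                     - sin (b * t) *: (a *: w + b *: u)).
  rewrite -Au -Aw !scalemxAr -mulmxBr scalemxAr; congr (_ *m _).
  by apply/matrixP=> k l; rewrite !mxE !ord1.
have lin c : is_derive t 1 (fun s : R => c * s) c.
  have := is_deriveZ c (is_derive_id t 1); rewrite /GRing.scale /= mulr1.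
  by apply.
rewrite [X in is_derive _ _ X](_ : _ =
  (expR \o (fun s => a * s)) * ((u i ord0) \*: (cos \o (fun s => b * s))
    - (w i ord0) \*: (sin \o (fun s => b * s)))); last first.
  by apply/funext=> s; rewrite !mxE /= /GRing.scale /= ![_ * (u _ _)]mulrC ![_ * (w _ _)]mulrC.
have de : is_derive t 1 (expR \o (fun s => a * s)) (expR (a * t) * a).
  exact: is_derive1_comp.
have dc : is_derive t 1 (cos \o (fun s => b * s)) (- sin (b * t) * b).
  exact: is_derive1_comp.
have ds : is_derive t 1 (sin \o (fun s => b * s)) (cos (b * t) * b).
  exact: is_derive1_comp.
apply: is_derive_eq; rewrite !mxE /GRing.scale /=.
rewrite [X in X * (expR _ * a)](_ : _ =
  u i ord0 * cos (b * t) - w i ord0 * sin (b * t)) //.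
by ring.
Qed.

Lemma eigen_trajectory0 n (u w : 'cV[R]_n) a b : eigen_trajectory u w a b 0 = u.
Proof.
apply/matrixP=> i j; rewrite !mxE !ord1 !mulr0 expR0 cos0 sin0.
by rewrite !mul1r mul0r subr0.
Qed.

Lemma observable_invisible0 n p (A : 'M[R]_n) (M : 'M[R]_(p, n)) (u w : 'cV[R]_n) a b :
  observable A M ->
  A *m u = a *: u - b *: w -> A *m w = a *: w + b *: u ->
  M *m u = 0 -> M *m w = 0 -> u = 0.
Proof.
move=> obs Au Aw Mu Mw.
have z0 : trajectory A (fun=> 0).
  by move=> t i; rewrite mulmx0 !mxE; apply: is_derive_cst.
have := obs _ _ (eigen_trajectoryP Au Aw) z0.
rewrite eigen_trajectory0; apply=> t _; rewrite mulmx0.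
have -> : eigen_trajectory u w a b t =
    expR (a * t) *: (cos (b * t) *: u - sin (b * t) *: w).
  by apply/matrixP=> k l; rewrite !mxE !ord1.
by rewrite -scalemxAr mulmxBr -!scalemxAr Mu Mw !scaler0 subr0 scaler0.
Qed.

Lemma observable_eigen_visible n p (A : 'M[R]_n) (M : 'M[R]_(p, n)) :
  observable A M -> eigen_visible A M.
Proof.
move=> obs [a b] v Av Mv.
have [Au Aw] := complex_eigen_parts Av.
have [Mu Mw] : M *m map_mx (@complex.Re R) v = 0 /\ M *m map_mx (@complex.Im R) v = 0.
  have [<- <-] := mulmx_parts M v; rewrite Mv.
  by split; apply/matrixP=> i j; rewrite !mxE.
apply: complex_mx_parts0; first exact: observable_invisible0 obs Au Aw Mu Mw.
apply: (observable_invisible0 (w := - map_mx (@complex.Re R) v) (a := a) (b := b) obs) => //.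
- by rewrite Aw scalerN opprK.
- by rewrite mulmxN Au scalerN opprB addrC.
- by rewrite mulmxN Mu oppr0.
Qed.

Lemma trajectoryB n (A : 'M[R]_n) x z :
  trajectory A x -> trajectory A z -> trajectory A (fun t => x t - z t).
Proof.
move=> xP zP t i.
rewrite [X in is_derive _ _ X](_ : _ = (fun s => x s i ord0) - (fun s => z s i ord0)); last first.
  by apply/funext=> s; rewrite !mxE.
apply: is_derive_eq (is_deriveB (xP t i) (zP t i)) _.
by rewrite mulmxBr [RHS]mxE [X in _ = _ + X]mxE.
Qed.

Lemma trajectory_row n (A : 'M[R]_n) x (c : 'rV[R]_n) (t : R) :
  trajectory A x ->
  is_derive t (1 : R) (fun s : R => (c *m x s) ord0 ord0) ((c *m A *m x t) ord0 ord0).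
Proof.
move=> xP.
rewrite [X in is_derive _ _ X](_ : _ = \sum_(i < n) (c ord0 i \*: (fun s => x s i ord0))); last first.
  by apply/funext=> s; rewrite !mxE fct_sumE.
by rewrite -mulmxA mxE; apply: is_derive_sum => i; apply: is_deriveZ.
Qed.

(** Differentiating an output that vanishes on [t > 0] shows that [M A^k x(t)]
    vanishes there for every [k]. *)
Lemma trajectory_silent n (A : 'M[R]_n) x (c : 'rV[R]_n) :
  trajectory A x -> (forall t, 0 < t -> (c *m x t) ord0 ord0 = 0) ->
  forall t, 0 < t -> (c *m A *m x t) ord0 ord0 = 0.
Proof.
move=> xP c0 t t0; have [_ <-] := trajectory_row c t xP.
rewrite (@near_eq_derive _ _ _ _ (cst 0)) ?derive_cst //.
by near=> s; apply: c0; near: s; exact: lt_nbhsr.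
Unshelve. all: by end_near.
Qed.

(** The difference of two trajectories with equal outputs is unobservable, hence
    0, at all positive times; its value at 0 is a limit. *)
Lemma eigen_visible_observable n p (A : 'M[R]_n) (M : 'M[R]_(p, n)) :
  eigen_visible A M -> observable A M.
Proof.
move=> vis x z xP zP out.
pose d t := x t - z t.
have dP : trajectory A d := trajectoryB xP zP.
have unobs (v : 'cV[R]_n) : (forall k, M *m iter k (mulmx A) v = 0) -> v = 0.
  move=> Mv; have [/eqP v0|v0] := boolP (complex_mx v == 0).
    apply/matrixP=> i j; have /matrixP/(_ i j) := v0.
    by rewrite !mxE => /(@complexI R).
  have [k|lam [u [u0 Au Mu]]] := unobservable_eigenvector (A := complex_mx A) (M := complex_mx M) v0.
    have -> : iter k (mulmx (complex_mx A)) (complex_mx v) = complex_mx (iter k (mulmx A) v).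
      by elim: k => //= k ->; rewrite /complex_mx map_mxM.
    by rewrite /complex_mx -map_mxM Mv map_mx0.
  by move/eqP: u0; case; apply: vis Au Mu.
have dpos t : 0 < t -> d t = 0.
  move=> t0; apply: unobs => k; apply/row_matrixP=> i; rewrite row0 row_mul.
  suff : forall c : 'rV[R]_n, (forall s, 0 < s -> (c *m d s) ord0 ord0 = 0) ->
      (c *m iter k (mulmx A) (d t)) ord0 ord0 = 0.
    move=> sil; apply/matrixP=> a b; rewrite !ord1 sil ?mxE // => s s0.
    by have := out s (ltW s0); rewrite /d mulmxBr -!row_mul => ->; rewrite subrr mxE.
  elim: k => [|k IH] c c0; first exact: c0.
  by rewrite /= mulmxA IH //; apply: trajectory_silent dP c0.
apply/eqP; rewrite -subr_eq0; apply/eqP/matrixP=> i j; rewrite ord1 [RHS]mxE.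
pose g s := d s i ord0; rewrite -[LHS]/(g 0).
have [g' _] := dP 0 i.
have gc : (g s @[s --> (0 : R)^'+] --> g 0)%classic.
  by apply: cvg_at_right_filter; apply: differentiable_continuous; apply/derivable1_diffP.
have g0 : (g s @[s --> (0 : R)^'+] --> (0 : R))%classic.
  apply: cvg_near_cst; near=> s; by rewrite /g dpos ?mxE.
exact: (cvg_unique _ gc g0).
Unshelve. all: by end_near.
Qed.

End Hautus.

(** * Weighted forests of cycles have no invisible eigenvector *)

Section OrbitForest.

Import boot.fintype boot.finset.

Variables (K : numFieldType) (T : finType) (f m g : T -> T) (h : T -> nat).
Variables (J : {set T}) (p : T -> K) (lam : K) (v : T -> K).
Local Notation rt := (froot f).

Hypothesis f_inj : injective f.
Hypothesis p_gt0 : forall x, 0 < p x.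
Hypothesis p_inj : injective p.
(** Each orbit of [f] has a level [h] and, unless the level is 0, an exit [m]
    from which an edge leads to [g], in an orbit of lower level. *)
Hypothesis h_rt : forall x y, rt x = rt y -> h x = h y.
Hypothesis m_rt : forall x y, rt x = rt y -> m x = m y.
Hypothesis g_rt : forall x y, rt x = rt y -> g x = g y.
Hypothesis rt_m : forall x, rt (m x) = rt x.
Hypothesis h_g : forall x, (0 < h x)%N -> (h (g x) < h x)%N.
Hypothesis h_J : forall x, h x = 0%N -> exists2 j, j \in J & rt j = rt x.
Hypothesis vJ : forall j, j \in J -> v j = 0.
Hypothesis eigen : forall i, lam * v (f i) =
  p (rt i) * v i + \sum_(e | [&& (0 < h e)%N, m e == e & g e == f i]) v e.

Let rt_f x : rt (f x) = rt x.
Proof. by apply/esym/(fingraph.rootP (fconnect_sym f_inj)); apply: fconnect1. Qed.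

Let rt_iter k x : rt (iter k f x) = rt x.
Proof. by elim: k => //= k IH; rewrite rt_f. Qed.

Let rt_orbit x y : rt x = rt y -> exists2 k, (k < order f x)%N & y = iter k f x.
Proof.
move/(fingraph.rootP (fconnect_sym f_inj)) => xy; exists (findex f x y).
  exact: findex_max.
by rewrite iter_findex.
Qed.

Let input x e := [&& (0 < h e)%N, m e == e, rt (g e) == rt x & v e != 0].

Let eigen_closed x : (forall e, ~~ input x e) ->
  forall i, rt i = rt x -> lam * v (f i) = p (rt x) * v i.
Proof.
move=> nx i ix; rewrite eigen ix big1 ?addr0 // => e /and3P[he me ge].
have := nx e; rewrite /input he me (eqP ge) rt_f ix eqxx /= negbK.
by move/eqP.
Qed.

Let orbit_eigenvalue x : (forall e, ~~ input x e) -> v x != 0 ->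
  `|lam| = p (rt x) /\ forall y, rt y = rt x -> v y != 0.
Proof.
move=> nx vx; set q := p (rt x); have q0 : 0 < q by apply: p_gt0.
have it k : lam ^+ k * v (iter k f x) = q ^+ k * v x.
  elim: k => [|k IH]; first by rewrite !expr0.
  by rewrite iterS exprSr -mulrA (eigen_closed nx) ?rt_iter // mulrCA IH mulrA -exprS.
split; last first.
  move=> y /esym/rt_orbit[k _ ->]; apply/negP=> /eqP vk; have /eqP := it k.
  by rewrite vk mulr0 eq_sym mulf_eq0 (negPf vx) orbF expf_eq0 (gt_eqF q0) andbF.
have := it (order f x); rewrite iter_order // => /(mulIf vx) /(congr1 Num.norm).
rewrite !normrX (gtr0_norm q0) => /eqP.
by rewrite eqrXn2 ?order_gt0 ?(ltW q0) // => /eqP.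
Qed.

Let x0_ex : (exists x, v x != 0) ->
  exists2 x0, v x0 != 0 & forall x, v x != 0 -> (h x <= h x0)%N.
Proof. by case=> x vx; case: (@arg_maxnP _ x (fun y => v y != 0) h vx) => x0 vx0 mx; exists x0. Qed.

(** On an orbit of highest level among those where [v] does not vanish nothing
    enters from other orbits, so [|lam|] is its weight. As the weights are
    distinct, any other orbit in the support is fed by one of higher level, and
    so all of them lie on the chain of exits of that orbit. Down this chain each
    orbit has a single nonzero input, which spreads over the whole orbit; thus
    [v] does not vanish on the orbit of level 0 at the end, against [vJ]. *)
Lemma orbit_forest_eigen0 x : v x = 0.
Proof.
apply/eqP/negPn/negP=> vx; have [|x0 vx0 mx0] := x0_ex; first by exists x.
have input_h y e : input y e -> (h y < h e)%N.
  by case/and4P=> he _ /eqP/h_rt <- _; apply: h_g.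
have nx0 e : ~~ input x0 e.
  apply/negP=> ie; have := input_h _ _ ie; rewrite ltnNge => /negP[]; apply: mx0.
  by case/and4P: ie.
have [lamE nz0] := orbit_eigenvalue nx0 vx0.
have lam0 : lam != 0 by rewrite -normr_gt0 lamE p_gt0.
pose c k := iter k g x0.
pose pure k := forall j, (j < k)%N -> (0 < h (c j))%N.
have cS k : (0 < h (c k))%N -> (h (c k.+1) < h (c k))%N by exact: h_g.
have c_anti i j : (i <= j)%N -> pure j -> (h (c j) + (j - i) <= h (c i))%N.
  elim: j => [|j IH]; first by rewrite leqn0 => /eqP->; rewrite addn0.
  rewrite leq_eqVlt => /orP[/eqP-> _|]; first by rewrite subnn addn0.
  rewrite ltnS => ij pj; have hj := cS j (pj j (ltnSn j)).
  have := IH ij (fun k kj => pj k (leqW kj)); rewrite subSn // addnS -addSn.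
  by apply: leq_trans; rewrite leq_add2r.
(* Only the chain of orbits that starts at x0 can carry nonzero entries. *)
have chain y : v y != 0 -> exists2 k, rt y = rt (c k) & pure k.
  move: {2}(h x0 - h y)%N (leqnn (h x0 - h y)) => b.
  elim: b y => [|b IH] y hb vy.
    have ny e : ~~ input y e.
      apply/negP=> ie; have := input_h _ _ ie; have := mx0 e.
      by case/and4P: ie => _ _ _ -> /(_ isT); move: hb; lia.
    by exists 0%N => //; have [lE _] := orbit_eigenvalue ny vy; apply: p_inj; rewrite -lE lamE.
  have [/existsP[e ie]|] := boolP [exists e, input y e].
    have he := input_h _ _ ie; case/and4P: (ie) => he0 me /eqP rge ve.
    have [|k ek pk] := IH e _ ve; first by move: hb he (mx0 e ve); lia.
    exists k.+1; first by rewrite /= -(g_rt ek).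
    move=> j; rewrite ltnS leq_eqVlt => /orP[/eqP->|]; last exact: pk.
    by rewrite -(h_rt ek).
  rewrite negb_exists => /forallP ny; exists 0%N => //.
  by have [lE _] := orbit_eigenvalue ny vy; apply: p_inj; rewrite -lE lamE.
have chain_nz k : pure k -> forall y, rt y = rt (c k) -> v y != 0.
  elim: k => [_|k IH pk]; first exact: nz0.
  have hk : (0 < h (c k))%N by apply: pk.
  pose e := m (c k); have re : rt e = rt (c k) by apply: rt_m.
  have ve : v e != 0 by apply: IH => // j jk; apply: pk; apply: leqW.
  have ge : g e = c k.+1 by rewrite /= (g_rt re).
  have onlye e' : input (c k.+1) e' -> e' = e.
    case/and4P=> he' /eqP me' /eqP/h_rt hge' ve'.
    have [j rj pj] := chain e' ve'.
    have pj1 : pure j.+1.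
      by move=> i; rewrite ltnS leq_eqVlt => /orP[/eqP->|/pj //]; rewrite -(h_rt rj).
    have hh : h (c j.+1) = h (c k.+1) by rewrite -hge' (g_rt rj).
    have jk : j = k.
      apply/eqP; case: ltngtP => // lt.
        by have := c_anti j.+1 k.+1 (leqW lt) pk; rewrite hh; lia.
      by have := c_anti k.+1 j.+1 (leqW lt) pj1; rewrite hh; lia.
    by rewrite -me' (m_rt rj) jk.
  set y := c k.+1 in ge onlye *; set q := p (rt y); have q0 : 0 < q by apply: p_gt0.
  have eq1 i : rt i = rt y -> lam * v (f i) = q * v i + (if f i == y then v e else 0).
    move=> iy; rewrite eigen iy; congr (_ + _).
    rewrite (bigID (pred1 e)) /= [X in _ + X]big1 ?addr0; last first.
      move=> e' /andP[/and3P[he' me' ge'] ne]; apply/eqP; apply: contraR ne => ve'.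
      by apply/eqP/onlye; rewrite /input he' me' (eqP ge') rt_f iy eqxx.
    case: eqP => fy; last first.
      by rewrite big1 // => e' /andP[/and3P[_ _ /eqP ge'] /eqP ee]; case: fy; rewrite -ge' ee.
    rewrite (big_pred1 e) // => e'; rewrite /=; case: (eqVneq e' e) => [->|_]; rewrite ?andbF //.
    by rewrite ge fy eqxx !andbT (h_rt re) hk (m_rt re) eqxx.
  have it t : (t < order f y)%N -> lam ^+ t * v (iter t f y) = q ^+ t * v y.
    elim: t => [|t IHt] lt; first by rewrite !expr0.
    rewrite iterS exprSr -mulrA eq1 ?rt_iter //.
    have -> : (f (iter t f y) == y) = false.
      by apply/eqP; rewrite -iterS => ty; have := findex_iter lt; rewrite ty findex0.
    by rewrite addr0 mulrCA IHt ?(ltnW lt) // mulrA -exprS.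
  have vy : v y != 0.
    apply: contra ve => /eqP vy.
    pose o1 := (order f y).-1.
    have o1E : o1.+1 = order f y by rewrite prednK // order_gt0.
    have vp : v (iter o1 f y) = 0.
      have := it o1; rewrite -o1E ltnSn vy mulr0 => /(_ isT)/eqP.
      by rewrite mulf_eq0 expf_eq0 (negPf lam0) andbF => /eqP.
    have := eq1 (iter o1 f y); rewrite rt_iter -iterS o1E iter_order // eqxx vy vp.
    by rewrite !mulr0 add0r => /(_ erefl) <-.
  move=> z /esym/rt_orbit[t lt ->]; apply/negP=> /eqP vt; have /eqP := it t lt.
  by rewrite vt mulr0 eq_sym mulf_eq0 (negPf vy) orbF expf_eq0 (gt_eqF q0) andbF.
have [k pk hk] : exists2 k, pure k & h (c k) = 0%N.
  have exk : exists k, h (c k) == 0%N.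
    have [//|nk] := pselect (exists k, h (c k) == 0%N).
    have pall k : pure k by move=> j _; rewrite lt0n; apply/negP=> hj; apply: nk; exists j.
    by have := c_anti 0%N (h x0).+1 (leq0n _) (pall _); rewrite /c /=; lia.
  case: (ex_minnP exk) => k /eqP hk kmin; exists k => // j jk.
  by rewrite lt0n; apply: contraL jk => /kmin; rewrite -leqNgt.
have [j jJ rj] := h_J hk.
by have := chain_nz k pk j rj; rewrite vJ ?eqxx.
Qed.

End OrbitForest.

(** * Structural observability as a property of the digraph *)

Section StructuralObservability.

Import boot.fintype boot.finset fingroup.perm.

Variable R : realType.
Local Notation C := R[i].

Lemma identity_rows_eq0 n (J : {set 'I_n}) (v : 'cV[C]_n) :
  complex_mx (identity_rows R J) *m v = 0 <-> forall j, j \in J -> v j ord0 = 0.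
Proof.
have E k : (complex_mx (identity_rows R J) *m v) k ord0 = v (enum_val k) ord0.
  rewrite mxE (bigD1 (enum_val k)) //= big1 => [|i ik]; rewrite !mxE ?eqxx.
    by rewrite rmorph1 mul1r addr0.
  by rewrite eq_sym (negPf ik) rmorph0 mul0r.
split=> [/matrixP v0 j jJ|v0].
  by have := v0 (enum_rank_in jJ j) ord0; rewrite E enum_rankK_in // mxE.
by apply/matrixP=> k l; rewrite ord1 E mxE v0 // enum_valP.
Qed.

Section Necessity.

Variables (n : nat) (A : 'M[bool]_n) (J : {set 'I_n}) (A' : 'M[R]_n).
Hypothesis pattern : forall i j, A i j = false -> A' i j = 0.
Hypothesis visible : eigen_visible A' (identity_rows R J).

(** A state supported on the successors of [x] stays there, out of sight. *)
Lemma visible_reaches : reaches (state_edge A) J.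
Proof.
move=> x; have [/exists_inP[y yJ xy]|/exists_inPn nx] :=
    boolP [exists y in J, connect (state_edge A) x y]; first by exists y.
pose v : 'cV[C]_n := \col_i (i == x)%:R.
have vx : v != 0.
  apply/eqP=> /matrixP/(_ x ord0) /eqP; rewrite !mxE eqxx => /eqP.
  by move/eqP; rewrite oner_eq0.
have supp k i : ~~ connect (state_edge A) x i -> iter k (mulmx (complex_mx A')) v i ord0 = 0.
  elim: k i => [|k IH] i xi.
    by rewrite mxE; case: eqVneq xi => // ->; rewrite connect0.
  rewrite mxE big1 // => j _; have [xj|/IH->] := boolP (connect (state_edge A) x j); last by rewrite mulr0.
  rewrite mxE pattern ?rmorph0 ?mul0r //; apply/negP=> Aij.
  have ji : state_edge A j i by [].
  by rewrite (connect_trans xj (connect1 ji)) in xi.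
have [k|lam [u [u0 Au Mu]]] :=
    unobservable_eigenvector (A := complex_mx A') (M := complex_mx (identity_rows R J)) vx.
  by apply/identity_rows_eq0=> j jJ; apply/supp/nx.
by move/eqP: u0; case; apply: visible Au Mu.
Qed.

(** The columns of the unobserved states are linearly independent, so some
    maximal minor, hence some product of entries in it, does not vanish. *)
Lemma visible_matchable : matchable (state_edge A) (~: J).
Proof.
pose m := #|~: J|.
pose B : 'M[C]_(n, m) := colsub (fun k : 'I_m => enum_val k) (complex_mx A').
have Bfull : row_full B.
  rewrite /row_full -mxrank_tr -[_ == _]/(row_free B^T) -kermx_eq0.
  apply/eqP/row_matrixP=> i; rewrite row0.
  pose r := row i (kermx B^T).
  have rB : B *m r^T = 0.
    by rewrite -[B]trmxK -trmx_mul /r -row_mul mulmx_ker row0 trmx0.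
  pose v : 'cV[C]_n := \col_j (if [pick k : 'I_m | enum_val k == j] is Some k then r ord0 k else 0).
  have vk k : v (enum_val k) ord0 = r ord0 k.
    rewrite mxE; case: pickP => [k' /eqP/enum_val_inj-> //|/(_ k)].
    by rewrite eqxx.
  have vJ j : j \in J -> v j ord0 = 0.
    move=> jJ; rewrite mxE; case: pickP => // k /eqP kj.
    by have := enum_valP k; rewrite kj inE jJ.
  have v0 : v = 0.
    apply: (visible (lam := 0)); last exact/identity_rows_eq0.
    rewrite scale0r -[RHS]rB; apply/matrixP=> a b; rewrite ord1 !mxE.
    rewrite (bigID (fun j => j \in J)) /= big1 ?add0r => [|j jJ]; last by rewrite vJ ?mulr0.
    rewrite (eq_bigl (fun j => j \in ~: J)) => [|j]; last by rewrite inE.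
    by rewrite big_enum_val /=; apply: eq_bigr => k _; rewrite vk !mxE.
  apply/matrixP=> a k; rewrite ord1 -[LHS]/(r ord0 k) -vk v0 !mxE //.
have [f] : exists2 f : 'I_m -> 'I_n, injective f & \det (rowsub f B) != 0.
  exists (fullrankfun Bfull); first exact: fullrankfun_inj.
  by rewrite -unitfE -unitmxE; apply: fullrowsub_unit.
move=> f_inj det0.
have [s] : exists s : {perm 'I_m}, \prod_i rowsub f B (s i) i != 0.
  apply/existsP; apply: contraR det0 => /existsPn nz; apply/eqP.
  rewrite -det_tr /determinant big1 // => s _.
  rewrite (eq_bigr (fun i => rowsub f B (s i) i)) => [|i _]; last by rewrite mxE.
  by have /negPn/eqP-> := nz s; rewrite mulr0.
rewrite prodf_seq_neq0 => /allP nz.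
pose g x := if [pick k : 'I_m | enum_val k == x] is Some k then f (s k) else x.
have gE k : g (enum_val k) = f (s k).
  rewrite /g; case: pickP => [k' /eqP/enum_val_inj-> //|/(_ k)].
  by rewrite eqxx.
have ex x : x \in ~: J -> exists k : 'I_m, x = enum_val k.
  by move=> xJ; exists (enum_rank_in xJ x); rewrite enum_rankK_in.
exists g; split=> [_ _ /ex[k ->] /ex[k' ->]|_ /ex[k ->]]; rewrite !gE.
  by move=> /f_inj/perm_inj->.
have := nz k (mem_index_enum _); rewrite !mxE => nzk.
apply/negPn/negP=> /negbTE nA; move: nzk.
by rewrite pattern ?rmorph0 ?eqxx.
Qed.

End Necessity.

Section Sufficiency.

Variables (n : nat) (A : 'M[bool]_n) (J : {set 'I_n}).
Local Notation e := (state_edge A).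

(** [d] is the distance to [J]. *)
Lemma reaches_rank : reaches e J ->
  exists d : 'I_n -> nat, (forall x, d x = 0%N -> x \in J) /\
    (forall x, (0 < d x)%N -> exists2 y, e x y & (d y < d x)%N).
Proof.
move=> eJ.
pose P x k := `[< exists p, [/\ path e x p, last x p \in J & size p = k] >].
have exP x : exists k, P x k.
  have [y yJ /connectP[p xp yp]] := eJ x.
  by exists (size p); apply/asboolP; exists p; rewrite -yp.
exists (fun x => ex_minn (exP x)); split=> x.
  by case: ex_minnP => k /asboolP[p [_ pJ <-]] _ /size0nil p0; rewrite p0 in pJ.
case: ex_minnP => k /asboolP[[|y p] [/= xp pJ <-]] _ //= _.
case/andP: xp => xy yp; exists y => //; case: ex_minnP => k' _; rewrite ltnS; apply.
by apply/asboolP; exists p.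
Qed.

Section Weights.

Variables (f : 'I_n -> 'I_n) (d : 'I_n -> nat).
Hypothesis f_inj : injective f.
Hypothesis fe : {in ~: J, forall x, e x (f x)}.
Hypothesis d0 : forall x, d x = 0%N -> x \in J.
Hypothesis dS : forall x, (0 < d x)%N -> exists2 y, e x y & (d y < d x)%N.

Let rt := froot f.

Definition orbit_exit x : 'I_n := [arg min_(y < rt x | rt y == rt x) d y].

Definition orbit_next x : 'I_n :=
  if [pick y | e (orbit_exit x) y && (d y < d (orbit_exit x))%N] is Some y then y
  else orbit_exit x.

Definition orbit_weight x : nat := (enum_rank (rt x)).+1.

(** Distinct weights on the orbits of [f] give their cycles disjoint spectra;
    each orbit is linked by one edge to an orbit that is closer to [J]. *)
Definition forest_mx : 'M[R]_n := \matrix_(j, i)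
  ((if (i \notin J) && (j == f i) then (orbit_weight i)%:R else 0) +
   (if [&& (0 < d (orbit_exit i))%N, orbit_exit i == i & orbit_next i == j]
    then 1 else 0)).

Let rt_rt x : rt (rt x) = rt x.
Proof. exact: root_root (fconnect_sym f_inj) x. Qed.

Let exitP x : rt (orbit_exit x) = rt x /\
  forall y, rt y = rt x -> (d (orbit_exit x) <= d y)%N.
Proof.
rewrite /orbit_exit; case: arg_minnP => [|y /eqP yx mn]; first by rewrite rt_rt.
by split=> // z zx; apply: mn; rewrite zx.
Qed.

Let exit_rt x y : rt x = rt y -> orbit_exit x = orbit_exit y.
Proof. by rewrite /orbit_exit => ->. Qed.

Let nextP x : (0 < d (orbit_exit x))%N ->
  e (orbit_exit x) (orbit_next x) /\ (d (orbit_next x) < d (orbit_exit x))%N.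
Proof.
move=> /dS[y ey dy]; rewrite /orbit_next; case: pickP => [z /andP[] //|/(_ y)].
by rewrite ey dy.
Qed.

Lemma forest_mx_pattern i j : A i j = false -> forest_mx i j = 0.
Proof.
move=> Aij; rewrite mxE; case: ifP => [/andP[jJ /eqP ij]|_].
  by have := fe; move=> /(_ j); rewrite inE => /(_ jJ); rewrite /state_edge -ij Aij.
case: ifP => [/and3P[/nextP[ej _] /eqP jj /eqP ji]|_]; rewrite ?addr0 //.
by move: ej; rewrite jj ji /state_edge Aij.
Qed.

Lemma forest_mx_visible : eigen_visible forest_mx (identity_rows R J).
Proof.
move=> lam v Av /identity_rows_eq0 vJ; apply/matrixP=> i0 l; rewrite ord1 mxE.
apply: (@orbit_forest_eigen0 C _ f orbit_exit orbit_next (fun x => d (orbit_exit x))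
  J (fun x => (enum_rank x).+1%:R) lam (fun x => v x ord0)) => //.
- by move=> x y /eqP; rewrite eqr_nat eqSS => /eqP/val_inj/enum_rank_inj.
- by move=> x y /exit_rt->.
- by move=> x y xy; rewrite /orbit_next (exit_rt xy).
- by move=> x; have [] := exitP x.
- move=> x /nextP[_ dn]; apply: leq_ltn_trans dn.
  by have [_ mn] := exitP (orbit_next x); apply: mn.
- by move=> x /d0 xJ; exists (orbit_exit x) => //; have [] := exitP x.
move=> i; have /matrixP/(_ (f i) ord0) := Av; rewrite [RHS]mxE => <-.
rewrite mxE; under eq_bigr do rewrite !mxE rmorphD mulrDl.
rewrite big_split /=; congr (_ + _).
  rewrite (bigD1 i) //= big1 ?addr0 => [|k ki].
    rewrite eqxx andbT; case: ifP => [_|/negbFE iJ]; last by rewrite vJ ?mulr0.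
    by rewrite rmorph_nat.
  by rewrite (inj_eq f_inj) eq_sym (negPf ki) andbF rmorph0 mul0r.
rewrite [RHS]big_mkcond; apply: eq_bigr => k _.
by case: ifP; rewrite ?rmorph1 ?mul1r ?rmorph0 ?mul0r.
Qed.

End Weights.

End Sufficiency.

(** Lin's characterization of structural observability. *)
Theorem feasibleP n (A : 'M[bool]_n) (J : {set 'I_n}) :
  feasible R A J <-> reaches (state_edge A) J /\ matchable (state_edge A) (~: J).
Proof.
split=> [[A' [pat /observable_eigen_visible vis]]|[eJ /matchable_injective[f fi fe]]].
  by split; [apply: visible_reaches pat vis|apply: visible_matchable pat vis].
have [d [d0 dS]] := reaches_rank eJ.
exists (forest_mx A J f d); split; first exact: forest_mx_pattern.
exact/eigen_visible_observable/forest_mx_visible.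
Qed.

End StructuralObservability.

(** * Sensitive links and their back-ups *)

Section SensitiveLinks.

Import boot.fintype boot.finset.

Local Open Scope nat_scope.

Lemma remove_linkE n (A : 'M[bool]_n) l :
  state_edge (remove_link A l) = del_edge (state_edge A) l.
Proof. by apply/funext=> i; apply/funext=> j; rewrite /state_edge mxE. Qed.

Lemma reaches_uncovered0 n (A : 'M[bool]_n) (F : {set 'I_n}) :
  reaches (state_edge A) F -> uncovered_sinks A F = 0.
Proof.
move=> eF; apply: eq_card0 => Q; rewrite !inE; apply/negP.
move=> /andP[/andP[/imsetP[x _ QE] /forall_inP Qc] /pred0P dQ].
have [y yF /connectP[p]] := eF x.
have xQ : x \in Q by rewrite QE inE connect0.
elim: p x xQ {QE} => [|z p IH] x xQ /= xp yE.
  by have := dQ y; rewrite /= yF yE xQ.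
case/andP: xp => xz zp; apply: IH yE => //.
by have /forallP/(_ z)/implyP/(_ xz) := Qc x xQ.
Qed.

Variables (R : realType) (n : nat) (A : 'M[bool]_n) (T F : {set 'I_n}).
Variable f : 'I_n -> 'I_n.
Local Notation e := (state_edge A).
Local Notation cut_off l := [disjoint tail_reach e l & F].
Local Notation tip_critical := (critical_edge e T F f).

Hypothesis fP : matching e (~: T) f.
Hypothesis TF : T \subset F.
Hypothesis eF : reaches e F.

Implicit Types (l : 'I_n * 'I_n) (U : {set 'I_n}).

Lemma tip_criticalP l : tip_sensitive A F l <-> tip_critical l.
Proof.
rewrite /tip_sensitive tips_withinP remove_linkE.
split=> [/(unmatchable_del fP TF)[lT lf lr]|/and3P[lT /eqP lf lr]].
  by rewrite /critical_edge lT lf eqxx.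
by apply/(unmatchable_del fP TF).
Qed.

Lemma tips_within_del l : tips_within (remove_link A l) F <-> ~~ tip_critical l.
Proof.
split=> [tw|/negP nt]; first by apply/negP=> /tip_criticalP; apply.
by have [//|/tip_criticalP] := pselect (tips_within (remove_link A l) F).
Qed.

Lemma tip_critical_state_edge l : tip_critical l -> state_edge A l.1 l.2.
Proof. by case/and3P=> lT /eqP-> _; apply: fP.2; rewrite inE. Qed.

Lemma tip_critical_above l U : tip_critical l -> T \subset U ->
  matchable (del_edge e l) (~: U) <-> ~~ [disjoint release_set e T f l.1 & U].
Proof.
move=> lc TU; rewrite -{1}(critical_edgeE lc).
by case/and3P: lc => lT _ lr; apply: matchable_del_above lT lr TU.
Qed.

Lemma release_setE l : tip_critical l ->
  tip_completions A T l = release_set e T f l.1.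
Proof.
move=> lc; apply/setP=> x; rewrite inE; apply/asboolP/idP.
  rewrite tips_withinP remove_linkE => /(tip_critical_above lc (subsetUr _ _)).
  case/pred0Pn=> z /= /andP[zl]; rewrite in_setU1 => /orP[/eqP<- //|zT].
  case/and3P: lc => _ _ /release_set_disjoint/pred0P/(_ z) /=.
  by rewrite zl (subsetP TF _ zT).
move=> xl; rewrite tips_withinP remove_linkE; apply/(tip_critical_above lc (subsetUr _ _)).
by apply/pred0Pn; exists x; rewrite /= xl !inE eqxx.
Qed.

Lemma sink_completionsE l : cut_off l ->
  sink_completions A l = tail_reach e l.
Proof.
move=> dl; apply/setP=> x; rewrite /sink_completions /scc remove_linkE inE.
apply/andP/idP=> [[lx _]|lx]; first by rewrite inE.
by split; [rewrite inE in lx|apply: (tail_reach_back eF dl lx)].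
Qed.

(** Before the failure no sink component avoids [F]; after it, a vertex of such a
    component has lost its paths to [F], hence still reaches the tail of [l]. *)
Lemma cut_off_uncovered l : cut_off l ->
  uncovered_sinks (remove_link A l) F = 1.
Proof.
move=> dl; apply/eqP/cards1P; exists (tail_reach e l); apply/setP=> Q; rewrite !inE.
have tE : scc (remove_link A l) l.1 = tail_reach e l by apply: sink_completionsE.
apply/andP/eqP=> [[/andP[/imsetP[x _ QE] /forall_inP Qc] dQ]|->].
  have Qcl y : connect (del_edge e l) x y -> y \in Q.
    case/connectP=> p; have : x \in Q by rewrite QE inE connect0.
    elim: p x {QE} => [|z p IH] x xQ /= xp yE; first by rewrite yE.
    case/andP: xp => xz zp; apply: IH zp yE.
    by have /forallP/(_ z) := Qc x xQ; rewrite remove_linkE xz.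
  have : l.1 \in Q.
    apply/Qcl/(connect_tail eF) => y yF; apply/negP=> /Qcl yQ.
    by move/pred0P: dQ => /(_ y); rewrite /= yQ yF.
  rewrite -tE QE !inE => /andP[xl lx].
  apply/setP=> y; rewrite !inE; apply/andP/andP=> -[h1 h2].
    by split; [apply: connect_trans lx h1|apply: connect_trans h2 xl].
  by split; [apply: connect_trans xl h1|apply: connect_trans h2 lx].
split=> //; apply/andP; split; first by rewrite -tE; apply: imset_f.
apply/forall_inP=> x xl; apply/forallP=> y; apply/implyP; rewrite remove_linkE.
move=> /andP[exy nl]; exact: tail_reach_closed xl exy nl.
Qed.

Lemma sink_sensitiveE l : sink_sensitive A F l <-> ~~ tip_critical l /\ cut_off l.
Proof.
rewrite /sink_sensitive (reaches_uncovered0 eF) tips_within_del.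
split=> [[nt un]|[nt /cut_off_uncovered un]]; last by [].
split=> //; apply/negPn/negP=> nl.
have : reaches (state_edge (remove_link A l)) F by rewrite remove_linkE; apply/(reaches_del eF).
by move/reaches_uncovered0; rewrite un.
Qed.

Lemma feasible_del l U : F \subset U ->
  feasible R (remove_link A l) U <->
  matchable (del_edge e l) (~: U) /\ ~~ [disjoint tail_reach e l & U].
Proof.
move=> FU; rewrite feasibleP remove_linkE.
by split=> -[h1 h2]; split=> //; apply/(reaches_del eF l FU).
Qed.

Lemma sensitiveP l :
  sensitive R A F l <-> state_edge A l.1 l.2 /\ (tip_critical l || cut_off l).
Proof.
have mE : matchable (del_edge e l) (~: F) <-> ~~ tip_critical l.
  by rewrite -remove_linkE -tips_withinP tips_within_del.
rewrite /sensitive (feasible_del l (subxx F)) mE.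
split=> -[el h]; split=> //; last by case=> nt nd; case/orP: h; apply/negP.
by apply/negPn/negP; rewrite negb_or => /andP[nt nd]; apply: h.
Qed.

(** Robustness above [F] is a hitting set problem: a sensitive link can demand
    both a tip and a representative of the part that it cuts off. *)
Lemma link_robust_above U : F \subset U ->
  link_robust R A U <->
  forall l, state_edge A l.1 l.2 ->
    (tip_critical l -> ~~ [disjoint release_set e T f l.1 & U]) /\
    (cut_off l -> ~~ [disjoint tail_reach e l & U]).
Proof.
move=> FU; have TU := subset_trans TF FU.
split=> rob l el; have := rob l el; last first.
  move=> [ht hc]; apply/(feasible_del l FU); split.
    have [lc|nlc] := boolP (tip_critical l); first by apply/(tip_critical_above lc TU)/ht.
    have : matchable (del_edge e l) (~: F).
      by rewrite -remove_linkE -tips_withinP tips_within_del.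
    by apply: matchable_sub; rewrite setCS.
  have [/hc//|] := boolP (cut_off l).
  move=> /pred0Pn[z /= /andP[zl zF]]; apply/pred0Pn; exists z.
  by rewrite /= zl (subsetP FU _ zF).
move=> /(feasible_del l FU)[hm hd]; split=> // lc.
exact/(tip_critical_above lc TU).
Qed.

End SensitiveLinks.

(** * A structured layer over the machine *)

Section StructuredPrograms.

Import Defs.

Local Open Scope nat_scope.

(** The programs below only use loops that count up to a register which is
    never assigned, so that their meaning is a total function of the state and
    their cost is at most polynomial, of degree the depth of the nesting. *)
Inductive cprog : Type :=
| CSkip
| CSet of nat & expr
| CPut of nat & expr & expr & expr
| CSeq of cprog & cprog
| CIf of expr & cprog & cprog
| CFor of nat & nat & cprog.

Fixpoint compile (p : cprog) : prog :=
  match p with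
  | CSkip => Skip
  | CSet x e => Assign x e
  | CPut a e1 e2 e => Store a e1 e2 e
  | CSeq p q => Seq (compile p) (compile q)
  | CIf e p q => If e (compile p) (compile q)
  | CFor x b p =>
      Seq (Assign x (Const 0))
        (While (Less (Reg x) (Reg b))
          (Seq (compile p) (Assign x (Succ (Reg x)))))
  end.

Fixpoint sem (p : cprog) (s : machine) : machine :=
  match p with
  | CSkip => s
  | CSet x e => set_reg s x (eval s e)
  | CPut a e1 e2 e => set_arr s a (eval s e1) (eval s e2) (eval s e)
  | CSeq p q => sem q (sem p s)
  | CIf e p q => if eval s e != 0 then sem p s else sem q s
  | CFor x b p =>
      iteri (reg s b) (fun k s' => set_reg (sem p s') x k.+1) (set_reg s x 0)
  end.

Fixpoint written_regs (p : cprog) : seq nat :=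
  match p with
  | CSkip | CPut _ _ _ _ => [::]
  | CSet x _ => [:: x]
  | CSeq p q | CIf _ p q => written_regs p ++ written_regs q
  | CFor x _ p => x :: written_regs p
  end.

Fixpoint written_arrs (p : cprog) : seq nat :=
  match p with
  | CSkip | CSet _ _ => [::]
  | CPut a _ _ _ => [:: a]
  | CSeq p q | CIf _ p q => written_arrs p ++ written_arrs q
  | CFor _ _ p => written_arrs p
  end.

Fixpoint well_bounded (B : seq nat) (p : cprog) : bool :=
  match p with
  | CSkip | CPut _ _ _ _ => true
  | CSet x _ => x \notin B
  | CSeq p q | CIf _ p q => well_bounded B p && well_bounded B q
  | CFor x b p => [&& x \notin B, b \in B, x \notin written_regs p & well_bounded B p]
  end.

Fixpoint depth (p : cprog) : nat :=
  match p with
  | CSkip | CSet _ _ | CPut _ _ _ _ => 0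
  | CSeq p q | CIf _ p q => maxn (depth p) (depth q)
  | CFor _ _ p => (depth p).+1
  end.

Fixpoint weight (p : cprog) : nat :=
  match p with
  | CSkip => 1
  | CSet _ e => (cost e).+1
  | CPut _ e1 e2 e => (cost e1 + cost e2 + cost e).+1
  | CSeq p q => (weight p + weight q).+1
  | CIf e p q => (cost e + (weight p + weight q)).+1
  | CFor _ _ p => weight p + 15
  end.

Definition same_but (rs xs : seq nat) (s s' : machine) : Prop :=
  (forall y, y \notin rs -> reg s' y = reg s y) /\
  (forall a, a \notin xs -> forall i j, arr s' a i j = arr s a i j).

Lemma same_but_trans rs xs s1 s2 s3 :
  same_but rs xs s1 s2 -> same_but rs xs s2 s3 -> same_but rs xs s1 s3.
Proof.
move=> [r1 a1] [r2 a2]; split=> [y yr|a ax i j]; first by rewrite r2 ?r1.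
by rewrite a2 ?a1.
Qed.

Lemma same_but_sub rs xs rs' xs' s s' :
  {subset rs <= rs'} -> {subset xs <= xs'} ->
  same_but rs xs s s' -> same_but rs' xs' s s'.
Proof.
move=> sr sx [r a]; split=> [y yr|b bx].
  by apply: r; apply: contra yr; apply: sr.
by apply: a; apply: contra bx; apply: sx.
Qed.

Lemma same_but_chain r1 x1 r2 x2 s1 s2 s3 :
  same_but r1 x1 s1 s2 -> same_but r2 x2 s2 s3 ->
  same_but (r1 ++ r2) (x1 ++ x2) s1 s3.
Proof.
by move=> h1 h2; apply: same_but_trans (same_but_sub _ _ h1) (same_but_sub _ _ h2);
   move=> y; rewrite mem_cat => ->; rewrite ?orbT.
Qed.

Lemma same_but_set_reg rs xs s s' x v :
  x \in rs -> same_but rs xs s s' -> same_but rs xs s (set_reg s' x v).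
Proof.
move=> xr [r a]; split=> // y yr; rewrite -r //=.
by case: eqP => // yx; rewrite yx xr in yr.
Qed.

Lemma same_but_set_arr rs xs s s' a i j v :
  a \in xs -> same_but rs xs s s' -> same_but rs xs s (set_arr s' a i j v).
Proof.
move=> ax [r h]; split=> // b bx k l; rewrite -h //=.
by case: eqP => // ba; rewrite ba ax in bx.
Qed.

Lemma sem_same_but p s : same_but (written_regs p) (written_arrs p) s (sem p s).
Proof.
elim: p s => [|x e|a e1 e2 e|p IHp q IHq|e p IHp q IHq|x b p IH] s //=.
- by apply: same_but_set_reg; rewrite ?inE.
- by apply: same_but_set_arr; rewrite ?inE.
- apply: same_but_trans (same_but_sub _ _ (IHp s)) (same_but_sub _ _ (IHq _));
    by move=> y; rewrite mem_cat => ->; rewrite ?orbT.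
- case: ifP => _; [apply: same_but_sub (IHp s)|apply: same_but_sub (IHq s)];
    by move=> y; rewrite mem_cat => ->; rewrite ?orbT.
- elim: (reg s b) => [|k IHk]; first by apply: same_but_set_reg; rewrite ?inE ?eqxx.
  apply: same_but_set_reg; rewrite ?inE ?eqxx //; apply: same_but_trans IHk _.
  by apply: same_but_sub (IH _) => // y yp; rewrite inE yp orbT.
Qed.

Lemma loop_same_but x p s k :
  let s' := iteri k (fun k s' => set_reg (sem p s') x k.+1) (set_reg s x 0) in
  same_but (x :: written_regs p) (written_arrs p) s s' /\ reg s' x = k.
Proof.
elim: k => [|k [IHk _]] /=; rewrite eqxx; split=> //.
  by apply: same_but_set_reg; rewrite ?inE ?eqxx.
apply: same_but_set_reg; rewrite ?inE ?eqxx //; apply: same_but_trans IHk _.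
by apply: same_but_sub (sem_same_but p _) => // y yp; rewrite inE yp orbT.
Qed.

Lemma well_bounded_written B p x : well_bounded B p -> x \in B -> x \notin written_regs p.
Proof.
move=> + xB; elim: p => //= [y _|p IHp q IHq|_ p IHp q IHq|y b p IH].
- by rewrite inE; apply: contra => /eqP<-.
- by rewrite mem_cat negb_or => /andP[/IHp-> /IHq->].
- by rewrite mem_cat negb_or => /andP[/IHp-> /IHq->].
- case/and4P=> yB _ _ /IH xp; rewrite inE negb_or xp andbT.
  by apply: contra yB => /eqP<-.
Qed.

(** The constant 15 in the weight of a loop pays for the initialization, for
    the comparisons and increments of [N] rounds, and for the final comparison,
    as [1 <= N ^ d]. *)
Lemma exec_compile B N p s :
  well_bounded B p -> 0 < N -> (forall b, b \in B -> reg s b <= N) ->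
  exists2 t, exec s (compile p) t (sem p s) & t <= weight p * N ^ depth p.
Proof.
move=> + N0; have powN d : 0 < N ^ d by rewrite expn_gt0 N0.
have powm d d' : d <= d' -> N ^ d <= N ^ d' by move=> dd; rewrite leq_pexp2l.
elim: p s => [|x e|a e1 e2 e|p IHp q IHq|e p IHp q IHq|x b p IH] s /= wf sB.
- by exists 1; [constructor|].
- by exists (cost e).+1; [constructor|rewrite expn0 muln1].
- by exists (cost e1 + cost e2 + cost e).+1; [constructor|rewrite expn0 muln1].
- case/andP: wf => wp wq; have [t tp tb] := IHp s wp sB.
  have sB' b : b \in B -> reg (sem p s) b <= N.
    by move=> bB; rewrite (sem_same_but p s).1 ?sB // (well_bounded_written wp bB).
  have [u uq ub] := IHq _ wq sB'.
  exists (t + u).+1; first exact: ExecSeq tp uq.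
  rewrite mulSn mulnDl -addn1 addnC leq_add ?powN // leq_add //.
    by apply: leq_trans tb _; rewrite leq_mul2l powm ?leq_maxl ?orbT.
  by apply: leq_trans ub _; rewrite leq_mul2l powm ?leq_maxr ?orbT.
- case/andP: wf => wp wq; case: ifPn => [e0|/negPn/eqP e0].
    have [t tp tb] := IHp s wp sB; exists (cost e + t).+1; first exact: ExecIfTrue.
    have tb' : t <= weight p * N ^ maxn (depth p) (depth q).
      by apply: leq_trans tb _; rewrite leq_mul2l powm ?leq_maxl ?orbT.
    have := powN (maxn (depth p) (depth q)); move: tb'; set M := N ^ _; nia.
  have [t tq tb] := IHq s wq sB; exists (cost e + t).+1; first exact: ExecIfFalse.
  have tb' : t <= weight q * N ^ maxn (depth p) (depth q).
    by apply: leq_trans tb _; rewrite leq_mul2l powm ?leq_maxr ?orbT.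
  have := powN (maxn (depth p) (depth q)); move: tb'; set M := N ^ _; nia.
case/and4P: wf => xB bB xp wp; set n := reg s b; set st := (X in iteri _ X _).
have bx : b != x by apply: contra xB => /eqP<-.
have inv := loop_same_but x p s; rewrite -/st in inv.
have inB k c : c \in B -> reg (iteri k st (set_reg s x 0)) c = reg s c.
  move=> cB; rewrite (inv k).1.1 // inE negb_or (well_bounded_written wp cB) andbT.
  by apply: contra xB => /eqP<-.
have loop m k : m + k = n -> exists2 t,
    exec (iteri k st (set_reg s x 0))
      (While (Less (Reg x) (Reg b)) (Seq (compile p) (Assign x (Succ (Reg x))))) t
      (iteri n st (set_reg s x 0))
    & t <= m * (weight p * N ^ depth p + 8) + 4.
  elim: m k => [|m IHm] k mk.
    exists 4 => //; rewrite -mk; have [_ rx] := inv k.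
    by apply: (@ExecWhileFalse _ (Less (Reg x) (Reg b))); rewrite /= rx inB // -/n -mk ltnn.
  have [|t tp tb] := IH (iteri k st (set_reg s x 0)) wp.
    by move=> c cB; rewrite inB ?sB.
  have [u uw ub] := IHm k.+1 (etrans (addnS m k) mk); have [_ rx] := inv k.
  exists (3 + (t + 3).+1 + u).+1; last by rewrite mulSn; move: tb ub; lia.
  apply: (@ExecWhileTrue _ (iteri k.+1 st (set_reg s x 0)) _ (Less (Reg x) (Reg b))) => //.
    by rewrite /= rx inB // -/n -mk addSn ltnS leq_addl.
  apply: ExecSeq tp _; rewrite [iteri k.+1 _ _]/= {3}/st.
  have := ExecAssign (sem p (iteri k st (set_reg s x 0))) x (Succ (Reg x)).
  by rewrite /= (sem_same_but p _).1 // rx.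
have [t tw tb] := loop n 0 (addn0 n).
exists (2 + t).+1; first by apply: ExecSeq tw; apply: ExecAssign.
have nN : n <= N by apply: sB.
rewrite expnS; have := powN (depth p); move: tb; set M := N ^ _ => tb M0.
have : n * (weight p * M + 8) <= N * (weight p * M + 8) by rewrite leq_mul2r nN orbT.
have : 1 <= N * M by rewrite muln_gt0 N0.
have : N <= N * M by rewrite leq_pmulr.
by move: tb; rewrite !mulnDr !mulnDl !mulnA; nia.
Qed.

(** The rule for loops: a step starts from a state that differs from the
    initial one only where the body writes. *)
Lemma sem_for (I : nat -> machine -> Prop) x b p s :
  x != b -> x \notin written_regs p -> b \notin written_regs p ->
  I 0 (set_reg s x 0) ->
  (forall k s', k < reg s b -> reg s' x = k ->
     same_but (x :: written_regs p) (written_arrs p) s s' -> I k s' ->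
     I k.+1 (set_reg (sem p s') x k.+1)) ->
  I (reg s b) (sem (CFor x b p) s).
Proof.
move=> xb xp bp I0 IS /=; set st := (X in iteri _ X _).
have inv := loop_same_but x p s; rewrite -/st in inv.
have : forall k, k <= reg s b -> I k (iteri k st (set_reg s x 0)).
  by elim=> // k IH kb; have [h1 h2] := inv k; apply: IS => //; apply: IH; apply: ltnW.
exact.
Qed.

End StructuredPrograms.

(** * Search in a stored digraph *)

Notation "p ;; q" := (CSeq p q) (at level 61, right associativity) : code_scope.
Delimit Scope code_scope with code.
Bind Scope code_scope with cprog.

(** Arrays 0 to 5 and registers 0 to 2 belong to the interface of the two
    programs; the arrays from 6 on and the registers from 10 on are work space.
    Register 20 always holds the vertex under study, and register 25 the head of
    the link under study. *)
Notation exchange_arr := 6%N (only parsing).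
Notation mark_arr := 7%N (only parsing).
Notation done_arr := 8%N (only parsing).
Notation parent_arr := 9%N (only parsing).

Section Search.

Import Defs boot.fintype boot.finset.

Local Open Scope nat_scope.

Lemma sem_seq p q s : sem (p ;; q)%code s = sem q (sem p s).
Proof. by []. Qed.

Lemma sem_if e p q s :
  sem (CIf e p q) s = if eval s e != 0 then sem p s else sem q s.
Proof. by []. Qed.

Lemma sem_set x e s : sem (CSet x e) s = set_reg s x (eval s e).
Proof. by []. Qed.

Lemma sem_put a e1 e2 e s :
  sem (CPut a e1 e2 e) s = set_arr s a (eval s e1) (eval s e2) (eval s e).
Proof. by []. Qed.

Lemma sem_skip s : sem CSkip s = s.
Proof. by []. Qed.

Definition semE := (sem_seq, sem_if, sem_set, sem_put, sem_skip).

Arguments sem : simpl never.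

Variable n : nat.
Implicit Types (s : machine) (U M D X : {set 'I_n}) (E : rel 'I_n).

Lemma same_but_stores rs xs s s' a U :
  same_but rs xs s s' -> a \notin xs -> stores_set s a U -> stores_set s' a U.
Proof. by move=> [_ h] ax sU i; rewrite h. Qed.

Lemma stores_set_add s a (i : 'I_n) U :
  stores_set s a U -> stores_set (set_arr s a i 0 1) a (i |: U).
Proof.
move=> sU j; rewrite /= eqxx andbT /= in_setU1 -val_eqE /=.
by case: eqP => // _; rewrite sU.
Qed.

Lemma stores_set_del s a (i : 'I_n) U :
  stores_set s a U -> stores_set (set_arr s a i 0 0) a (U :\ i).
Proof.
move=> sU j; rewrite /= eqxx andbT /= in_setD1 -val_eqE /=.
by case: eqP => // _; rewrite sU.
Qed.

Lemma stores_set_eq s a U U' : U = U' -> stores_set s a U -> stores_set s a U'.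
Proof. by move=> ->. Qed.

Lemma sem_for_upto m b (I : nat -> machine -> Prop) x p s :
  reg s b = m -> x != b -> x \notin written_regs p -> b \notin written_regs p ->
  I 0 (set_reg s x 0) ->
  (forall (k : 'I_m) s', reg s' x = k ->
     same_but (x :: written_regs p) (written_arrs p) s s' -> I k s' ->
     I k.+1 (set_reg (sem p s') x k.+1)) ->
  I m (sem (CFor x b p) s).
Proof.
move=> sn xb xp bp I0 IS; rewrite -[m]sn; apply: sem_for => // k s' kn.
by have kn' : k < m by [rewrite -sn]; apply: (IS (Ordinal kn')).
Qed.

Definition sem_for_n I x p s := @sem_for_upto n 0 I x p s.

Definition fill a x e : cprog := CFor x 0 (CPut a (Reg x) (Const 0) e).

Lemma sem_fill a x e s U :
  reg s 0 = n -> x != 0 ->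
  (forall s' (i : 'I_n), same_but [:: x] [:: a] s s' -> reg s' x = i ->
     eval s' e = (i \in U)) ->
  stores_set (sem (fill a x e) s) a U.
Proof.
move=> sn x0 eU.
suff : forall i : 'I_n, i < n -> arr (sem (fill a x e) s) a i 0 = (i \in U).
  by move=> h i; apply: h.
apply: (sem_for_n (I := fun k s' => forall i : 'I_n, i < k -> arr s' a i 0 = (i \in U))) => //.
move=> k s' xk sb IH i; rewrite ltnS leq_eqVlt semE /= xk !eqxx andbT /=.
case: eqP => [/ord_inj-> _|_ /IH //]; exact: eU.
Qed.

Definition stores_graph s g E : Prop := forall i j : 'I_n, arr s g i j = E i j.

Definition parent_rel s E : rel 'I_n :=
  fun u v => (arr s parent_arr u 0 == v) && E v u.

(** Following the parents from a marked vertex leads back to the roots. *)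
Definition search_tree s E X M : Prop := forall u, u \in M ->
  exists p, [/\ uniq (u :: p), {subset u :: p <= M},
                path (parent_rel s E) u p & last u p \in X].

Lemma search_tree_eq s s' E X M :
  (forall i j, arr s' parent_arr i j = arr s parent_arr i j) ->
  search_tree s E X M -> search_tree s' E X M.
Proof.
move=> ss' tr u /tr[p [up sp pp lp]]; exists p; split=> //.
by rewrite (eq_path (e' := parent_rel s E)) // => v w; rewrite /parent_rel ss'.
Qed.

Lemma search_tree_add s s' E X M y v :
  y \in M -> v \notin M -> E y v ->
  arr s' parent_arr v 0 = y ->
  (forall i : 'I_n, i != v -> arr s' parent_arr i 0 = arr s parent_arr i 0) ->
  search_tree s E X M -> search_tree s' E X (v |: M).
Proof.
move=> yM vM yv vy ss' tr.
have old u : u \in M -> exists p, [/\ uniq (u :: p), {subset u :: p <= M},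
    path (parent_rel s' E) u p & last u p \in X].
  move=> /tr[p [up sp pp lp]]; exists p; split=> //.
  elim: p u sp pp {up lp} => //= w p IH u sp /andP[uw wp].
  have uv : u != v by apply: contraNneq vM => <-; apply: sp; rewrite inE eqxx.
  have -> : parent_rel s' E u w = parent_rel s E u w by rewrite /parent_rel ss'.
  rewrite uw /=; apply: IH => // z zp.
  by apply: sp; rewrite inE zp orbT.
move=> u; rewrite in_setU1 => /predU1P[->|/old[p [up sp pp lp]]]; last first.
  by exists p; split=> // z /sp zM; rewrite in_setU1 zM orbT.
have [p [up sp pp lp]] := old y yM; exists (y :: p); split=> //.
- by rewrite cons_uniq up andbT; apply: contra vM; apply: sp.
- move=> z; rewrite inE => /predU1P[->|/sp zM]; first exact: setU11.
  by rewrite in_setU1 zM orbT.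
- by rewrite /= {1}/parent_rel vy eqxx yv.
Qed.

(** Register 11 keeps its initial value [n] if no vertex is pending. *)
Definition pick_pending : cprog :=
  CFor 12 0
    (CIf (Cell mark_arr (Reg 12) (Const 0))
       (CIf (Cell done_arr (Reg 12) (Const 0)) CSkip (CSet 11 (Reg 12)))
       CSkip).

Lemma sem_pick_pending s M D :
  reg s 0 = n -> reg s 11 = n ->
  stores_set s mark_arr M -> stores_set s done_arr D ->
  let s' := sem pick_pending s in
  (reg s' 11 = n /\ M \subset D) \/
  exists i : 'I_n, [/\ reg s' 11 = i, i \in M & i \notin D].
Proof.
move=> sn s11 sM sD /=.
suff [[h1 h2]|h] : (reg (sem pick_pending s) 11 = n /\
      forall i : 'I_n, i < n -> i \in M -> i \in D) \/
    exists i : 'I_n, [/\ reg (sem pick_pending s) 11 = i, i \in M & i \notin D].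
- by left; split=> //; apply/subsetP=> i; apply: h2.
- by right.
apply: (sem_for_n (I := fun k s' => (reg s' 11 = n /\
      forall i : 'I_n, i < k -> i \in M -> i \in D) \/
    exists i : 'I_n, [/\ reg s' 11 = i, i \in M & i \notin D])) => //.
  by left.
move=> k s' xk sb IH; have sM' := same_but_stores sb isT sM.
have sD' := same_but_stores sb isT sD.
rewrite semE /= xk sM'; case: (boolP (k \in M)) => kM /=; last first.
  case: IH => [[h1 h2]|]; [left|by right]; split=> // i.
  by rewrite ltnS leq_eqVlt => /orP[/eqP/ord_inj->|/h2 //]; rewrite (negPf kM).
rewrite semE /= xk sD'; case: (boolP (k \in D)) => kD /=.
  case: IH => [[h1 h2]|]; [left|by right]; split=> // i.
  by rewrite ltnS leq_eqVlt => /orP[/eqP/ord_inj->|/h2 //].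
by right; exists k; rewrite /= xk.
Qed.

Definition visit g : cprog :=
  CFor 13 0
    (CIf (Cell g (Reg 11) (Reg 13))
       (CIf (Cell mark_arr (Reg 13) (Const 0)) CSkip
          (CPut mark_arr (Reg 13) (Const 0) (Const 1) ;;
           CPut parent_arr (Reg 13) (Const 0) (Reg 11)))
       CSkip)%code.

Lemma sem_visit g s E X M (y : 'I_n) :
  g \notin [:: mark_arr; done_arr; parent_arr] ->
  reg s 0 = n -> reg s 11 = y -> stores_graph s g E ->
  stores_set s mark_arr M -> search_tree s E X M -> y \in M ->
  let s' := sem (visit g) s in let M' := M :|: [set v | E y v] in
  stores_set s' mark_arr M' /\ search_tree s' E X M'.
Proof.
move=> gn sn s11 sE sM tr yM /=.
pose Mk k := M :|: [set v : 'I_n | (v < k) && E y v].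
have -> : M :|: [set v | E y v] = Mk n.
  by apply/setP=> v; rewrite !inE ltn_ord.
apply: (sem_for_n (I := fun k s' =>
  stores_set s' mark_arr (Mk k) /\ search_tree s' E X (Mk k))) => //.
  have -> : Mk 0 = M by apply/setP=> v; rewrite !inE orbF.
  by split=> //; apply: search_tree_eq tr.
move=> k s' xk sb [sMk trk].
have yMk : y \in Mk k by rewrite inE yM.
have sE' : stores_graph s' g E.
  move=> i j; rewrite sb.2 //; apply: contra gn; rewrite !inE.
  by do ![case/orP] => /eqP->.
have MkS : Mk k.+1 = if E y k then k |: Mk k else Mk k.
  have vkE (v : 'I_n) : (v == k) = ((v : nat) == k) by [].
  apply/setP=> v; case: ifP => Eyk; rewrite !inE ltnS leq_eqVlt ?vkE.
    by case: (eqVneq (v : nat) k) => [/ord_inj->|] //=; rewrite Eyk orbT.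
  by case: (eqVneq (v : nat) k) => [/ord_inj->|] //=; rewrite Eyk ltnn.
rewrite semE /= xk sb.1 // s11 sE' MkS; case: (boolP (E y k)) => Eyk /=; last by split.
rewrite semE /= xk sMk; case: (boolP (k \in Mk k)) => kM /=.
  have -> : k |: Mk k = Mk k by apply/setUidPr; rewrite sub1set.
  by split.
rewrite !semE /= xk (sb.1 11) // s11; split.
  move=> v; have := stores_set_add k sMk v; rewrite /= => <-.
  by [].
apply: (search_tree_add (s := s') yMk kM Eyk) => //=.
  by rewrite !eqxx.
move=> i ik; case: (eqVneq (i : nat) k) => [/ord_inj ikE|//].
by rewrite ikE eqxx in ik.
Qed.

Definition reach g : cprog :=
  (fill done_arr 12 (Const 0) ;;
   CFor 10 0
     (CSet 11 (Reg 0) ;;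
      pick_pending ;;
      CIf (Less (Reg 11) (Reg 0))
        (CPut done_arr (Reg 11) (Const 0) (Const 1) ;; visit g)
        CSkip))%code.

(** Every round treats a new vertex until all marked vertices are treated. *)
Lemma sem_reach g s E X :
  g \notin [:: mark_arr; done_arr; parent_arr] ->
  reg s 0 = n -> stores_graph s g E -> stores_set s mark_arr X ->
  let s' := sem (reach g) s in
  let M := [set v | [exists u in X, connect E u v]] in
  stores_set s' mark_arr M /\ search_tree s' E X M.
Proof.
move=> gn sn sE sX /=; rewrite sem_seq; set s1 := sem _ s.
have sb1 : same_but [:: 12] [:: done_arr] s s1 := sem_same_but (fill done_arr 12 (Const 0)) s.
have s1D : stores_set s1 done_arr (set0 : {set 'I_n}).
  by apply: sem_fill => // s' i _ _; rewrite in_set0.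
pose I k s' := exists M D : {set 'I_n},
  [/\ stores_set s' mark_arr M, stores_set s' done_arr D,
      search_tree s' E X M & [/\ X \subset M, D \subset M,
      forall u, u \in M -> [exists x in X, connect E x u],
      forall u v, u \in D -> E u v -> v \in M
      & D = M \/ k <= #|D|]].
suff : I n (sem (CFor 10 0 (CSet 11 (Reg 0) ;; pick_pending ;; CIf (Less (Reg 11) (Reg 0))
        (CPut done_arr (Reg 11) (Const 0) (Const 1) ;; visit g) CSkip))%code s1).
  move=> [M [D [sM sD tr [XM DM Mc Dc DE]]]].
  have {DE}DE : D = M.
    case: DE => // nD; apply/eqP; rewrite eqEcard DM (leq_trans _ nD) //.
    by rewrite -[X in _ <= X]card_ord max_card.
  have -> : [set v | [exists u in X, connect E u v]] = M; last by [].
  apply/setP=> v; rewrite inE; apply/idP/idP; last exact: Mc.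
  case/exists_inP=> x xX /connectP[p]; have := subsetP XM x xX.
  elim: p x {xX} => [|w p IH] x xM /= xp vE; first by rewrite vE.
  by case/andP: xp => xw wp; apply: IH wp vE; apply: (Dc x w) => //; rewrite DE.
apply: sem_for_n => //.
- by rewrite sb1.1.
- rewrite /I; exists X, set0; split.
  + exact: same_but_stores sb1 _ sX.
  + by [].
  + by move=> u uX; exists [::]; split=> // z; rewrite inE => /eqP->.
  + split=> //; first exact: sub0set.
      by move=> u uX; apply/exists_inP; exists u; rewrite ?connect0.
    by move=> u v; rewrite inE.
    by right.
move=> k s2 xk sb2 [M [D [sM sD tr [XM DM Mc Dc DE]]]].
have s2n : reg s2 0 = n by rewrite sb2.1 // sb1.1.
have s2E : stores_graph s2 g E.
  move=> i j; have g' : g \notin [:: done_arr; mark_arr; parent_arr].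
    by apply: contra gn; rewrite !inE => /or3P[]->; rewrite ?orbT.
  rewrite sb2.2; last by move: g'; rewrite /= !inE.
  by rewrite sb1.2 //; apply: contra gn; rewrite !inE => ->; rewrite orbT.
rewrite !sem_seq sem_set; set s3 := set_reg s2 11 _.
set s4 := sem pick_pending s3.
have sb4 : same_but [:: 12; 11] [::] s3 s4 := sem_same_but pick_pending s3.
have s4n : reg s4 0 = n by rewrite sb4.1.
have [[s4y MD]|[y [s4y yM yD]]] : _ \/ _ := sem_pick_pending (s := s3) s2n s2n sM sD.
  have DM' : D = M by apply/eqP; rewrite eqEsubset DM.
  rewrite sem_if /= -/s4 s4y s4n ltnn /= sem_skip.
  exists M, D; split=> //; last by split=> //; left.
  - exact: same_but_stores sb4 _ sM.
  - exact: same_but_stores sb4 _ sD.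
  - by apply: search_tree_eq tr => i j; rewrite /= sb4.2.
rewrite sem_if /= -/s4 s4y s4n ltn_ord /= sem_seq sem_put /= s4y.
set s5 := set_arr s4 _ _ _ _.
have s5M : stores_set s5 mark_arr M by exact: same_but_stores sb4 _ sM.
have s5D : stores_set s5 done_arr (y |: D).
  by apply: stores_set_add; exact: same_but_stores sb4 _ sD.
have s5E : stores_graph s5 g E.
  move=> i j; rewrite /=; case: eqP gn => [->|_ _] //=; by rewrite sb4.2 //= s2E.
have s5t : search_tree s5 E X M.
  by apply: search_tree_eq tr => i j; rewrite /= sb4.2.
have [sM' tr'] := sem_visit gn (s4n : reg s5 0 = n) (s4y : reg s5 11 = y) s5E s5M s5t yM.
have sb6 := sem_same_but (visit g) s5.
exists (M :|: [set v | E y v]), (y |: D); split=> //.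
  exact: same_but_stores sb6 _ s5D.
split.
- exact: subset_trans XM (subsetUl _ _).
- rewrite subUset sub1set inE yM /=; exact: subset_trans DM (subsetUl _ _).
- move=> u; rewrite !inE => /orP[/Mc //|yu].
  have /exists_inP[x xX xy] := Mc _ yM; apply/exists_inP; exists x => //.
  exact: connect_trans xy (connect1 yu).
- move=> u v; rewrite !inE => /orP[/eqP-> ->|uD /(Dc _ _ uD)->] //.
  by rewrite orbT.
right; rewrite cardsU1 yD add1n ltnS; case: DE => // DM'.
by rewrite DM' yM in yD.
Qed.

End Search.

(** * Computing a matching *)

Notation partner_arr := 10%N (only parsing).
Notation matched_arr := 11%N (only parsing).
Notation free_arr := 12%N (only parsing).

Section ComputeMatching.

Import Defs boot.fintype boot.finset.

Local Open Scope nat_scope.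

Arguments sem : simpl never.

Variable n : nat.
Implicit Types (s : machine) (T U M D X : {set 'I_n}) (E : rel 'I_n) (f : 'I_n -> 'I_n).

Definition stores_partners s D f : Prop :=
  forall i : 'I_n, i \in D -> arr s partner_arr i 0 = f i.

Definition stores_matching s D f : Prop :=
  stores_set s matched_arr D /\ stores_partners s D f.

Lemma same_but_graph rs xs s s' g E :
  same_but rs xs s s' -> g \notin xs -> stores_graph s g E -> stores_graph s' g E.
Proof. by move=> [_ h] gx sE i j; rewrite h. Qed.

Lemma same_but_partners rs xs s s' D f :
  same_but rs xs s s' -> partner_arr \notin xs ->
  stores_partners s D f -> stores_partners s' D f.
Proof. by move=> [_ h] gx sf i iD; rewrite h ?sf. Qed.

Lemma same_but_matching rs xs s s' D f :
  same_but rs xs s s' -> partner_arr \notin xs -> matched_arr \notin xs ->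
  stores_matching s D f -> stores_matching s' D f.
Proof.
move=> sb px mx [sD sf]; split; first exact: same_but_stores sb mx sD.
exact: same_but_partners sb px sf.
Qed.

(* The possibly meaningless cell of an unmatched vertex is guarded by the
   comparison with its flag. *)
Definition exchange_row : cprog :=
  CFor 13 0
    (CPut exchange_arr (Reg 12) (Reg 13)
       (Less (Equal (Cell 0 (Reg 12) (Cell partner_arr (Reg 13) (Const 0))) (Const 0))
             (Cell matched_arr (Reg 13) (Const 0)))).

Definition exchange_table : cprog := CFor 12 0 exchange_row.

Lemma sem_exchange_table s E D f :
  reg s 0 = n -> stores_graph s 0 E -> stores_matching s D f ->
  stores_graph (sem exchange_table s) exchange_arr (exchange E D f).
Proof.
move=> sn sE sf.
suff : forall i j : 'I_n, i < n -> arr (sem exchange_table s) exchange_arr i j = exchange E D f i j.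
  by move=> h i j; apply: h.
apply: (sem_for_n (I := fun k s' => forall i j : 'I_n, i < k ->
  arr s' exchange_arr i j = exchange E D f i j)) => //.
move=> k s1 xk sb1 IH.
suff : forall i j : 'I_n, (i < k) || ((i : nat) == k) && (j < n) ->
    arr (sem exchange_row s1) exchange_arr i j = exchange E D f i j.
  move=> h i j; rewrite ltnS leq_eqVlt => ik; apply: h.
  by rewrite ltn_ord andbT orbC.
apply: (sem_for_n (I := fun k' s' => forall i j : 'I_n,
  (i < k) || ((i : nat) == k) && (j < k') ->
  arr s' exchange_arr i j = exchange E D f i j)) => //.
- by rewrite sb1.1.
- by move=> i j; rewrite andbF orbF; apply: IH.
move=> k' s2 xk' sb2 IH' i j; rewrite ltnS [j <= _]leq_eqVlt semE /= xk' !(sb2.1 12) // xk.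
case: (eqVneq (i : nat) k) => [/ord_inj ik|ik] /=; last first.
  by rewrite orbF => lt; rewrite IH' ?lt.
rewrite ik ?eqxx ?ltnn /=; case: (eqVneq (j : nat) k') => [/ord_inj jk _|jk /= lt]; last first.
  by rewrite IH' // eqxx lt orbT.
have [sD' sf'] := same_but_matching (same_but_chain sb1 sb2) isT isT sf.
rewrite sD' jk /exchange; case: (boolP (k' \in D)) => kD; last by rewrite ltn0.
have sE' : stores_graph s2 0 E.
  exact: (same_but_graph (g := 0) (same_but_chain sb1 sb2)).
by rewrite sf' // sE'; case: (E k (f k')).
Qed.

Lemma unmatched_upto D f (k : 'I_n) :
  [set y | unmatched [set i in D | i < k.+1] f y] =
  if k \in D then [set y | unmatched [set i in D | i < k] f y] :\ f k
  else [set y | unmatched [set i in D | i < k] f y].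
Proof.
have E : [set i in D | i < k.+1] = if k \in D then k |: [set i in D | i < k] else [set i in D | i < k].
  apply/setP=> i; rewrite inE ltnS leq_eqVlt.
  case: (boolP (k \in D)) => kD; rewrite !inE;
    case: (eqVneq (i : nat) k) => [/ord_inj->|ik] /=; rewrite ?kD ?eqxx ?(negPf kD) ?andbF //.
  by case: (eqVneq i k) ik => [->|]; rewrite ?eqxx.
rewrite E; case: ifP => // kD; apply/setP=> y; rewrite in_setD1 !in_set /unmatched.
by rewrite imsetU1 in_setU1 negb_or.
Qed.

Definition free_table : cprog :=
  (fill free_arr 13 (Const 1) ;;
   CFor 13 0
     (CIf (Cell matched_arr (Reg 13) (Const 0))
        (CPut free_arr (Cell partner_arr (Reg 13) (Const 0)) (Const 0) (Const 0))
        CSkip))%code.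

Lemma sem_free_table s D f :
  reg s 0 = n -> stores_matching s D f ->
  stores_set (sem free_table s) free_arr [set y | unmatched D f y].
Proof.
move=> sn sf; rewrite sem_seq; set s1 := sem _ s.
have sb1 : same_but [:: 13] [:: free_arr] s s1 := sem_same_but (fill free_arr 13 (Const 1)) s.
have s1U : stores_set s1 free_arr (setT : {set 'I_n}).
  by apply: sem_fill => // s' i _ _; rewrite in_setT.
pose Uk k := [set y | unmatched [set i in D | i < k] f y].
have -> : [set y | unmatched D f y] = Uk n.
  have DE : [set i in D | i < n] = D by apply/setP=> i; rewrite inE ltn_ord andbT.
  by rewrite /Uk DE.
apply: (sem_for_n (I := fun k s' => stores_set s' free_arr (Uk k))) => //.
- by rewrite sb1.1.
- apply: stores_set_eq s1U; apply/setP=> y; rewrite !inE; apply/esym/imsetP.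
  by case=> i; rewrite inE andbF.
move=> k s2 xk sb2 IH; have sb := same_but_chain sb1 sb2.
have [sD sp] := same_but_matching sb isT isT sf.
rewrite semE /= xk sD /Uk unmatched_upto; case: (boolP (k \in D)) => kD /=; last exact: IH.
by rewrite semE /= xk sp //; apply: (stores_set_del (f k) IH).
Qed.

Definition pick_free_head : cprog :=
  CFor 13 0
    (CIf (Cell mark_arr (Reg 12) (Const 0))
       (CIf (Cell free_arr (Reg 13) (Const 0))
          (CIf (Cell 0 (Reg 12) (Reg 13))
             (CSet 21 (Reg 12) ;; CSet 22 (Reg 13))
             CSkip)
          CSkip)
       CSkip)%code.

Definition pick_free : cprog := CFor 12 0 pick_free_head.

(** The pair found is the last one in the lexicographic order; the invariant
    only records that it is good. *)
Lemma sem_pick_free s E M U :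
  reg s 0 = n -> stores_graph s 0 E ->
  stores_set s mark_arr M -> stores_set s free_arr U ->
  (exists u y, [&& u \in M, y \in U & E u y]) ->
  exists u y : 'I_n, [/\ reg (sem pick_free s) 21 = u, reg (sem pick_free s) 22 = y
    & [&& u \in M, y \in U & E u y]].
Proof.
move=> sn sE sM sU [u0 [y0 uy0]].
pose good u y := [&& u \in M, y \in U & E u y].
pose I (P : 'I_n -> 'I_n -> bool) s' :=
  (exists u y : 'I_n, [/\ reg s' 21 = u, reg s' 22 = y & good u y]) \/
  forall u y : 'I_n, P u y -> ~~ good u y.
have H : I (fun u y => u < n) (sem pick_free s).
  apply: (sem_for_n (I := fun k s' => I (fun u y : 'I_n => u < k) s')) => //.
    by right.
  move=> k s1 xk sb1 IH1.
  have s1n : reg s1 0 = n by rewrite sb1.1.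
  suff H : I (fun u y : 'I_n => (u < k) || ((u : nat) == k) && (y < n)) (sem pick_free_head s1).
    case: H => [h|h]; [by left|right] => u y uk; apply: h.
    by rewrite ltn_ord andbT orbC -leq_eqVlt -ltnS.
  apply: (sem_for_n (I := fun k' s' =>
      I (fun u y : 'I_n => (u < k) || ((u : nat) == k) && (y < k')) s')) => //.
    by case: IH1 => [h|h]; [by left|right] => u y; rewrite andbF orbF; apply: h.
  move=> k' s2 xk' sb2 IH2.
  have xk2 : reg s2 12 = k by rewrite sb2.1.
  have sb := same_but_chain sb1 sb2.
  have sM' := same_but_stores sb isT sM; have sU' := same_but_stores sb isT sU.
  have sE' : stores_graph s2 0 E by exact: (same_but_graph sb).
  have skip s3 : ~~ good k k' -> reg s3 21 = reg s2 21 -> reg s3 22 = reg s2 22 ->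
      I (fun u y : 'I_n => (u < k) || ((u : nat) == k) && (y < k'.+1)) s3.
    move=> ng r1 r2; case: IH2 => [[u [y [h1 h2 h3]]]|h].
      by left; exists u, y; rewrite r1 r2.
    right=> u y /orP[uk|]; first by apply: h; rewrite uk.
    case/andP=> /eqP/ord_inj->; rewrite ltnS leq_eqVlt => /orP[/eqP/ord_inj->//|yk].
    by apply: h; rewrite eqxx yk orbT.
  rewrite semE /= xk2 sM'; case: (boolP (k \in M)) => kM /=; last first.
    by apply: skip => //; rewrite /good (negPf kM).
  rewrite semE /= xk' sU'; case: (boolP (k' \in U)) => kU /=; last first.
    by apply: skip => //; rewrite /good (negPf kU) andbF.
  rewrite semE /= xk2 xk' sE'; case: (boolP (E k k')) => kE /=; last first.
    by apply: skip => //; rewrite /good (negPf kE) !andbF.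
  by left; exists k, k'; rewrite !semE /= xk2 xk' /good kM kU kE.
case: H => [//|h]; by have := h u0 y0 (ltn_ord u0); rewrite /good uy0.
Qed.

Definition walk_back : cprog :=
  CFor 12 0
    (CIf (Reg 23)
       (CSet 24 (Cell partner_arr (Reg 21) (Const 0)) ;;
        CPut partner_arr (Reg 21) (Const 0) (Reg 22) ;;
        CIf (Equal (Reg 21) (Reg 20))
          (CSet 23 (Const 0))
          (CSet 22 (Reg 24) ;; CSet 21 (Cell parent_arr (Reg 21) (Const 0))))
       CSkip)%code.

Lemma parent_path_update s E D f u y p z :
  u \notin z :: p ->
  path (parent_rel s (exchange E D f)) z p ->
  path (parent_rel s (exchange E D (update f u y))) z p.
Proof.
elim: p z => //= w p IH z; rewrite inE negb_or => /andP[uz up] /andP[zw wp].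
have zu : (z == u) = false by rewrite eq_sym (negPf uz).
by rewrite IH // andbT; move: zw; rewrite /parent_rel /exchange /update zu.
Qed.

(** The augmentation of [augment_path], performed from the free end. *)
Lemma sem_walk_back s E D f (x u y : 'I_n) q :
  reg s 0 = n -> reg s 20 = x -> reg s 21 = u -> reg s 22 = y -> reg s 23 = 1 ->
  x \notin D -> matching E D f -> stores_partners s D f ->
  unmatched D f y -> E u y -> uniq (u :: q) ->
  path (parent_rel s (exchange E D f)) u q -> last u q = x ->
  exists f', matching E (x |: D) f' /\ stores_partners (sem walk_back s) (x |: D) f'.
Proof.
move=> sn s20 s21 s22 s23 xD fP sf yf uy uq qp lq.
pose I k s' :=
  (reg s' 23 = 0 /\
   exists f', matching E (x |: D) f' /\ stores_partners s' (x |: D) f') \/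
  (reg s' 23 = 1 /\ exists (u y : 'I_n) f q,
    [/\ reg s' 21 = u, reg s' 22 = y, matching E D f, stores_partners s' D f
      & [/\ unmatched D f y, E u y, uniq (u :: q) & size q + k < n]] /\
    path (parent_rel s (exchange E D f)) u q /\ last u q = x).
suff : I n (sem walk_back s).
  case=> [[_ //]|[_ [u' [y' [f' [q' [[_ _ _ _ [_ _ _]]]]]]]]].
  by rewrite ltnNge leq_addl.
apply: sem_for_n => //.
  right; split=> //; exists u, y, f, q; split=> //; split=> //; split=> //.
  by rewrite addn0; have := max_card (mem (u :: q)); rewrite card_ord (card_uniqP uq).
move=> k s1 xk sb1 [[s1z [f' [f'P sf']]]|[s1o [u' [y' [f' [q' [[h1 h2 f'P sf' [yf' uy' uq' sq]] [qp' lq']]]]]]]].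
  by left; rewrite semE /= s1z /= semE; split=> //; exists f'.
rewrite semE /= s1o /= !semE /= h1 h2 (sb1.1 20) // s20.
case: (eqVneq (u' : nat) x) => [/ord_inj ux|ux] /=.
  rewrite ?semE /=; left; split=> //; exists (update f' x y'); split.
    rewrite -ux in xD *; apply: matching_update => //.
      by apply: matching_sub f'P; apply: subD1set.
    by apply: contra yf' => /imsetP[w]; rewrite in_setD1 => /andP[_ wD] ->; apply: imset_f.
  move=> i; rewrite in_setU1 /= /update ux.
  case: (eqVneq i x) => [->|ix] /=; first by rewrite eqxx.
  move=> iD; case: (eqVneq (i : nat) x) => [/ord_inj ixE|_] /=; first by rewrite ixE eqxx in ix.
  exact: sf'.
case: q' => [|w q'] in uq' sq qp' lq' *; first by rewrite -lq' /= eqxx in ux.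
move: qp' => /= /andP[/andP[pw /andP[uD ew]] wp].
have [uw wq] : u' \notin w :: q' /\ uniq (w :: q') by move: uq' => /andP[].
have [g1 g2] := augment_step f'P uD yf' uy'.
rewrite ?semE /=; right; split=> //.
exists w, (f' u'), (update f' u' y'), q'; split; last by split=> //; apply: parent_path_update wp.
split=> //.
- by rewrite /= sb1.2 // (eqP pw).
- exact: sf'.
- move=> i iD; rewrite /update /=; case: (eqVneq i u') => [->|iu] /=; first by rewrite eqxx.
  case: (eqVneq (i : nat) u') => [/ord_inj iuE|_] /=; first by rewrite iuE eqxx in iu.
  exact: sf'.
- by split=> //; rewrite addnS -addSn.
Qed.

Definition mark_self : cprog := fill mark_arr 12 (Equal (Reg 12) (Reg 20)).

Lemma sem_mark_self s (a : 'I_n) :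
  reg s 0 = n -> reg s 20 = a -> stores_set (sem mark_self s) mark_arr [set a].
Proof.
move=> sn sa; apply: sem_fill => // s' i sb xi; rewrite /= xi sb.1 // sa in_set1.
by congr nat_of_bool; apply/eqP/eqP=> [/ord_inj|->].
Qed.

Definition augment : cprog :=
  (exchange_table ;;
   free_table ;;
   mark_self ;;
   reach exchange_arr ;;
   pick_free ;;
   CSet 23 (Const 1) ;;
   walk_back ;;
   CPut matched_arr (Reg 20) (Const 0) (Const 1))%code.

Lemma reach_set1 E (x : 'I_n) :
  [set v | [exists u in [set x], connect E u v]] = [set v | connect E x v].
Proof.
apply/setP=> v; rewrite !in_set; apply/exists_inP/idP => [[u]|xv].
  by rewrite in_set1 => /eqP->.
by exists x; rewrite ?set11.
Qed.

(** Without an augmenting path from [x], the matching could not be extended to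
    [D'], by [blocked_reach]. *)
Lemma sem_augment s E D f D' (x : 'I_n) :
  reg s 0 = n -> reg s 20 = x -> stores_graph s 0 E ->
  matching E D f -> stores_matching s D f ->
  x \notin D -> x |: D \subset D' -> matchable E D' ->
  exists f', matching E (x |: D) f' /\ stores_matching (sem augment s) (x |: D) f'.
Proof.
move=> sn s20 sE fP sf xD sD' D'P.
rewrite /augment sem_seq; set s1 := sem exchange_table s.
have sb1 := sem_same_but exchange_table s; rewrite -/s1 in sb1.
have H1 : stores_graph s1 exchange_arr (exchange E D f) by apply: sem_exchange_table.
have sf1 := same_but_matching sb1 isT isT sf.
rewrite sem_seq; set s2 := sem free_table s1.
have sb2 := sem_same_but free_table s1; rewrite -/s2 in sb2.
have U2 : stores_set s2 free_arr [set y | unmatched D f y].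
  by apply: sem_free_table => //; rewrite sb1.1.
have sb02 := same_but_chain sb1 sb2.
rewrite sem_seq; set s3 := sem mark_self s2.
have sb3 := sem_same_but mark_self s2; rewrite -/s3 in sb3.
have M3 : stores_set s3 mark_arr [set x].
  by apply: sem_mark_self; rewrite sb02.1.
have sb03 := same_but_chain sb02 sb3.
rewrite sem_seq; set s4 := sem (reach exchange_arr) s3.
have sb4 := sem_same_but (reach exchange_arr) s3; rewrite -/s4 in sb4.
have s3n : reg s3 0 = n by rewrite sb03.1.
have H3 : stores_graph s3 exchange_arr (exchange E D f).
  by exact: (same_but_graph (same_but_chain sb2 sb3)).
have [M4 T4] := sem_reach (g := exchange_arr) isT s3n H3 M3.
rewrite reach_set1 -/s4 -/(exchange_reach E D f x) in M4 T4.
have sb04 := same_but_chain sb03 sb4.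
have s4n : reg s4 0 = n by rewrite sb04.1.
have E4 : stores_graph s4 0 E by exact: (same_but_graph sb04).
have U4 : stores_set s4 free_arr [set y | unmatched D f y].
  by exact: (same_but_stores (same_but_chain sb3 sb4)).
have ex : exists u y, [&& u \in exchange_reach E D f x, y \in [set y | unmatched D f y] & E u y].
  have [/existsP[u /existsP[y h]]|nx] := boolP [exists u, [exists y,
      [&& u \in exchange_reach E D f x, y \in [set y | unmatched D f y] & E u y]]].
    by exists u, y.
  case: (blocked_reach (e := E) (x := x) (D' := D') fP xD _ _ D'P).
    move=> i y ix iy; apply: contra nx => yf; apply/existsP; exists i; apply/existsP; exists y.
    by rewrite ix iy in_set yf.
  exact: subset_trans (exchange_reach_sub E D f x) sD'.
rewrite sem_seq; set s5 := sem pick_free s4.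
have sb5 := sem_same_but pick_free s4; rewrite -/s5 in sb5.
have [u [y [s5u s5y /and3P[ux yU uy]]]] := sem_pick_free s4n E4 M4 U4 ex.
rewrite -/s5 in s5u s5y.
have sb05 := same_but_chain sb04 sb5.
rewrite sem_seq sem_set; set s6 := set_reg s5 23 _.
have [q [uq _ qp lq]] := T4 u ux.
rewrite sem_seq sem_put; set s7 := sem walk_back s6.
have sb7 := sem_same_but walk_back s6; rewrite -/s7 in sb7.
have s620 : reg s6 20 = x by rewrite /= sb05.1.
have s6n : reg s6 0 = n by rewrite /= sb05.1.
have sf6 : stores_partners s6 D f.
  by move=> i iD; rewrite /= sb05.2 //; apply: sf.2.
have qp6 : path (parent_rel s6 (exchange E D f)) u q.
  by rewrite (eq_path (e' := parent_rel s4 (exchange E D f))) // => v w; rewrite /parent_rel /= sb5.2.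
rewrite in_set in yU; rewrite in_set1 in lq.
have [f' [f'P sf']] := sem_walk_back s6n s620 s5u s5y erefl xD fP sf6 yU uy uq qp6 (eqP lq).
exists f'; split=> //; rewrite -/s7 in sf'; split; last first.
  by move=> i iD; rewrite /= sf'.
have -> : eval s7 (Reg 20) = x by rewrite /= sb7.1.
apply: stores_set_add; apply: (same_but_stores sb7) => //.
have h5 : stores_set s5 matched_arr D by apply: (same_but_stores sb05) sf.1.
exact: h5.
Qed.

Definition compute_matching : cprog :=
  (fill matched_arr 12 (Const 0) ;;
   CFor 20 0 (CIf (Cell 2 (Reg 20) (Const 0)) CSkip augment))%code.

Lemma sem_compute_matching s E T :
  reg s 0 = n -> stores_graph s 0 E -> stores_set s 2 T -> matchable E (~: T) ->
  exists f, matching E (~: T) f /\ stores_matching (sem compute_matching s) (~: T) f.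
Proof.
move=> sn sE sT TP; rewrite /compute_matching sem_seq; set s1 := sem _ s.
have sb1 : same_but [:: 12] [:: matched_arr] s s1 := sem_same_but (fill matched_arr 12 (Const 0)) s.
have s1D : stores_set s1 matched_arr (set0 : {set 'I_n}).
  by apply: sem_fill => // s' i _ _; rewrite in_set0.
pose Dk k := [set i in ~: T | i < k].
have <- : Dk n = ~: T by apply/setP=> i; rewrite !inE ltn_ord andbT.
apply: (sem_for_n (I := fun k s' => exists f, matching E (Dk k) f /\ stores_matching s' (Dk k) f)) => //.
- by rewrite sb1.1.
- exists id; have -> : Dk 0 = set0 by apply/setP=> i; rewrite !inE andbF.
  split; first by split=> x; rewrite inE.
  by split=> // i; rewrite inE.
move=> k s2 xk sb2 [f [fP sf]].
have sb := same_but_chain sb1 sb2.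
have sT' : stores_set s2 2 T by exact: (same_but_stores sb).
have DkS : Dk k.+1 = if k \in T then Dk k else k |: Dk k.
  have vkE (i : 'I_n) : (i == k) = ((i : nat) == k) by [].
  case: (boolP (k \in T)) => kT; apply/setP=> i; rewrite !inE ltnS leq_eqVlt ?vkE.
    by case: (eqVneq (i : nat) k) => [/ord_inj->|] //=; rewrite kT.
  by case: (eqVneq (i : nat) k) => [/ord_inj->|] //=; rewrite kT.
rewrite sem_if /= xk sT' DkS; case: (boolP (k \in T)) => kT /=.
  by exists f; rewrite sem_skip.
have kDk : k \notin Dk k by rewrite !inE ltnn andbF.
have sDk : k |: Dk k \subset ~: T.
  apply/subsetP=> i; rewrite in_setU1 => /predU1P[->|]; first by rewrite inE.
  by rewrite inE => /andP[].
have s2n : reg s2 0 = n by rewrite sb.1.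
have s2E : stores_graph s2 0 E by exact: (same_but_graph sb).
have [f' [f'P [h1 h2]]] := sem_augment s2n xk s2E fP sf kDk sDk TP.
by exists f'.
Qed.

End ComputeMatching.

(** * Computing the covering problem *)

Notation link_arr := 3%N (only parsing).
Notation cover_arr := 4%N (only parsing).
Notation critical_arr := 14%N (only parsing).

Section Construct.

Import Defs boot.fintype boot.finset.

Local Open Scope nat_scope.

Arguments sem : simpl never.

Variable n : nat.
Implicit Types (s : machine) (T F U M D X : {set 'I_n}) (E : rel 'I_n) (f : 'I_n -> 'I_n).
Implicit Types (l : 'I_n * 'I_n).

(** Register 26 collects the verdict of an existential test: the body sets it
    to 1 at a witness and leaves it alone otherwise. *)
Lemma sem_test (P : pred 'I_n) x p s :
  reg s 0 = n -> x != 0 -> x != 26 -> x \notin written_regs p -> 0 \notin written_regs p ->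
  (forall (k : 'I_n) s', same_but (x :: written_regs p) (written_arrs p) s s' ->
     reg s' x = k -> reg (sem p s') 26 = if P k then 1 else reg s' 26) ->
  reg (sem (CFor x 0 p) s) 26 = if [exists k, P k] then 1 else reg s 26.
Proof.
move=> sn x0 x26 xp p0 IP.
have -> : [exists k, P k] = [exists k : 'I_n, (k < n) && P k].
  by apply: eq_existsb => k; rewrite ltn_ord.
apply: (sem_for_n (I := fun m s' => reg s' 26 = if [exists k : 'I_n, (k < m) && P k] then 1 else reg s 26)) => //.
  by rewrite /= eq_sym (negPf x26); case: existsP => // -[k].
move=> k s' xk sb IH; rewrite /= eq_sym (negPf x26) (IP k s' sb xk) IH.
case: (boolP (P k)) => Pk.
  by case: existsP => // -[]; exists k; rewrite ltnSn Pk.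
rewrite [in RHS](eq_existsb (P2 := fun i : 'I_n => (i < k) && P i)) // => i.
rewrite ltnS leq_eqVlt; case: (eqVneq (i : nat) k) => [/ord_inj->|] //=.
by rewrite (negPf Pk) andbF.
Qed.

(** The covering problem as a list of links, each with its set of back-ups, which
    grows by one entry at a time. *)
Definition stores_entries s (LL : seq (('I_n * 'I_n) * {set 'I_n})) : Prop :=
  reg s 1 = size LL /\ forall d k, k < size LL ->
    [/\ arr s link_arr k 0 = (nth d LL k).1.1, arr s link_arr k 1 = (nth d LL k).1.2
      & forall j : 'I_n, arr s cover_arr j k = (j \in (nth d LL k).2)].

Lemma same_but_entries rs xs s s' LL :
  same_but rs xs s s' -> 1 \notin rs -> link_arr \notin xs -> cover_arr \notin xs ->
  stores_entries s LL -> stores_entries s' LL.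
Proof.
move=> [hr ha] r1 a3 a4 [sz en]; split=> [|d k /(en d)[h1 h2 h3]]; first by rewrite hr.
by split=> [||j]; rewrite ha.
Qed.

Definition copy_marks : cprog :=
  CFor 12 0 (CPut cover_arr (Reg 12) (Reg 1) (Cell mark_arr (Reg 12) (Const 0))).

Definition record_link : cprog :=
  (CPut link_arr (Reg 1) (Const 0) (Reg 20) ;;
   CPut link_arr (Reg 1) (Const 1) (Reg 25) ;;
   copy_marks ;;
   CSet 1 (Succ (Reg 1)))%code.

Lemma sem_record_link s LL (a b : 'I_n) M :
  reg s 0 = n -> reg s 20 = a -> reg s 25 = b -> stores_set s mark_arr M ->
  stores_entries s LL ->
  stores_entries (sem record_link s) (rcons LL ((a, b), M)).
Proof.
move=> sn s20 s25 sM [sz en]; rewrite /record_link !sem_seq !sem_put sem_set.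
set s2 := set_arr _ _ _ _ _; set s3 := sem _ s2.
have sb3 : same_but [:: 12] [:: cover_arr] s2 s3 :=
  sem_same_but copy_marks s2.
have s31 : reg s3 1 = size LL by rewrite sb3.1.
have H : forall j : 'I_n, j < n ->
    arr s3 cover_arr j (size LL) = (j \in M) /\
    forall k, k < size LL -> arr s3 cover_arr j k = arr s cover_arr j k.
  move=> j jn; suff [] : (forall j : 'I_n, j < n -> arr s3 cover_arr j (size LL) = (j \in M)) /\
      forall (j : 'I_n) k, k < size LL -> arr s3 cover_arr j k = arr s cover_arr j k.
    by move=> h1 h2; split=> [|k]; [apply: h1|apply: h2].
  apply: (sem_for_n (I := fun m s' =>
     (forall j : 'I_n, j < m -> arr s' cover_arr j (size LL) = (j \in M)) /\
      forall (j : 'I_n) k, k < size LL -> arr s' cover_arr j k = arr s cover_arr j k)) => //.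
  move=> k s' xk sb [IH1 IH2]; rewrite semE /= xk (sb.1 1) //= sz; split.
    move=> i; rewrite ltnS leq_eqVlt eqxx andbT /=.
    case: (eqVneq (i : nat) k) => [/ord_inj-> _|_ /IH1 //].
    by rewrite sb.2 //= sM.
  move=> i k' lk; rewrite (ltn_eqF lk) andbF; exact: IH2.
split=> [|d k]; first by rewrite /= s31 size_rcons.
rewrite size_rcons ltnS leq_eqVlt nth_rcons => /orP[/eqP->|lk].
  rewrite ltnn eqxx /=; split.
  - by rewrite /= sb3.2 //= sz ?eqxx /= ?andbF.
  - by rewrite /= sb3.2 //= sz ?eqxx /=.
  - by move=> j; have [h _] := H j (ltn_ord j); apply: h.
rewrite lk; have [h1 h2 h3] := en d k lk; split.
- by rewrite /= sb3.2 //= sz (ltn_eqF lk) /=.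
- by rewrite /= sb3.2 //= sz (ltn_eqF lk) /=.
- by move=> j; rewrite /=; have [_ ->] := H j (ltn_ord j).
Qed.

Lemma stores_graph_del s g E (a b : 'I_n) :
  stores_graph s g E -> stores_graph (set_arr s g a b 0) g (del_edge E (a, b)).
Proof.
move=> sE i j; rewrite /= eqxx /= /del_edge xpair_eqE.
have <- : ((i : nat) == a) = (i == a) by [].
have <- : ((j : nat) == b) = (j == b) by [].
by case: (_ && _); rewrite ?andbF // andbT sE.
Qed.

Lemma stores_graph_restore s g E (a b : 'I_n) :
  E a b -> stores_graph s g (del_edge E (a, b)) -> stores_graph (set_arr s g a b 1) g E.
Proof.
move=> ab sE i j; rewrite /= eqxx /=; case: andP => [[/eqP/ord_inj-> /eqP/ord_inj->]|nab].
  by rewrite ab.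
rewrite sE /del_edge; case: eqP => [[ia jb]|]; last by rewrite andbT.
by case: nab; rewrite ia jb !eqxx.
Qed.

Definition test_repairable : cprog :=
  (CSet 26 (Const 0) ;;
   CFor 12 0
     (CIf (Cell mark_arr (Reg 12) (Const 0))
        (CIf (Cell 1 (Reg 12) (Const 0))
           (CSet 26 (Const 1))
           (CFor 13 0
              (CIf (Cell free_arr (Reg 13) (Const 0))
                 (CIf (Cell 0 (Reg 12) (Reg 13)) (CSet 26 (Const 1)) CSkip)
                 CSkip)))
        CSkip))%code.

Lemma sem_test_repairable s E F M U :
  reg s 0 = n -> stores_graph s 0 E -> stores_set s 1 F ->
  stores_set s mark_arr M -> stores_set s free_arr U ->
  reg (sem test_repairable s) 26 =
    [exists z in M, (z \in F) || [exists y, (y \in U) && E z y]].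
Proof.
move=> sn sE sF sM sU; rewrite /test_repairable sem_seq sem_set.
rewrite (sem_test (P := fun z => (z \in M) && ((z \in F) || [exists y, (y \in U) && E z y]))) //.
move=> k s' sb xk.
have sM' := same_but_stores sb isT (sM : stores_set (set_reg s 26 _) _ _).
have sF' := same_but_stores sb isT (sF : stores_set (set_reg s 26 _) _ _).
have sU' := same_but_stores sb isT (sU : stores_set (set_reg s 26 _) _ _).
have sE' : stores_graph s' 0 E by exact: (same_but_graph sb).
rewrite sem_if /= xk sM'; case: (boolP (k \in M)) => kM //=.
rewrite sem_if /= xk sF'; case: (boolP (k \in F)) => kF //=.
rewrite (sem_test (P := fun y => (y \in U) && E k y)) //; first by rewrite sb.1.
move=> k' s2 sb2 xk'; have sU2 := same_but_stores sb2 isT sU'.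
rewrite sem_if /= xk' sU2; case: (boolP (k' \in U)) => kU //=.
have sE2 : stores_graph s2 0 E by exact: (same_but_graph sb2).
by rewrite sem_if /= sb2.1 // xk xk' sE2; case: (boolP (E k k')).
Qed.

(** The vertex in register 20 loses its partner for the time of the test. *)
Definition test_partner : cprog :=
  (CSet 25 (Cell partner_arr (Reg 20) (Const 0)) ;;
   CPut 0 (Reg 20) (Reg 25) (Const 0) ;;
   CPut matched_arr (Reg 20) (Const 0) (Const 0) ;;
   exchange_table ;;
   free_table ;;
   mark_self ;;
   reach exchange_arr ;;
   test_repairable ;;
   CPut 0 (Reg 20) (Reg 25) (Const 1) ;;
   CPut matched_arr (Reg 20) (Const 0) (Const 1))%code.

Lemma sem_test_partner s E T F f (a : 'I_n) :
  reg s 0 = n -> reg s 20 = a -> a \notin T ->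
  stores_graph s 0 E -> stores_set s 1 F ->
  matching E (~: T) f -> stores_matching s (~: T) f ->
  let s' := sem test_partner s in
  [/\ reg s' 25 = f a, reg s' 26 = repairable E T F f a,
      stores_set s' mark_arr (release_set E T f a),
      stores_graph s' 0 E & stores_matching s' (~: T) f].
Proof.
move=> sn s20 aT sE sF fP [sD sp] /=.
have aD : a \in ~: T by rewrite inE.
rewrite /test_partner 9!sem_seq sem_set !sem_put.
have -> : eval s (Cell 10 (Reg 20) (Const 0)) = f a by rewrite /= s20 sp.
rewrite /= s20; set s1 := set_arr (set_arr _ _ _ _ _) _ _ _ _.
have s1E : stores_graph s1 0 (del_edge E (a, f a)).
  exact: (stores_graph_del (s := set_reg s 25 (f a)) (g := 0) a (f a) sE).
have s1D : stores_set s1 matched_arr (~: T :\ a).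
  exact: (stores_set_del (s := set_arr (set_reg s 25 (f a)) 0 a (f a) 0) (a := matched_arr) a sD).
have s1m : stores_matching s1 (~: T :\ a) f.
  by split=> // i /setD1P[_ iT]; apply: sp.
set s2 := sem exchange_table s1.
have sb2 := sem_same_but exchange_table s1; rewrite -/s2 in sb2.
have s2H : stores_graph s2 exchange_arr (exchange (del_edge E (a, f a)) (~: T :\ a) f).
  by apply: sem_exchange_table.
have s2m := same_but_matching sb2 isT isT s1m.
set s3 := sem free_table s2.
have sb3 := sem_same_but free_table s2; rewrite -/s3 in sb3.
have s3U : stores_set s3 free_arr [set y | unmatched (~: T :\ a) f y].
  by apply: sem_free_table => //; rewrite sb2.1.
have sb13 := same_but_chain sb2 sb3.
set s4 := sem mark_self s3.
have sb4 : same_but [:: 12] [:: mark_arr] s3 s4 := sem_same_but mark_self s3.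
have s4M : stores_set s4 mark_arr [set a].
  by apply: sem_mark_self; rewrite sb13.1.
have sb14 := same_but_chain sb13 sb4.
set s5 := sem (reach exchange_arr) s4.
have sb5 := sem_same_but (reach exchange_arr) s4; rewrite -/s5 in sb5.
have s4n : reg s4 0 = n by rewrite sb14.1.
have s4H : stores_graph s4 exchange_arr (exchange (del_edge E (a, f a)) (~: T :\ a) f).
  by exact: (same_but_graph (same_but_chain sb3 sb4)).
have [s5M _] := sem_reach (g := exchange_arr) isT s4n s4H s4M.
rewrite reach_set1 -/s5 -/(exchange_reach _ _ _ _) -/(release_set E T f a) in s5M.
have sb15 := same_but_chain sb14 sb5.
have s5n : reg s5 0 = n by rewrite sb15.1.
have s5E : stores_graph s5 0 (del_edge E (a, f a)) by exact: (same_but_graph sb15).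
have s5U : stores_set s5 free_arr [set y | unmatched (~: T :\ a) f y].
  by exact: (same_but_stores (same_but_chain sb4 sb5)).
have s5F : stores_set s5 1 F by apply: (same_but_stores sb15).
set s6 := sem test_repairable s5.
have sb6 := sem_same_but test_repairable s5; rewrite -/s6 in sb6.
have sb16 := same_but_chain sb15 sb6.
have s6R := sem_test_repairable s5n s5E s5F s5M s5U; rewrite -/s6 in s6R.
have s620 : reg s6 20 = a by rewrite sb16.1.
have s625 : reg s6 25 = f a by rewrite sb16.1.
rewrite s620 s625; split=> //.
- rewrite /= s6R; congr nat_of_bool; apply: eq_existsb => z; congr (_ && (_ || _)).
  by apply: eq_existsb => y; rewrite in_set.
- have h : stores_set s6 mark_arr (release_set E T f a) by apply: (same_but_stores sb6).
  exact: h.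
- have h : stores_graph s6 0 (del_edge E (a, f a)) by apply: (same_but_graph sb16).
  exact: (stores_graph_restore (s := s6) (g := 0) (fP.2 a aD) h).
have [h1 h2] := same_but_matching sb16 isT isT s1m; split.
  have := stores_set_add (s := set_arr s6 0 a (f a) 1) (a := matched_arr) a h1.
  by rewrite setD1K.
move=> i iD; rewrite /= sb16.2 //; exact: sp.
Qed.

Definition meet_output : cprog :=
  CFor 12 0
    (CIf (Cell mark_arr (Reg 12) (Const 0))
       (CIf (Cell 1 (Reg 12) (Const 0)) (CSet 26 (Const 1)) CSkip)
       CSkip).

(** Whether the tail of the edge in registers 20 and 25 still reaches the set
    in array 1 after the deletion of that edge. *)
Definition test_cut : cprog :=
  (CPut 0 (Reg 20) (Reg 25) (Const 0) ;;
   mark_self ;;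
   reach 0 ;;
   CPut 0 (Reg 20) (Reg 25) (Const 1) ;;
   CSet 26 (Const 0) ;;
   meet_output)%code.

Lemma sem_test_cut s E F (a b : 'I_n) :
  reg s 0 = n -> reg s 20 = a -> reg s 25 = b -> E a b ->
  stores_graph s 0 E -> stores_set s 1 F ->
  let s' := sem test_cut s in
  [/\ reg s' 26 = ~~ [disjoint tail_reach E (a, b) & F],
      stores_set s' mark_arr (tail_reach E (a, b)) & stores_graph s' 0 E].
Proof.
move=> sn s20 s25 ab sE sF /=; rewrite /test_cut 5!sem_seq !sem_put sem_set /= s20 s25.
set s1 := set_arr s _ _ _ _.
have s1E : stores_graph s1 0 (del_edge E (a, b)) by apply: stores_graph_del.
set s2 := sem mark_self s1.
have sb2 : same_but [:: 12] [:: mark_arr] s1 s2 := sem_same_but mark_self s1.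
have s2M : stores_set s2 mark_arr [set a] by apply: sem_mark_self.
set s3 := sem (reach 0) s2.
have sb3 := sem_same_but (reach 0) s2; rewrite -/s3 in sb3.
have s2n : reg s2 0 = n by rewrite sb2.1.
have s2E : stores_graph s2 0 (del_edge E (a, b)) by exact: (same_but_graph sb2).
have [s3M _] := sem_reach (g := 0) isT s2n s2E s2M.
rewrite reach_set1 -/s3 -/(tail_reach E (a, b)) in s3M.
have sb13 := same_but_chain sb2 sb3.
have s3E : stores_graph s3 0 (del_edge E (a, b)) by exact: (same_but_graph sb13).
rewrite !sb13.1 //= s20 s25; set s4 := set_reg _ 26 _; set s5 := sem _ s4.
have sb5 : same_but [:: 12; 26] [::] s4 s5 := sem_same_but meet_output s4.
have s4E : stores_graph s4 0 E.
  exact: (stores_graph_restore (s := s3) (g := 0) ab s3E).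
have s4M : stores_set s4 mark_arr (tail_reach E (a, b)) by exact: s3M.
have s4F : stores_set s4 1 F.
  have h : stores_set s3 1 F by apply: (same_but_stores sb13).
  exact: h.
split; last 2 first.
- exact: (same_but_stores sb5).
- exact: (same_but_graph sb5).
have s4n : reg s4 0 = n by rewrite /= sb13.1.
have dE : ~~ [disjoint tail_reach E (a, b) & F] =
    [exists z, (z \in tail_reach E (a, b)) && (z \in F)].
  by apply/pred0Pn/existsP=> -[z zP]; exists z.
rewrite dE /s5 /meet_output (sem_test (P := fun z => (z \in tail_reach E (a, b)) && (z \in F)) s4n) //.
move=> k s' sb xk.
have sM' := same_but_stores sb isT s4M; have sF' := same_but_stores sb isT s4F.
rewrite sem_if /= xk sM'; case: (boolP (k \in tail_reach E (a, b))) => kM //=.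
by rewrite sem_if /= xk sF'; case: (boolP (k \in F)).
Qed.

End Construct.

(** ** The two kinds of links *)

Section Phases.

Import Defs boot.fintype boot.finset.

Local Open Scope nat_scope.

Arguments sem : simpl never.

Variable n : nat.
Variables (E : rel 'I_n) (T F : {set 'I_n}) (f : 'I_n -> 'I_n).
Hypothesis fP : matching E (~: T) f.
Implicit Types (s : machine) (l : 'I_n * 'I_n).
Implicit Types (LL : seq (('I_n * 'I_n) * {set 'I_n})).
Local Notation critical := (critical_edge E T F f).

(** A critical link is the edge of the matching at its tail, so one test for each
    non-tip suffices; the marks left by the test are the back-ups. *)
Definition tip_phase : cprog :=
  (fill critical_arr 12 (Const 0) ;;
   CSet 1 (Const 0) ;;
   CFor 20 0
     (CIf (Cell 2 (Reg 20) (Const 0)) CSkip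
        (test_partner ;;
         CIf (Reg 26) CSkip
           (record_link ;; CPut critical_arr (Reg 20) (Const 0) (Const 1)))) ;;
   CSet 2 (Reg 1))%code.

Lemma sem_tip_phase s :
  reg s 0 = n -> stores_graph s 0 E -> stores_set s 1 F -> stores_set s 2 T ->
  stores_matching s (~: T) f ->
  let s' := sem tip_phase s in
  exists LL, [/\ stores_entries s' LL, uniq [seq x.1 | x <- LL], reg s' 2 = size LL
    & forall l X, (l, X) \in LL <-> critical l /\ X = release_set E T f l.1] /\
  [/\ stores_graph s' 0 E, stores_matching s' (~: T) f &
      stores_set s' critical_arr [set a | critical (a, f a)]].
Proof.
move=> sn sE sF sT sf /=; rewrite /tip_phase 3!sem_seq !sem_set.
set s1 := sem _ s.
have sb1 : same_but [:: 12] [:: critical_arr] s s1 := sem_same_but (fill critical_arr 12 (Const 0)) s.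
have s1C : stores_set s1 critical_arr (set0 : {set 'I_n}).
  by apply: sem_fill => // s' i _ _; rewrite in_set0.
set s2 := set_reg s1 1 _.
have sb2 : same_but [:: 12; 1] [:: critical_arr] s s2.
  by apply: same_but_set_reg => //; apply: same_but_sub sb1 => // y; rewrite inE => /eqP->.
pose I k s' := exists LL, [/\ stores_entries s' LL, uniq [seq x.1 | x <- LL]
    & forall l X, (l, X) \in LL <-> [/\ critical l, l.1 < k & X = release_set E T f l.1]] /\
  [/\ stores_graph s' 0 E, stores_matching s' (~: T) f &
      stores_set s' critical_arr [set a : 'I_n | (a < k) && critical (a, f a)]].
set body := CIf _ _ _.
suff : I n (sem (CFor 20 0 body) s2).
  case=> LL [[en un LLP] [h1 h2 h3]]; exists LL; split.
    split=> //; first by have [sz _] := en; rewrite /= sz.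
    move=> l X; rewrite LLP; split=> [[] //|[h ->]]; split=> //; exact: ltn_ord.
  split=> //; apply: stores_set_eq h3; apply/setP=> a.
  by rewrite !in_set ltn_ord.
apply: sem_for_n => //; first by rewrite sb2.1.
  exists [::]; split.
    by split=> // l X; split=> // -[].
  have E0 : stores_graph s2 0 E by exact: (same_but_graph sb2).
  have m0 : stores_matching s2 (~: T) f := same_but_matching sb2 isT isT sf.
  have C0 : [set a : 'I_n | (a < 0) && critical (a, f a)] = set0.
    by apply/setP=> a; rewrite !in_set.
  by rewrite C0; split; [exact: E0|exact: m0|exact: s1C].
move=> k s3 xk sb3 [LL [[en un LLP] [h1 h2 h3]]].
have sb := same_but_chain sb2 sb3.
have s3n : reg s3 0 = n by rewrite sb.1.
have s3T : stores_set s3 2 T by apply: (same_but_stores sb).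
have s3F : stores_set s3 1 F by apply: (same_but_stores sb).
have ltS (a : 'I_n) : (a < k.+1) = (a == k) || (a < k) by rewrite ltnS leq_eqVlt.
have skip s4 : ~~ critical (k, f k) -> stores_entries s4 LL ->
    stores_graph s4 0 E -> stores_matching s4 (~: T) f ->
    stores_set s4 critical_arr [set a : 'I_n | (a < k) && critical (a, f a)] ->
    I k.+1 (set_reg s4 20 k.+1).
  move=> nk en4 E4 m4 C4; exists LL; split; last first.
    split=> //; apply: stores_set_eq C4; apply/setP=> a; rewrite !in_set ltS.
    by case: eqP => [->|] //=; rewrite (negPf nk) andbF.
  split=> // l X; rewrite LLP ltS; split=> [[hc -> ->]|[hc lk ->]]; first by rewrite orbT.
  split=> //; case/orP: lk => // /eqP lk; move: nk; rewrite -lk.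
  by rewrite (critical_edgeE hc) hc.
rewrite /body sem_if /= xk s3T; case: (boolP (k \in T)) => kT /=.
  have nk : ~~ critical (k, f k) by rewrite /critical_edge kT.
  exact: (skip s3).
rewrite sem_seq sem_if; set s4 := sem test_partner s3.
have sb4 := sem_same_but test_partner s3; rewrite -/s4 in sb4.
have [s425 s426 s4M s4E s4m] := sem_test_partner s3n xk kT h1 s3F fP h2.
rewrite -/s4 in s425 s426 s4M s4E s4m.
have s4C := same_but_stores (a := critical_arr) sb4 isT h3.
have en4 := same_but_entries sb4 isT isT isT en.
have s420 : reg s4 20 = k by rewrite sb4.1.
have s4n : reg s4 0 = n by rewrite sb4.1.
clearbody s4.
have -> : eval s4 (Reg 26) = repairable E T F f k := s426.
case: (boolP (repairable E T F f k)) => kr /=.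
  have nk : ~~ critical (k, f k) by rewrite /critical_edge /= kr !andbF.
  exact: (skip s4).
have ck : critical (k, f k) by rewrite /critical_edge /= kT eqxx kr.
rewrite sem_seq sem_put; set s5 := sem record_link s4.
have sb5 := sem_same_but record_link s4; rewrite -/s5 in sb5.
have en5 := sem_record_link s4n s420 s425 s4M en4; rewrite -/s5 in en5.
clearbody s5.
have -> : eval s5 (Reg 20) = k by exact: (etrans (sb5.1 20 isT) s420).
exists (rcons LL ((k, f k), release_set E T f k)); split; last first.
  split.
  - have h : stores_graph s5 0 E by exact: (same_but_graph sb5).
    exact: h.
  - have h : stores_matching s5 (~: T) f := same_but_matching sb5 isT isT s4m.
    exact: h.
  - have h : stores_set s5 critical_arr [set a : 'I_n | (a < k) && critical (a, f a)].
      exact: (same_but_stores (a := critical_arr) sb5 isT s4C).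
    apply: stores_set_eq (stores_set_add (a := critical_arr) k h).
    apply/setP=> a; rewrite in_setU1 !in_set ltS.
    by case: eqP => [->|] //=; rewrite ck.
split.
- exact: en5.
- rewrite map_rcons rcons_uniq un andbT; apply/mapP=> -[[l X] /= /LLP[_ lk _] kl].
  by rewrite -kl /= ltnn in lk.
- move=> l X; rewrite mem_rcons inE ltS; split.
    case/predU1P=> [[-> ->]|/LLP[hc lk hX]]; first by rewrite eqxx.
    by rewrite lk orbT.
  case=> hc /orP[/eqP lk|lk] hX; apply/orP; last by right; apply/LLP.
  by left; rewrite hX -lk (critical_edgeE hc) eqxx.
Qed.

(** The flags of the critical tails keep the links of the first kind from being
    recorded twice. *)
Definition skip_critical : cprog :=
  CIf (Cell critical_arr (Reg 20) (Const 0))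
    (CIf (Equal (Cell partner_arr (Reg 20) (Const 0)) (Reg 25))
       (CSet 26 (Const 1)) CSkip)
    CSkip.

Definition sink_phase : cprog :=
  CFor 20 0 (CFor 25 0
    (CIf (Cell 0 (Reg 20) (Reg 25))
       (test_cut ;;
        skip_critical ;;
        CIf (Reg 26) CSkip record_link)
       CSkip))%code.

Definition cutting_edge l : bool :=
  [&& E l.1 l.2, ~~ critical l & [disjoint tail_reach E l & F]].

Lemma sem_sink_phase s LL1 :
  reg s 0 = n -> stores_graph s 0 E -> stores_set s 1 F ->
  stores_matching s (~: T) f ->
  stores_set s critical_arr [set a | critical (a, f a)] ->
  stores_entries s LL1 ->
  exists LL2, [/\ stores_entries (sem sink_phase s) (LL1 ++ LL2),
    uniq [seq x.1 | x <- LL2]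
    & forall l X, (l, X) \in LL2 <-> cutting_edge l /\ X = tail_reach E l].
Proof.
move=> sn sE sF sf sC en1.
pose I (P : 'I_n * 'I_n -> bool) s' := exists LL2,
  [/\ stores_entries s' (LL1 ++ LL2), uniq [seq x.1 | x <- LL2], stores_graph s' 0 E
    & forall l X, (l, X) \in LL2 <-> [/\ cutting_edge l, P l & X = tail_reach E l]].
have ext P P' s' : P =1 P' -> I P s' -> I P' s'.
  move=> PP' [LL2 [h1 h2 h3 h4]]; exists LL2; split=> // l X.
  by rewrite h4 PP'.
rewrite /sink_phase; set body := CIf (Cell 0 (Reg 20) (Reg 25)) _ _.
suff : I (fun l => l.1 < n) (sem (CFor 20 0 (CFor 25 0 body)) s).
  case=> LL2 [h1 h2 _ h4]; exists LL2; split=> // l X; rewrite h4.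
  by split=> [[]|[]].
apply: (sem_for_n (I := fun k s' => I (fun l => l.1 < k) s')) => //.
  exists [::]; rewrite cats0; split=> // l X; by split=> // -[].
move=> k s1 xk sb1 I1.
have s1n : reg s1 0 = n by rewrite sb1.1.
suff : I (fun l => (l.1 < k) || ((l.1 : nat) == k) && (l.2 < n)) (sem (CFor 25 0 body) s1).
  by apply: ext => l; rewrite ltn_ord andbT [RHS]ltnS [RHS]leq_eqVlt orbC.
apply: (sem_for_n (I := fun k' s' =>
   I (fun l => (l.1 < k) || ((l.1 : nat) == k) && (l.2 < k')) s')) => //.
  by apply: ext I1 => l /=; rewrite andbF orbF.
move=> k' s2 xk' sb2 [LL2 [en un s2E LLP]].
have sb := same_but_chain sb1 sb2.
have s220 : reg s2 20 = k by rewrite sb2.1.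
have s2n : reg s2 0 = n by rewrite sb.1.
have s2F : stores_set s2 1 F by apply: (same_but_stores sb).
have ltS l : (l.1 < k) || ((l.1 : nat) == k) && (l.2 < k'.+1) =
    [|| l == (k, k'), (l.1 < k) | ((l.1 : nat) == k) && (l.2 < k')].
  case: l => a b /=; rewrite ltnS [b <= _]leq_eqVlt xpair_eqE -!val_eqE /=.
  by case: (ltngtP (a : nat) k); case: (ltngtP (b : nat) k').
have skip s4 : ~~ cutting_edge (k, k') -> stores_entries s4 (LL1 ++ LL2) ->
    stores_graph s4 0 E ->
    I (fun l => (l.1 < k) || ((l.1 : nat) == k) && (l.2 < k'.+1)) (set_reg s4 25 k'.+1).
  move=> nk en4 E4; exists LL2; split=> // l X; rewrite LLP ltS.
  split=> [[hc -> ->]|[hc /predU1P[lk|lk] ->]]; first by rewrite orbT.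
    by move: nk; rewrite -lk hc.
  by [].
rewrite /body sem_if /= s220 xk' s2E; case: (boolP (E k k')) => kE /=; last first.
  have nk : ~~ cutting_edge (k, k') by rewrite /cutting_edge (negPf kE).
  exact: (skip s2).
rewrite 2!sem_seq; set s3 := sem test_cut s2.
have sb3 := sem_same_but test_cut s2; rewrite -/s3 in sb3.
have [s326 s3M s3E] := sem_test_cut s2n s220 xk' kE s2E s2F; rewrite -/s3 in s326 s3M s3E.
clearbody s3.
set s4 := sem skip_critical s3.
have sb4 : same_but [:: 26] [::] s3 s4 := sem_same_but skip_critical s3.
have sb03 := same_but_chain sb sb3.
have s3C : stores_set s3 critical_arr [set a | critical (a, f a)].
  exact: (same_but_stores (a := critical_arr) sb03 isT sC).
have [_ s3f] := same_but_matching sb03 isT isT sf.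
have s320 : reg s3 20 = k by rewrite sb3.1.
have s325 : reg s3 25 = k' by rewrite sb3.1.
have s426 : reg s4 26 = ~~ cutting_edge (k, k').
  rewrite /s4 /skip_critical sem_if /= s320 s3C in_set /cutting_edge /= kE /= negb_and negbK.
  case: (boolP (critical (k, f k))) => ck /=.
    have kD : k \in ~: T by case/and3P: ck => kT _ _; rewrite inE.
    rewrite sem_if /= s320 s325 s3f //; case: (eqVneq (f k : nat) k') => [/ord_inj fk|fk] /=.
      by rewrite -fk ck.
    rewrite sem_skip s326; case: (boolP (critical (k, k'))) => //= ck'.
    by move: ck' => /and3P[_ /eqP /= kk' _]; rewrite kk' eqxx in fk.
  rewrite sem_skip s326; case: (boolP (critical (k, k'))) => //= ck'.
  by move: (ck') => /and3P[_ /eqP /= kk' _]; rewrite kk' (negPf ck) in ck'.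
have en4 : stores_entries s4 (LL1 ++ LL2).
  exact: same_but_entries (same_but_chain sb3 sb4) isT isT isT en.
have s4E : stores_graph s4 0 E by exact: (same_but_graph sb4).
clearbody s4.
rewrite sem_if; have -> : eval s4 (Reg 26) = ~~ cutting_edge (k, k') := s426.
case: (boolP (cutting_edge (k, k'))) => cc /=; last first.
  exact: (skip s4).
have s4n : reg s4 0 = n by rewrite sb4.1 // sb03.1.
have s420 : reg s4 20 = k by rewrite sb4.1.
have s425 : reg s4 25 = k' by rewrite sb4.1.
have s4M : stores_set s4 mark_arr (tail_reach E (k, k')) by apply: (same_but_stores sb4).
have en5 := sem_record_link s4n s420 s425 s4M en4.
have sb5 := sem_same_but record_link s4.
set s5 := sem record_link s4 in en5 sb5 *; clearbody s5.
exists (rcons LL2 ((k, k'), tail_reach E (k, k'))); split.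
- by rewrite -rcons_cat; exact: en5.
- rewrite map_rcons rcons_uniq un andbT; apply/mapP=> -[[l X] /= /LLP[_ lk _] kl].
  by move: lk; rewrite -kl /= eqxx !ltnn.
- have h : stores_graph s5 0 E by exact: (same_but_graph sb5).
  exact: h.
- move=> l X; rewrite mem_rcons inE ltS; split.
    case/predU1P=> [[-> ->]|/LLP[hc lk hX]]; first by rewrite eqxx.
    by rewrite lk orbT.
  case=> hc /predU1P[lk|lk] hX; apply/orP; last by right; apply/LLP.
  by left; rewrite hX lk eqxx.
Qed.

Definition construct : cprog := (compute_matching ;; tip_phase ;; sink_phase)%code.

End Phases.

Section ConstructCorrect.

Import Defs boot.fintype boot.finset.

Local Open Scope nat_scope.

Variables (R : realType) (n : nat) (A : 'M[bool]_n) (T F : {set 'I_n}).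
Hypothesis TF : T \subset F.
Hypothesis eF : reaches (state_edge A) F.

Lemma VsetE rho r (lk : rho.-tuple ('I_n * 'I_n)) (j : 'I_n) (k : 'I_rho) :
  (k \in Vset A T r lk j) =
  (j \in if k < r then tip_completions A T (tnth lk k) else sink_completions A (tnth lk k)).
Proof.
rewrite inE /backups /Zset; apply/imsetP/idP => [[g gX /set1_inj->] //|jX].
by exists j.
Qed.

(** The tests of the two phases decide the two kinds of sensitive links, by
    [tip_criticalP] and [sink_sensitiveE], and their marks are the completions. *)
Lemma construct_correct s :
  0 < n -> matchable (state_edge A) (~: T) -> stores_digraph s A F T ->
  exists rho r (lk : rho.-tuple ('I_n * 'I_n)),
    sensitive_links R A F r lk /\
    stores_covering_problem (sem construct s) A T r lk.
Proof.
move=> n0 TP [sn sE sF sT].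
have [f [fP sf]] := sem_compute_matching sn sE sT TP.
rewrite /construct 2!sem_seq; set s1 := sem compute_matching s in sf *.
have sb1 := sem_same_but compute_matching s; rewrite -/s1 in sb1.
have s1n : reg s1 0 = n by rewrite sb1.1.
have s1E : stores_graph s1 0 (state_edge A) by exact: (same_but_graph (g := 0) sb1 isT sE).
have s1F := same_but_stores (a := 1) sb1 isT sF.
have s1T := same_but_stores (a := 2) sb1 isT sT.
clearbody s1.
have [LL1 [[en1 un1 sz1 LL1P] [s2E s2f s2C]]] := sem_tip_phase fP s1n s1E s1F s1T sf.
set s2 := sem tip_phase s1 in en1 sz1 s2E s2f s2C *.
have sb2 := sem_same_but tip_phase s1; rewrite -/s2 in sb2.
have s2n : reg s2 0 = n by rewrite sb2.1.
have s2F := same_but_stores (a := 1) sb2 isT s1F.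
clearbody s2.
have [LL2 [en2 un2 LL2P]] := sem_sink_phase s2n s2E s2F s2f s2C en1.
set s3 := sem sink_phase s2 in en2 *.
have sb3 := sem_same_but sink_phase s2; rewrite -/s3 in sb3.
have s3r : reg s3 2 = size LL1 by rewrite sb3.1.
clearbody s3.
pose LL := LL1 ++ LL2; pose d := ((Ordinal n0, Ordinal n0), set0 : {set 'I_n}).
pose lk := in_tuple [seq x.1 | x <- LL].
have szl : size [seq x.1 | x <- LL] = size LL by rewrite size_map.
have ltLL (k : 'I_(size [seq x.1 | x <- LL])) : k < size LL.
  by have := ltn_ord k; rewrite [X in _ < X]szl.
have lkE k : tnth lk k = (nth d LL k).1.
  by rewrite (tnth_nth d.1) /= (nth_map d) // ltLL.
have tipE (k : 'I_(size [seq x.1 | x <- LL])) : k < size LL1 ->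
    critical_edge (state_edge A) T F f (tnth lk k) /\ (nth d LL k).2 = release_set (state_edge A) T f (tnth lk k).1.
  move=> kr; rewrite lkE nth_cat kr; have := mem_nth d kr.
  by case: (nth d LL1 k) => l X /LL1P.
have sinkE (k : 'I_(size [seq x.1 | x <- LL])) : size LL1 <= k ->
    cutting_edge (state_edge A) T F f (tnth lk k) /\ (nth d LL k).2 = tail_reach (state_edge A) (tnth lk k).
  move=> kr; rewrite lkE nth_cat ltnNge kr /=.
  have : k - size LL1 < size LL2.
    by rewrite ltn_subLR // -size_cat -/LL ltLL.
  by move/(mem_nth d); case: (nth d LL2 _) => l X /LL2P.
exists (size [seq x.1 | x <- LL]), (size LL1), lk; split.
  split.
  - rewrite -[uniq _]/(uniq [seq x.1 | x <- LL1 ++ LL2]) map_cat cat_uniq un1 un2 andbT /=; apply/hasPn=> l /mapP[[l' X] /LL2P[+ _] /= ->].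
    case/and3P=> _ nc _; apply/mapP=> -[[l'' Y] /LL1P[/= cr _] /= ll].
    by rewrite ll cr in nc.
  - move=> l; rewrite (sensitiveP R fP TF eF).
    rewrite -[l \in _]/(l \in [seq x.1 | x <- LL1 ++ LL2]) map_cat mem_cat.
    split=> [/orP[]/mapP[[l' X] + /= ->]|].
        by move=> /LL1P[cr _]; split; [apply: (tip_critical_state_edge fP cr)|apply/orP; left].
      by move=> /LL2P[/and3P[el _ cl] _]; split=> //; rewrite cl orbT.
    case=> el.
    have [cr _|ncr /= cl] := boolP (critical_edge (state_edge A) T F f l).
      apply/orP; left; apply/mapP; exists (l, release_set (state_edge A) T f l.1) => //.
      by apply/LL1P.
    apply/orP; right; apply/mapP; exists (l, tail_reach (state_edge A) l) => //.
    by apply/LL2P; split=> //; apply/and3P.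
  - by rewrite szl size_cat leq_addr.
  - by move=> k /tipE[cr _]; apply/(tip_criticalP fP TF).
  - by move=> k /sinkE[/and3P[_ nc cl] _]; apply/(sink_sensitiveE fP TF eF).
have [sz en] := en2; split=> //.
- by rewrite sz szl.
- move=> k; have [|h1 h2 _] := en d k; first by rewrite -/LL ltLL.
  by rewrite h1 h2 lkE.
- move=> j k; have [|_ _ h3] := en d k; first by rewrite -/LL ltLL.
  rewrite h3 VsetE; congr (nat_of_bool (_ \in _)); rewrite -/LL.
  case: ltnP => [/tipE[cr ->]|/sinkE[/and3P[_ _ cl] ->]].
    by rewrite (release_setE fP TF cr).
  by rewrite (sink_completionsE eF cl).
Qed.

End ConstructCorrect.

(** * Greedy covering and harmonic numbers *)

Section Greedy.

Import boot.fintype boot.finset.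

Variable R : realType.
Local Notation H := (harmonic_number R).

Lemma harmonicS m : H m.+1 = H m + m.+1%:R^-1.
Proof. by rewrite /harmonic_number big_nat_recr. Qed.

Lemma harmonic0 : H 0 = 0.
Proof. by rewrite /harmonic_number big_geq. Qed.

Lemma harmonic_le a b : (a <= b)%N -> H a <= H b.
Proof.
elim: b => [|b IH]; first by rewrite leqn0 => /eqP->.
rewrite leq_eqVlt => /orP[/eqP->//|]; rewrite ltnS => /IH ab.
by rewrite harmonicS (le_trans ab) // lerDl invr_ge0.
Qed.

(** Each of the terms lost between [b] and [b + d] is at least [1 / c]. *)
Lemma harmonic_drop b d c : (b + d <= c)%N -> H b + d%:R / c%:R <= H (b + d).
Proof.
elim: d => [|d IH] bc; first by rewrite mul0r addr0 addn0.
rewrite addnS harmonicS -natr1 mulrDl addrA lerD //.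
  by apply: IH; rewrite (leq_trans _ bc) // addnS.
rewrite mul1r lef_pV2 ?posrE ?ltr0n ?ler_nat //; first by rewrite -addnS.
by apply: leq_trans bc; rewrite addnS.
Qed.

Variables (V I : finType) (X : I -> {set V}).
Implicit Types (U : {set I}) (J G : {set V}).

Definition coverage U v : nat := #|[set i in U | v \in X i]|.

Definition uncover U v : {set I} := [set i in U | v \notin X i].

Definition hitting U G : Prop := forall i, i \in U -> ~~ [disjoint X i & G].

(** What the elements of [G] are worth while the constraints in [U] are still
    open: an element that meets [c] of them is charged [H c]. *)
Definition cover_price G U : R := \sum_(g in G) H (coverage U g).

(** Picking [v] costs 1 and lowers the price at least as much: an element [g]
    that loses [d] of its at most [c] constraints loses at least [d / c], and
    [G] hits each of the [c] constraints covered by [v]. *)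
Lemma cover_price_step U G v :
  (0 < coverage U v)%N -> (forall w, (coverage U w <= coverage U v)%N) ->
  hitting U G -> 1 + cover_price G (uncover U v) <= cover_price G U.
Proof.
move=> c0 cmax hG; set c := coverage U v.
pose d g := #|[set i in U | (v \in X i) && (g \in X i)]|.
have cov g : coverage U g = (coverage (uncover U v) g + d g)%N.
  rewrite /coverage -(cardsID [set i | v \in X i] [set i in U | g \in X i]) addnC.
  congr (_ + _)%N; apply: eq_card => i; rewrite !inE.
    by case: (i \in U); case: (v \in X i); case: (g \in X i).
  by case: (i \in U); case: (v \in X i); case: (g \in X i).
have dE g : d g = (\sum_(i in [set i in U | v \in X i]) (g \in X i))%N.
  rewrite /d -sum1_card [RHS]big_mkcond [LHS]big_mkcond; apply: eq_bigr => i _.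
  by rewrite !inE; case: (i \in U); case: (v \in X i); case: (g \in X i).
have sd : (c <= \sum_(g in G) d g)%N.
  rewrite (eq_bigr _ (fun g _ => dE g)) exchange_big /= /c /coverage -sum1_card.
  apply: leq_sum => i; rewrite inE => /andP[iU vi].
  have /pred0Pn[g /= /andP[gi gG]] := hG i iU.
  by rewrite (bigD1 g) //= gi.
rewrite /cover_price.
apply: le_trans (_ : \sum_(g in G) (H (coverage (uncover U v) g) + (d g)%:R / c%:R) <= _); last first.
  by apply: ler_sum => g _; rewrite cov harmonic_drop // -cov cmax.
rewrite big_split /= [leLHS]addrC lerD2l -mulr_suml -natr_sum.
by rewrite ler_pdivlMr ?ltr0n // mul1r ler_nat.
Qed.

Lemma cover_price_bound U G d :
  (forall g, g \in G -> (coverage U g <= d)%N) ->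
  cover_price G U <= #|G|%:R * H d.
Proof.
move=> cd; rewrite /cover_price mulr_natl -sumr_const.
by apply: ler_sum => g /cd; apply: harmonic_le.
Qed.

(** The state of the greedy algorithm for the constraints [U0] after the choice of
    [J], with [U] still open. *)
Definition greedy_state U0 J U : Prop :=
  [/\ forall i, i \in U0 -> i \in U \/ ~~ [disjoint X i & J],
      forall i, i \in U -> i \in U0 /\ [disjoint X i & J]
    & forall G, hitting U0 G -> #|J|%:R + cover_price G U <= cover_price G U0].

Lemma greedy_state0 U0 : greedy_state U0 set0 U0.
Proof.
split=> [i iU|i iU|G _]; first by left.
  by split=> //; apply/pred0P=> x; rewrite /= inE andbF.
by rewrite cards0 add0r.
Qed.

Lemma coverage_chosen U0 J U v : greedy_state U0 J U -> v \in J -> coverage U v = 0%N.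
Proof.
move=> [_ h _] vJ; apply/eqP; rewrite cards_eq0; apply/eqP/setP=> i; rewrite !inE.
apply/negP=> /andP[/h[_ /pred0P/(_ v) /= dv] vi].
by rewrite vi vJ in dv.
Qed.

Lemma greedy_stateS U0 J U v :
  greedy_state U0 J U -> (0 < coverage U v)%N ->
  (forall w, (coverage U w <= coverage U v)%N) ->
  greedy_state U0 (v |: J) (uncover U v) /\ #|v |: J| = #|J|.+1.
Proof.
move=> gs c0 cmax; have vJ : v \notin J.
  by apply/negP=> vJ; rewrite (coverage_chosen gs vJ) in c0.
have cJ : #|v |: J| = #|J|.+1 by rewrite cardsU1 vJ.
have [h1 h2 h3] := gs.
split=> //; split=> [i iU0|i|G hG].
- case: (h1 i iU0) => [iU|/pred0Pn[x /= /andP[xi xJ]]]; last first.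
    by right; apply/pred0Pn; exists x; rewrite /= xi inE xJ orbT.
  have [vi|vi] := boolP (v \in X i); last by left; rewrite inE iU.
  by right; apply/pred0Pn; exists v; rewrite /= vi setU11.
- rewrite inE => /andP[/h2[iU0 /pred0P dJ] vi]; split=> //; apply/pred0P=> x /=.
  have := dJ x; rewrite /= in_setU1; case: eqP => [->|_] //=.
  by rewrite (negPf vi).
rewrite cJ -natr1 -addrA; apply: le_trans (h3 G hG); rewrite lerD2l.
by apply: cover_price_step => // i /h2[iU0 _]; apply: hG.
Qed.

Lemma greedy_stalled U0 J U :
  greedy_state U0 J U -> (forall v, coverage U v = 0%N) ->
  (forall i, i \in U0 -> X i != set0) -> hitting U0 J.
Proof.
move=> [h1 h2 _] c0 nX i iU0; case: (h1 i iU0) => // iU.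
have /set0Pn[v vi] := nX i iU0; have /eqP := c0 v.
by rewrite cards_eq0 => /eqP/setP/(_ i); rewrite !inE iU vi.
Qed.

Lemma hitting_setT U0 : (forall i, i \in U0 -> X i != set0) -> hitting U0 setT.
Proof.
move=> nX i /nX/set0Pn[v vi]; apply/pred0Pn; exists v.
by rewrite /= vi inE.
Qed.

Lemma greedy_size U0 J U G d :
  greedy_state U0 J U -> hitting U0 G ->
  (forall g, g \in G -> (coverage U0 g <= d)%N) ->
  #|J|%:R <= #|G|%:R * H d.
Proof.
move=> [_ _ h] hG cd; apply: le_trans (cover_price_bound cd).
apply: le_trans (h G hG); rewrite lerDl; apply: sumr_ge0 => g _.
by rewrite -harmonic0 harmonic_le.
Qed.

End Greedy.

Section PerformanceRatio.

Variable R : realType.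
Local Notation H := (harmonic_number R).

(** The one additional constraint that a vertex can meet is paid for by the
    slack [(H rho - 1) f] when [3 <= rho]; for [rho <= 2] the bound on [j] is
    used through its integral part. *)
Lemma harmonic_ratio (f g j rho : nat) :
  (0 < f)%N -> (0 < rho)%N -> (g <= rho)%N ->
  j%:R <= g%:R * H rho.+1 -> (f + j)%:R <= H rho * (f + g)%:R.
Proof.
move=> f0 rho0 grho jg.
have H1 : H 1 = 1 by rewrite harmonicS harmonic0 add0r invr1.
have H2 : H 2 = 3 / 2 by rewrite harmonicS H1; field.
have H3 : H 3 = 11 / 6 by rewrite harmonicS H2; field.
have H4 : H 4 = 25 / 12 by rewrite harmonicS H3; field.
have f1 : 1 <= f%:R :> R by rewrite ler1n.
rewrite !natrD.
case: rho => [//|[|[|[|rho]]]] in rho0 grho jg *.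
- rewrite H2 in jg; rewrite H1.
  have : (j <= g)%N.
    rewrite -ltnS -(ltr_nat R) -natr1; apply: le_lt_trans jg _.
    have : (g%:R : R) <= 1 by rewrite lern1.
    have : (0 : R) <= g%:R by [].
    by lra.
  by rewrite -(ler_nat R); lra.
- rewrite H3 in jg; rewrite H2.
  case: g => [|[|[|//]]] in grho jg *.
  + have : (j%:R : R) <= 0 by lra.
    by lra.
  + have : (j < 2)%N by rewrite -(ltr_nat R); lra.
    rewrite ltnS -(ler_nat R) => j1; by lra.
  + have : (j < 4)%N by rewrite -(ltr_nat R); lra.
    rewrite ltnS -(ler_nat R) => j3; by lra.
- rewrite H4 in jg; rewrite H3.
  have : (g%:R : R) <= 3 by rewrite ler_nat.
  by lra.
have Hrho : 25 / 12 <= H rho.+4 by rewrite -H4; apply: harmonic_le.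
have gr : g%:R * rho.+4.+1%:R^-1 <= 1 :> R.
  by rewrite ler_pdivrMr ?ltr0n // mul1r ler_nat (leq_trans grho).
have fH : f%:R + 1 <= H rho.+4 * f%:R by nra.
rewrite harmonicS mulrDr in jg; rewrite [leRHS]mulrDr [X in _ <= _ + X]mulrC.
set x := g%:R * H _ in jg *; set y := g%:R * _^-1 in jg gr.
set z := H _ * f%:R in fH *; by lra.
Qed.

End PerformanceRatio.

(** * Computing an approximate cover *)

Notation chosen_arr := 5%N (only parsing).
Notation cut_arr := 15%N (only parsing).
Notation size_arr := 16%N (only parsing).
Notation tip_open_arr := 17%N (only parsing).
Notation cut_open_arr := 18%N (only parsing).

Section Approximate.

Import Defs boot.fintype boot.finset.

Local Open Scope nat_scope.

Arguments sem : simpl never.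

Lemma sem_sum m b (w : 'I_m -> nat) c x p s :
  reg s b = m -> x != b -> x != c -> x \notin written_regs p -> b \notin written_regs p ->
  (forall (k : 'I_m) s', same_but (x :: written_regs p) (written_arrs p) s s' ->
     reg s' x = k -> reg (sem p s') c = reg s' c + w k) ->
  reg (sem (CFor x b p) s) c = reg s c + \sum_(k < m) w k.
Proof.
move=> sm xb xc xp bp IP.
have -> : \sum_(k < m) w k = \sum_(k < m | k < m) w k.
  by apply: eq_bigl => k; rewrite ltn_ord.
apply: (sem_for_upto (I := fun t s' => reg s' c = reg s c + \sum_(k < m | k < t) w k)) => //.
  by rewrite /= eq_sym (negPf xc) big_pred0 ?addn0 // => k; rewrite ltn0.
move=> k s' xk sb IH; rewrite /= eq_sym (negPf xc) (IP k s' sb xk) IH -addnA.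
congr (_ + _); rewrite [RHS](bigD1 k) ?ltnSn //= addnC; congr (_ + _).
by apply: eq_bigl => i; rewrite ltnS [LHS]ltn_neqAle andbC.
Qed.

Variables (n rho : nat) (E : rel 'I_n) (F : {set 'I_n}).
Variables (l : 'I_rho -> 'I_n * 'I_n) (V : 'I_rho -> {set 'I_n}).
Hypothesis lE : forall k, E (l k).1 (l k).2.
Implicit Types (s : machine) (J : {set 'I_n}).

Definition stores_links s : Prop :=
  forall k : 'I_rho, arr s link_arr k 0 = (l k).1 /\ arr s link_arr k 1 = (l k).2.

Definition stores_family s a (W : 'I_rho -> {set 'I_n}) : Prop :=
  forall (j : 'I_n) (k : 'I_rho), arr s a j k = (j \in W k).

Lemma same_but_links rs xs s s' :
  same_but rs xs s s' -> link_arr \notin xs -> stores_links s -> stores_links s'.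
Proof. by move=> [_ h] gx sl k; rewrite !h //; apply: sl. Qed.

Lemma same_but_family rs xs s s' a W :
  same_but rs xs s s' -> a \notin xs -> stores_family s a W -> stores_family s' a W.
Proof. by move=> [_ h] gx sl j k; rewrite !h //; apply: sl. Qed.

(** The empty set stands for a link that cuts nothing off from [F]. *)
Definition cut_part (k : 'I_rho) : {set 'I_n} :=
  if [disjoint tail_reach E (l k) & F] then tail_reach E (l k) else set0.

(** Register 26, the verdict of [test_cut], is 0 if the tail is cut off. *)
Definition copy_cut : cprog :=
  CFor 12 0 (CPut cut_arr (Reg 12) (Reg 19) (Less (Reg 26) (Cell mark_arr (Reg 12) (Const 0)))).

Definition count_cut : cprog :=
  CFor 12 0 (CIf (Cell cut_arr (Reg 12) (Reg 19)) (CSet 27 (Succ (Reg 27))) CSkip).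

Definition cut_table : cprog :=
  CFor 19 1
    (CSet 20 (Cell link_arr (Reg 19) (Const 0)) ;;
     CSet 25 (Cell link_arr (Reg 19) (Const 1)) ;;
     test_cut ;;
     copy_cut ;;
     CSet 27 (Const 0) ;;
     count_cut ;;
     CPut size_arr (Reg 19) (Const 0) (Reg 27))%code.

Lemma sem_cut_table s :
  reg s 0 = n -> reg s 1 = rho -> stores_graph s 0 E -> stores_set s 1 F ->
  stores_links s ->
  let s' := sem cut_table s in
  [/\ stores_graph s' 0 E, stores_family s' cut_arr cut_part
    & forall k : 'I_rho, arr s' size_arr k 0 = #|cut_part k|].
Proof.
move=> sn s1 sE sF sl /=; rewrite /cut_table; set body := CSeq _ _.
pose I t s' := [/\ stores_graph s' 0 E,
  forall (j : 'I_n) (k : 'I_rho), k < t -> arr s' cut_arr j k = (j \in cut_part k)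
  & forall k : 'I_rho, k < t -> arr s' size_arr k 0 = #|cut_part k|].
suff : I rho (sem (CFor 19 1 body) s).
  by case=> h1 h2 h3; split=> // [j k|k]; [apply: h2|apply: h3].
apply: sem_for_upto => //.
move=> k s2 xk sb2 [h1 h2 h3].
have s2n : reg s2 0 = n by rewrite sb2.1.
have s2F : stores_set s2 1 F := same_but_stores (a := 1) sb2 isT sF.
have s2l : stores_links s2 := same_but_links sb2 isT sl.
rewrite /body 6!sem_seq !sem_set sem_put.
have [la lb] := s2l k.
rewrite [eval s2 _]/= xk la; set s3 := set_reg s2 20 _.
have -> : eval s3 (Cell 3 (Reg 19) (Const 1)) = (l k).2 by rewrite /= xk.
set s4 := set_reg s3 25 _.
have s4n : reg s4 0 = n by [].
set s5 := sem test_cut s4.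
have sb5 := sem_same_but test_cut s4; rewrite -/s5 in sb5.
have [s5b s5M s5E] := sem_test_cut (a := (l k).1) (b := (l k).2) s4n erefl erefl (lE k) h1 s2F.
rewrite -/s5 -surjective_pairing in s5b s5M s5E.
have s5n : reg s5 0 = n by rewrite sb5.1.
have s519 : reg s5 19 = k by rewrite sb5.1.
have s5c : forall (j : 'I_n) (i : 'I_rho), i < k -> arr s5 cut_arr j i = (j \in cut_part i).
  by move=> j i ik; rewrite sb5.2 //; apply: h2.
have s5s : forall (i : 'I_rho), i < k -> arr s5 size_arr i 0 = #|cut_part i|.
  by move=> i ik; rewrite sb5.2 //; apply: h3.
clearbody s5.
set s6 := sem copy_cut s5.
have sb6 : same_but [:: 12] [:: cut_arr] s5 s6 := sem_same_but copy_cut s5.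
have s6c : forall (j : 'I_n) (i : 'I_rho), i < k.+1 -> arr s6 cut_arr j i = (j \in cut_part i).
  have : (forall (j : 'I_n), j < n -> arr s6 cut_arr j k = (j \in cut_part k)) /\
    (forall (j : 'I_n) (i : 'I_rho), i < k -> arr s6 cut_arr j i = (j \in cut_part i)).
    apply: (sem_for_n (I := fun t s' =>
      (forall (j : 'I_n), j < t -> arr s' cut_arr j k = (j \in cut_part k)) /\
      (forall (j : 'I_n) (i : 'I_rho), i < k -> arr s' cut_arr j i = (j \in cut_part i)))) => //.
    move=> j s' xj sb [IH1 IH2]; rewrite sem_put /= xj (sb.1 19) // s519 (sb.1 26) // s5b.
    rewrite sb.2 // s5M; split=> [i|i i' ik]; last by rewrite (ltn_eqF ik) andbF; apply: IH2.
    rewrite ltnS leq_eqVlt eqxx andbT; case: (eqVneq (i : nat) j) => [/ord_inj-> _|_ /IH1 //].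
    rewrite /cut_part; case: [disjoint _ & _] => /=; last by rewrite in_set0; case: (_ \in _).
    by case: (_ \in _).
  case=> c1 c2 j i; rewrite ltnS leq_eqVlt => /orP[/eqP/ord_inj->|]; first exact: c1.
  exact: c2.
set s7 := set_reg s6 27 _; set s8 := sem _ s7.
have sb8 : same_but [:: 12; 27] [::] s7 s8 := sem_same_but count_cut s7.
have s7n : reg s7 0 = n by rewrite /= sb6.1.
have s819 : reg s8 19 = k by rewrite sb8.1 //= sb6.1.
have s827 : reg s8 27 = #|cut_part k|.
  rewrite /s8 /count_cut (sem_sum (w := fun j : 'I_n => j \in cut_part k) s7n) //.
    by rewrite /= add0n -sum1_card [RHS]big_mkcond; apply: eq_bigr => j _; case: (_ \in _).
  move=> j s' sb xj; rewrite sem_if /= xj sb.1 //= sb6.1 // s519 sb.2 //= s6c ?ltnSn //.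
  by case: (_ \in _) => /=; rewrite ?sem_set ?sem_skip /= ?addn1 ?addn0.
have s8c : forall (j : 'I_n) (i : 'I_rho), i < k.+1 -> arr s8 cut_arr j i = (j \in cut_part i).
  by move=> j i ik; rewrite sb8.2 //=; apply: s6c.
have s8E : stores_graph s8 0 E.
  have h : stores_graph s6 0 E by exact: (same_but_graph sb6).
  by move=> i j; rewrite sb8.2 //=; apply: h.
have s8s : forall (i : 'I_rho), i < k -> arr s8 size_arr i 0 = #|cut_part i|.
  by move=> i ik; rewrite sb8.2 //= sb6.2 //; apply: s5s.
clearbody s8; split=> //.
move=> i; rewrite /= s819 s827 ltnS leq_eqVlt andbT.
by case: (eqVneq (i : nat) k) => [/ord_inj-> //|_ /s8s].
Qed.

(** Ties are broken by the index, which keeps one of several equal parts. *)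
Definition smaller_part (m k : 'I_rho) : bool :=
  [&& (l m).1 \in cut_part k, cut_part m != set0
    & (#|cut_part m| < #|cut_part k|) || (#|cut_part m| == #|cut_part k|) && (m < k)].

Definition minimal_parts : {set 'I_rho} :=
  [set k | (cut_part k != set0) && [forall m, ~~ smaller_part m k]].

Definition minimal_table : cprog :=
  CFor 19 1
    (CPut cut_open_arr (Reg 19) (Const 0) (Less (Const 0) (Cell size_arr (Reg 19) (Const 0))) ;;
     CFor 28 1
       (CIf (Cell cut_arr (Cell link_arr (Reg 28) (Const 0)) (Reg 19))
          (CIf (Cell size_arr (Reg 28) (Const 0))
             (CIf (Less (Cell size_arr (Reg 28) (Const 0)) (Cell size_arr (Reg 19) (Const 0)))
                (CPut cut_open_arr (Reg 19) (Const 0) (Const 0))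
                (CIf (Equal (Cell size_arr (Reg 28) (Const 0)) (Cell size_arr (Reg 19) (Const 0)))
                   (CIf (Less (Reg 28) (Reg 19))
                      (CPut cut_open_arr (Reg 19) (Const 0) (Const 0))
                      CSkip)
                   CSkip))
             CSkip)
          CSkip))%code.

Lemma sem_minimal_table s :
  reg s 1 = rho -> stores_links s -> stores_family s cut_arr cut_part ->
  (forall k : 'I_rho, arr s size_arr k 0 = #|cut_part k|) ->
  stores_set (sem minimal_table s) cut_open_arr minimal_parts.
Proof.
move=> s1 sl sc ss; rewrite /minimal_table; set test := CIf _ _ _.
set body := CSeq _ _.
suff : forall k : 'I_rho, k < rho -> arr (sem (CFor 19 1 body) s) cut_open_arr k 0 = (k \in minimal_parts).
  by move=> h k; apply: h.
apply: (sem_for_upto (I := fun t s' => forall k : 'I_rho, k < t ->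
  arr s' cut_open_arr k 0 = (k \in minimal_parts))) => //.
move=> k s2 xk sb2 IH i; rewrite ltnS leq_eqVlt /body sem_seq sem_put /= xk.
rewrite sb2.2 // ss; set s3 := set_arr s2 _ _ _ _.
have s31 : reg s3 1 = rho by rewrite /= sb2.1.
pose good t := (cut_part k != set0) && [forall m : 'I_rho, (m < t) ==> ~~ smaller_part m k].
have kE : (k \in minimal_parts) = good rho.
  by rewrite inE; congr (_ && _); apply: eq_forallb => m; rewrite ltn_ord.
suff [h1 h2] : arr (sem (CFor 28 1 test) s3) cut_open_arr k 0 = good rho /\
    forall i : 'I_rho, i < k -> arr (sem (CFor 28 1 test) s3) cut_open_arr i 0 = (i \in minimal_parts).
  by case: (eqVneq (i : nat) k) => [/ord_inj-> _|_ /h2 //]; rewrite kE.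
apply: (sem_for_upto (I := fun t s' => arr s' cut_open_arr k 0 = good t /\
    forall i : 'I_rho, i < k -> arr s' cut_open_arr i 0 = (i \in minimal_parts))) => //.
  split.
    rewrite /= !eqxx /= /good -card_gt0; case: (0 < _) => //=.
    by apply/esym/eqP; rewrite eqb1; apply/forallP.
  by move=> j jk; rewrite /= (ltn_eqF jk) /=; apply: IH.
move=> m s4 xm sb4 [IH1 IH2].
have s419 : reg s4 19 = k by rewrite sb4.1.
have goodS : good m.+1 = good m && ~~ smaller_part m k.
  rewrite /good -andbA; congr (_ && _); apply/forallP/andP=> [h|[/forallP h hm] j].
    split; last by have := h m; rewrite ltnSn.
    by apply/forallP=> j; apply/implyP=> jm; have := h j; rewrite ltnS (ltnW jm).
  apply/implyP; rewrite ltnS leq_eqVlt => /orP[/eqP/ord_inj->//|jm].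
  by have := h j; rewrite jm.
have keep s5 : ~~ smaller_part m k -> (forall i, arr s5 cut_open_arr i 0 = arr s4 cut_open_arr i 0) ->
    arr s5 cut_open_arr k 0 = good m.+1 /\
    forall i : 'I_rho, i < k -> arr s5 cut_open_arr i 0 = (i \in minimal_parts).
  by move=> nm e5; rewrite goodS nm andbT e5; split=> // j jk; rewrite e5; apply: IH2.
have drop : smaller_part m k ->
    let s5 := set_arr s4 cut_open_arr k 0 0 in
    arr s5 cut_open_arr k 0 = good m.+1 /\
    forall i : 'I_rho, i < k -> arr s5 cut_open_arr i 0 = (i \in minimal_parts).
  move=> ym /=; rewrite goodS ym andbF !eqxx; split=> // j jk.
  by rewrite (ltn_eqF jk) /=; apply: IH2.
have s4l : arr s4 link_arr m 0 = (l m).1.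
  by rewrite sb4.2 //= sb2.2 //; have [] := sl m.
have s4c (j : 'I_n) : arr s4 cut_arr j k = (j \in cut_part k).
  by rewrite sb4.2 //= sb2.2.
have s4s (j : 'I_rho) : arr s4 size_arr j 0 = #|cut_part j|.
  by rewrite sb4.2 //= sb2.2.
rewrite /test sem_if /= xm s419 s4l s4c; case: (boolP (_ \in _)) => am /=; last first.
  by apply: keep => //; rewrite /smaller_part (negPf am).
rewrite sem_if /= xm s4s cards_eq0; case: (boolP (cut_part m != set0)) => m0 /=; last first.
  by apply: keep => //; rewrite /smaller_part (negPf m0) andbF.
rewrite sem_if /= xm s419 !s4s.
have smE : smaller_part m k = (#|cut_part m| < #|cut_part k|) || (#|cut_part m| == #|cut_part k|) && (m < k).
  by rewrite /smaller_part am m0.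
case: (boolP (#|cut_part m| < #|cut_part k|)) => lt /=.
  by rewrite ?sem_put /= s419; apply: drop; rewrite smE lt.
rewrite sem_if /= xm s419 !s4s; case: (boolP (#|cut_part m| == #|cut_part k|)) => eq /=; last first.
  by apply: keep => //; rewrite smE (negPf lt) (negPf eq).
rewrite sem_if /= xm s419; case: (boolP (m < k)) => mk /=.
  by rewrite ?sem_put /= s419; apply: drop; rewrite smE eq mk orbT.
by apply: keep => //; rewrite smE (negPf lt) (negPf mk) andbF.
Qed.

End Approximate.

(** ** The greedy algorithm *)

Section GreedyProgram.

Import Defs boot.fintype boot.finset.

Local Open Scope nat_scope.

Arguments sem : simpl never.

Variables (R : realType) (n rho : nat) (V Q : 'I_rho -> {set 'I_n}).
Implicit Types (s : machine) (J : {set 'I_n}) (U : {set 'I_rho + 'I_rho}).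

(** A link can give rise to two constraints, its back-ups and the part that it
    cuts off, so the constraints are indexed by two copies of the links. *)
Definition constraint (i : 'I_rho + 'I_rho) : {set 'I_n} :=
  match i with inl k => V k | inr k => Q k end.

Local Notation cov := (coverage constraint).

Definition stores_open s U : Prop :=
  stores_set s tip_open_arr [set k | inl k \in U] /\
  stores_set s cut_open_arr [set k | inr k \in U].

Lemma coverage_sum U (v : 'I_n) :
  cov U v = \sum_(k < rho) (((inl k \in U) && (v \in V k)) + ((inr k \in U) && (v \in Q k))).
Proof.
rewrite big_split /= /coverage -sum1_card big_mkcond big_sumType /=.
by congr (_ + _); apply: eq_bigr => k _; rewrite inE; case: (_ && _).
Qed.

Definition count_open : cprog :=
  (CSet 27 (Const 0) ;;
   CFor 19 1
     (CIf (Cell tip_open_arr (Reg 19) (Const 0))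
        (CIf (Cell cover_arr (Reg 20) (Reg 19)) (CSet 27 (Succ (Reg 27))) CSkip) CSkip ;;
      CIf (Cell cut_open_arr (Reg 19) (Const 0))
        (CIf (Cell cut_arr (Reg 20) (Reg 19)) (CSet 27 (Succ (Reg 27))) CSkip) CSkip))%code.

Lemma sem_count_open s U (v : 'I_n) :
  reg s 1 = rho -> reg s 20 = v -> stores_family s cover_arr V ->
  stores_family s cut_arr Q -> stores_open s U ->
  reg (sem count_open s) 27 = cov U v.
Proof.
move=> s1 sv sV sQ [sT sC]; rewrite /count_open sem_seq sem_set coverage_sum.
rewrite (sem_sum (m := rho) (w := fun k => ((inl k \in U) && (v \in V k)) + ((inr k \in U) && (v \in Q k)))) //.
move=> k s' sb xk.
have h20 : reg s' 20 = v by rewrite sb.1.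
have hT : arr s' tip_open_arr k 0 = (inl k \in U) by rewrite sb.2 //= sT inE.
have hC : arr s' cut_open_arr k 0 = (inr k \in U) by rewrite sb.2 //= sC inE.
have hV : arr s' cover_arr v k = (v \in V k) by rewrite sb.2 //= sV.
have hQ : arr s' cut_arr v k = (v \in Q k) by rewrite sb.2 //= sQ.
rewrite sem_seq [sem (CIf (Cell tip_open_arr _ _) _ _) s']sem_if /= xk hT.
have step s2 : reg s2 19 = k -> reg s2 20 = v ->
    arr s2 cut_open_arr k 0 = (inr k \in U) -> arr s2 cut_arr v k = (v \in Q k) ->
    reg (sem (CIf (Cell cut_open_arr (Reg 19) (Const 0))
        (CIf (Cell cut_arr (Reg 20) (Reg 19)) (CSet 27 (Succ (Reg 27))) CSkip) CSkip) s2) 27 =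
    reg s2 27 + ((inr k \in U) && (v \in Q k)).
  move=> g1 g2 g3 g4; rewrite sem_if /= g1 g3; case: (inr k \in U) => /=; last by rewrite ?sem_skip addn0.
  rewrite sem_if /= g1 g2 g4; case: (v \in Q k) => /=; first by rewrite ?sem_set /= addn1.
  by rewrite ?sem_skip addn0.
case: (inl k \in U) => /=; last by rewrite ?sem_skip step // add0n.
rewrite [sem (CIf (Cell cover_arr _ _) _ _) s']sem_if /= xk h20 hV; case: (v \in V k) => /=; last by rewrite ?sem_skip step // add0n.
by rewrite ?sem_set step //= addSnnS.
Qed.

Definition pick_best : cprog :=
  (CSet 30 (Const 0) ;;
   CFor 20 0
     (count_open ;;
      CIf (Less (Reg 30) (Reg 27)) (CSet 30 (Reg 27) ;; CSet 31 (Reg 20)) CSkip))%code.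

Lemma sem_pick_best s U :
  reg s 0 = n -> reg s 1 = rho -> stores_family s cover_arr V ->
  stores_family s cut_arr Q -> stores_open s U ->
  let s' := sem pick_best s in
  (forall v, cov U v <= reg s' 30) /\
  (0 < reg s' 30 -> exists2 v : 'I_n, reg s' 31 = v & cov U v = reg s' 30).
Proof.
move=> sn s1 sV sQ sU /=; rewrite /pick_best sem_seq sem_set.
set s0 := set_reg s 30 _; set body := CSeq _ _.
suff [h1 h2] : (forall v : 'I_n, v < n -> cov U v <= reg (sem (CFor 20 0 body) s0) 30) /\
  (0 < reg (sem (CFor 20 0 body) s0) 30 -> exists2 v : 'I_n,
     reg (sem (CFor 20 0 body) s0) 31 = v & cov U v = reg (sem (CFor 20 0 body) s0) 30).
  by split=> // v; apply: h1.
apply: (sem_for_n (I := fun t s' => (forall v : 'I_n, v < t -> cov U v <= reg s' 30) /\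
  (0 < reg s' 30 -> exists2 v : 'I_n, reg s' 31 = v & cov U v = reg s' 30))) => //.
move=> k s2 xk sb [IH1 IH2]; rewrite /body sem_seq.
have s21 : reg s2 1 = rho by rewrite sb.1.
have sU2 : stores_open s2 U.
  by split; [apply: (same_but_stores sb); first by []|apply: (same_but_stores sb); first by []]; case: sU.
have sV2 := same_but_family (a := cover_arr) sb isT (sV : stores_family s0 cover_arr V).
have sQ2 := same_but_family (a := cut_arr) sb isT (sQ : stores_family s0 cut_arr Q).
have c3 := sem_count_open s21 xk sV2 sQ2 sU2.
have sb3 := sem_same_but count_open s2; set s3 := sem count_open s2 in c3 sb3 *.
have s330 : reg s3 30 = reg s2 30 by rewrite sb3.1.
have s331 : reg s3 31 = reg s2 31 by rewrite sb3.1.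
have s320 : reg s3 20 = k by rewrite sb3.1.
clearbody s3.
rewrite sem_if /= c3 s330; case: (ltnP (reg s2 30) (cov U k)) => lt /=.
  rewrite ?sem_seq ?sem_set /= c3 s320; split=> [v|_]; last by exists k.
  rewrite ltnS leq_eqVlt => /orP[/eqP/ord_inj->//|/IH1 h].
  exact: leq_trans h (ltnW lt).
rewrite ?sem_skip /= s330 s331; split=> // v.
by rewrite ltnS leq_eqVlt => /orP[/eqP/ord_inj->|/IH1].
Qed.

Definition close_constraints : cprog :=
  CFor 19 1
    (CIf (Cell cover_arr (Reg 31) (Reg 19)) (CPut tip_open_arr (Reg 19) (Const 0) (Const 0)) CSkip ;;
     CIf (Cell cut_arr (Reg 31) (Reg 19)) (CPut cut_open_arr (Reg 19) (Const 0) (Const 0)) CSkip)%code.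

Lemma sem_close_constraints s U (v : 'I_n) :
  reg s 1 = rho -> reg s 31 = v -> stores_family s cover_arr V ->
  stores_family s cut_arr Q -> stores_open s U ->
  stores_open (sem close_constraints s) (uncover constraint U v).
Proof.
move=> s1 sv sV sQ sU.
pose Uk t := [set i in U | match i with inl k => ~~ ((k < t) && (v \in V k))
                                     | inr k => ~~ ((k < t) && (v \in Q k)) end].
have -> : uncover constraint U v = Uk rho.
  by apply/setP=> -[k|k]; rewrite !inE ltn_ord.
apply: (sem_for_upto (I := fun t s' => stores_open s' (Uk t))) => //.
  have -> : Uk 0 = U by apply/setP=> -[k|k]; rewrite !inE /= andbT.
  exact: sU.
move=> k s2 xk sb [IH1 IH2].
have s231 : reg s2 31 = v by rewrite sb.1.
have hV : arr s2 cover_arr v k = (v \in V k) by rewrite sb.2 //= sV.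
have hQ : arr s2 cut_arr v k = (v \in Q k) by rewrite sb.2 //= sQ.
rewrite sem_seq; set s3 := sem _ s2.
have sb3 : same_but [::] [:: tip_open_arr] s2 s3 := sem_same_but
  (CIf (Cell cover_arr (Reg 31) (Reg 19)) (CPut tip_open_arr (Reg 19) (Const 0) (Const 0)) CSkip) s2.
have T3 : stores_set s3 tip_open_arr [set k' | inl k' \in Uk k.+1].
  rewrite /s3 sem_if /= xk s231 hV; case: (boolP (v \in V k)) => vk /=.
    rewrite ?sem_put /= xk; apply: stores_set_eq (stores_set_del (a := tip_open_arr) k IH1).
    apply/setP=> i; rewrite !inE ltnS [i <= _]leq_eqVlt -val_eqE /=.
    by case: (eqVneq (i : nat) k) => [/ord_inj->|] //=; rewrite vk andbF.
  rewrite ?sem_skip; apply: stores_set_eq IH1.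
  apply/setP=> i; rewrite !inE ltnS [i <= _]leq_eqVlt /=.
  by case: (eqVneq (i : nat) k) => [/ord_inj->|] //=; rewrite (negPf vk) ltnn.
have h319 : reg s3 19 = k by rewrite sb3.1.
have h331 : reg s3 31 = v by rewrite sb3.1.
have hQ3 : arr s3 cut_arr v k = (v \in Q k) by rewrite sb3.2.
have IH3 : stores_set s3 cut_open_arr [set k' | inr k' \in Uk k] by apply: (same_but_stores sb3).
clearbody s3.
rewrite sem_if /= h319 h331 hQ3; case: (boolP (v \in Q k)) => vk /=; split.
- by rewrite ?sem_put; exact: T3.
- rewrite ?sem_put /= h319; apply: stores_set_eq (stores_set_del (a := cut_open_arr) k IH3).
  apply/setP=> i; rewrite !inE ltnS [i <= _]leq_eqVlt -val_eqE /=.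
  by case: (eqVneq (i : nat) k) => [/ord_inj->|] //=; rewrite vk andbF.
- exact: T3.
rewrite ?sem_skip; apply: stores_set_eq IH3.
apply/setP=> i; rewrite !inE ltnS [i <= _]leq_eqVlt /=.
by case: (eqVneq (i : nat) k) => [/ord_inj->|] //=; rewrite (negPf vk) ltnn.
Qed.

Definition greedy_cover : cprog :=
  (fill chosen_arr 12 (Const 0) ;;
   CFor 29 0
     (pick_best ;;
      CIf (Reg 30)
        (CPut chosen_arr (Reg 31) (Const 0) (Const 1) ;; close_constraints)
        CSkip))%code.

(** Every round chooses a new vertex until no open constraint can be met; after
    [n] rounds all vertices have been chosen. *)
Lemma sem_greedy_cover s U0 :
  reg s 0 = n -> reg s 1 = rho -> stores_family s cover_arr V ->
  stores_family s cut_arr Q -> stores_open s U0 ->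
  (forall i, i \in U0 -> constraint i != set0) ->
  exists J U, [/\ stores_set (sem greedy_cover s) chosen_arr J,
    greedy_state R constraint U0 J U & hitting constraint U0 J].
Proof.
move=> sn s1 sV sQ sU U0n; rewrite /greedy_cover sem_seq; set s0 := sem _ s.
have sb0 : same_but [:: 12] [:: chosen_arr] s s0 := sem_same_but (fill chosen_arr 12 (Const 0)) s.
have s0J : stores_set s0 chosen_arr (set0 : {set 'I_n}).
  by apply: sem_fill => // s' i _ _; rewrite in_set0.
set body := CSeq _ _.
pose I t s' := exists J U, [/\ stores_set s' chosen_arr J, stores_open s' U,
  greedy_state R constraint U0 J U & t <= #|J| \/ forall v, cov U v = 0].
suff : I n (sem (CFor 29 0 body) s0).
  case=> J [U [sJ _ gs st]]; exists J, U; split=> //.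
  case: st => [nJ|c0]; last exact: (greedy_stalled gs).
  have JT : J = setT.
    by apply/eqP; rewrite eqEcard subsetT cardsT card_ord.
  by rewrite JT; apply: hitting_setT.
apply: sem_for_n => //; first by rewrite sb0.1.
  exists set0, U0; split=> //; last by left; rewrite cards0.
    have [h1 h2] := sU; split; last by exact: (same_but_stores (a := cut_open_arr) sb0 isT h2).
    exact: (same_but_stores (a := tip_open_arr) sb0 isT h1).
  exact: greedy_state0.
move=> k s2 xk sb2 [J [U [sJ sUU gs st]]].
have sb := same_but_chain sb0 sb2.
have s2n : reg s2 0 = n by rewrite sb.1.
have s21 : reg s2 1 = rho by rewrite sb.1.
have sV2 := same_but_family (a := cover_arr) sb isT sV.
have sQ2 := same_but_family (a := cut_arr) sb isT sQ.
rewrite /body sem_seq.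
have [best pick] := sem_pick_best s2n s21 sV2 sQ2 sUU.
have sb3 := sem_same_but pick_best s2; set s3 := sem pick_best s2 in best pick sb3 *.
have s3J := same_but_stores (a := chosen_arr) sb3 isT sJ.
have s3U : stores_open s3 U.
  have [h1 h2] := sUU; split; last by exact: (same_but_stores (a := cut_open_arr) sb3 isT h2).
  exact: (same_but_stores (a := tip_open_arr) sb3 isT h1).
have s31 : reg s3 1 = rho by rewrite sb3.1.
have sV3 := same_but_family (a := cover_arr) sb3 isT sV2.
have sQ3 := same_but_family (a := cut_arr) sb3 isT sQ2.
clearbody s3.
rewrite sem_if [eval s3 _]/=; case: (posnP (reg s3 30)) => [b0|b0].
  rewrite [~~ _]/= ?sem_skip; exists J, U; split=> //; right=> v.
  by apply/eqP; rewrite -leqn0 -b0.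
rewrite [~~ _]/=; have [v s3v cv] := pick b0.
have c0 : 0 < cov U v by rewrite cv.
have [gs' cJ] := greedy_stateS gs c0 (fun w => leq_trans (best w) (eq_leq (esym cv))).
rewrite sem_seq sem_put /= s3v; set s4 := set_arr s3 _ _ _ _.
have s4J : stores_set s4 chosen_arr (v |: J) by apply: stores_set_add.
have s4U := sem_close_constraints (s := s4) s31 s3v sV3 sQ3 s3U.
have sb5 := sem_same_but close_constraints s4; set s5 := sem close_constraints s4 in s4U sb5 *.
have s5J := same_but_stores (a := chosen_arr) sb5 isT s4J.
clearbody s5.
exists (v |: J), (uncover constraint U v); split=> //; left; rewrite cJ ltnS.
by case: st => // c00; rewrite c00 in c0.
Qed.

End GreedyProgram.

(** * Robustness and performance of the approximate cover *)

Section MinimalParts.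

Import Defs boot.fintype boot.finset.

Local Open Scope nat_scope.

Variables (n rho : nat) (E : rel 'I_n) (F : {set 'I_n}) (l : 'I_rho -> 'I_n * 'I_n).
Hypothesis eF : reaches E F.
Local Notation Q := (cut_part E F l).

Lemma cut_partP k : Q k != set0 ->
  [/\ [disjoint tail_reach E (l k) & F], Q k = tail_reach E (l k) & (l k).1 \in Q k].
Proof.
rewrite /cut_part; case: ifP => [dl _|_]; last by rewrite eqxx.
by split=> //; apply: tail_reachxx.
Qed.

Lemma cut_off_part k : [disjoint tail_reach E (l k) & F] -> Q k = tail_reach E (l k).
Proof. by rewrite /cut_part => ->. Qed.

Lemma cut_part_disjoint k : [disjoint Q k & F].
Proof.
rewrite /cut_part; case: ifP => // _.
by apply/pred0P => x; rewrite /= inE.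
Qed.

Lemma cut_part_laminar m k x : x \in Q m -> x \in Q k ->
  (Q m \subset Q k) || (Q k \subset Q m).
Proof.
move=> xm xk; have m0 : Q m != set0 by apply/set0Pn; exists x.
have k0 : Q k != set0 by apply/set0Pn; exists x.
have [dm mE _] := cut_partP m0; have [dk kE _] := cut_partP k0.
rewrite mE kE; apply: (tail_reach_laminar eF) => //.
by apply/pred0Pn; exists x; rewrite /= -mE -kE xm.
Qed.

Lemma smaller_part_sub m k : smaller_part E F l m k -> Q m \subset Q k.
Proof.
case/and3P=> mk m0 sz; have [_ _ mm] := cut_partP m0.
have /orP[//|km] := cut_part_laminar mm mk.
have le : #|Q m| <= #|Q k| by case/orP: sz => [/ltnW//|/andP[/eqP-> _]].
by have /eqP-> : Q k == Q m by rewrite eqEcard km.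
Qed.

(** The order of [smaller_part] is lexicographic, on the size and then the index;
    [key] linearizes it. *)
Lemma minimal_part_below k :
  Q k != set0 -> exists2 m, m \in minimal_parts E F l & Q m \subset Q k.
Proof.
move=> k0; pose key (m : 'I_rho) := #|Q m| * rho + m.
pose P m := (Q m != set0) && (Q m \subset Q k).
have Pk : P k by rewrite /P k0 subxx.
case: (arg_minnP key Pk) => m /andP[m0 mk] mmin; exists m => //.
rewrite inE m0; apply/forallP=> m'; apply/negP=> sm.
have m'm := smaller_part_sub sm; case/and3P: (sm) => _ m'0 sz.
have := mmin m'; rewrite /P m'0 (subset_trans m'm mk) => /(_ isT).
rewrite leqNgt => /negP[]; rewrite /key; have := ltn_ord m'.
case/orP: sz => [lt|/andP[/eqP-> lt]]; last by rewrite ltn_add2l.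
have : #|Q m'|.+1 * rho <= #|Q m| * rho by rewrite leq_mul2r lt orbT.
by rewrite mulSn; lia.
Qed.

Lemma minimal_parts_disjoint m k x :
  m \in minimal_parts E F l -> k \in minimal_parts E F l ->
  x \in Q m -> x \in Q k -> m = k.
Proof.
wlog: m k / Q m \subset Q k => [wl mP kP xm xk|mk].
  have /orP[mk|km] := cut_part_laminar xm xk; first exact: wl.
  by apply/esym/wl.
rewrite !inE => /andP[m0 /forallP mm] /andP[k0 /forallP km] xm xk.
have [_ _ am] := cut_partP m0; have [_ _ ak] := cut_partP k0.
have := km m; rewrite /smaller_part (subsetP mk _ am) m0 /= negb_or negb_and.
rewrite -leqNgt => /andP[sz]; have QE : Q m = Q k by apply/eqP; rewrite eqEcard mk.
rewrite QE eqxx /= -leqNgt => le1.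
have := mm k; rewrite /smaller_part QE ak k0 ltnn eqxx /= -leqNgt => le2.
by apply/ord_inj/eqP; rewrite eqn_leq le1 le2.
Qed.

End MinimalParts.

Section ApproximateCorrect.

Import Defs boot.fintype boot.finset.

Local Open Scope nat_scope.

Arguments sem : simpl never.

Definition open_tips : cprog :=
  CFor 19 1 (CPut tip_open_arr (Reg 19) (Const 0) (Less (Reg 19) (Reg 2))).

Definition approximate : cprog :=
  (cut_table ;; minimal_table ;; open_tips ;; greedy_cover)%code.

Lemma sem_open_tips rho r s :
  reg s 1 = rho -> reg s 2 = r ->
  stores_set (sem open_tips s) tip_open_arr [set k : 'I_rho | k < r].
Proof.
move=> s1 s2.
suff : forall k : 'I_rho, k < rho -> arr (sem open_tips s) tip_open_arr k 0 = (k \in [set k : 'I_rho | k < r]).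
  by move=> h k; apply: h.
apply: (sem_for_upto (I := fun t s' => forall k : 'I_rho, k < t ->
  arr s' tip_open_arr k 0 = (k \in [set k : 'I_rho | k < r]))) => //.
move=> k s' xk sb IH i; rewrite ltnS leq_eqVlt sem_put /= xk (sb.1 2) // s2 andbT.
by case: (eqVneq (i : nat) k) => [/ord_inj-> _|_ /IH //]; rewrite inE.
Qed.

Variables (R : realType) (n : nat) (A : 'M[bool]_n) (T F : {set 'I_n}).
Variables (rho r : nat) (lk : rho.-tuple ('I_n * 'I_n)) (f : 'I_n -> 'I_n).
Local Notation E := (state_edge A).
Local Notation l := (fun k => tnth lk k).

Hypothesis fP : matching E (~: T) f.
Hypothesis TF : T \subset F.
Hypothesis eF : reaches E F.
Hypothesis lkP : sensitive_links R A F r lk.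

Local Notation V := (fun k => [set j | k \in Vset A T r lk j]).
Local Notation Q := (cut_part E F l).
Local Notation X := (constraint V Q).

Lemma link_edge (k : 'I_rho) : E (tnth lk k).1 (tnth lk k).2.
Proof. by have [_ h _ _ _] := lkP; have /h[] := mem_tnth k lk. Qed.

Lemma tip_link (k : 'I_rho) : k < r ->
  critical_edge (state_edge A) T F f (tnth lk k) /\ V k = release_set E T f (tnth lk k).1.
Proof.
have [_ _ _ h _] := lkP => kr; have cr : critical_edge (state_edge A) T F f (tnth lk k).
  by apply/(tip_criticalP fP TF)/h.
by split=> //; apply/setP=> j; rewrite inE VsetE kr (release_setE fP TF cr).
Qed.

Lemma cut_link (k : 'I_rho) : r <= k ->
  [disjoint tail_reach E (tnth lk k) & F] /\ V k = tail_reach E (tnth lk k).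
Proof.
have [_ _ _ _ h] := lkP => kr.
have /(sink_sensitiveE fP TF eF)[_ cl] := h k kr; split=> //.
by apply/setP=> j; rewrite inE VsetE ltnNge kr /= (sink_completionsE eF cl).
Qed.

(** A tip link is determined by its tail, and so is a cutting link. *)
Lemma rho_le2n : rho <= 2 * n.
Proof.
have [un _ _ _ _] := lkP.
have bound (P : {set 'I_rho}) :
    {in P &, forall j k, (tnth lk j).1 = (tnth lk k).1 -> tnth lk j = tnth lk k} -> #|P| <= n.
  move=> inj; rewrite -[leqRHS]card_ord.
  have <- : #|[set (tnth lk k).1 | k in P]| = #|P|; last exact: max_card.
  by apply: card_in_imset => j k jP kP /(inj _ _ jP kP); apply: tuple_uniqP.
have := cardsC [set k : 'I_rho | k < r]; rewrite card_ord => <-.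
rewrite mul2n -addnn leq_add //; apply: bound => j k; rewrite !inE.
  move=> /tip_link[/critical_edgeE jE _] /tip_link[/critical_edgeE kE _] jk.
  by rewrite -jE -kE jk.
rewrite -!leqNgt => /cut_link[dj _] /cut_link[dk _].
exact: cut_edge_inj dj dk.
Qed.

Definition open_constraints : {set 'I_rho + 'I_rho} :=
  [set i : 'I_rho + 'I_rho | match i with inl k => k < r | inr k => k \in minimal_parts E F l end].

Lemma open_constraint_neq0 (i : 'I_rho + 'I_rho) : i \in open_constraints -> X i != set0.
Proof.
rewrite inE; case: i => k /=.
  by move=> /tip_link[_ ->]; apply/set0Pn; exists (tnth lk k).1; apply: release_setxx.
by rewrite inE => /andP[].
Qed.

Lemma open_constraint_disjoint (i : 'I_rho + 'I_rho) : i \in open_constraints -> [disjoint X i & F].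
Proof.
rewrite inE; case: i => k /=; last by move=> _; apply: cut_part_disjoint.
move=> /tip_link[/and3P[_ _ nr] ->].
exact: release_set_disjoint nr.
Qed.

(** Every cut off part contains a minimal one. *)
Lemma hitting_parts J (k : 'I_rho) : hitting X open_constraints J ->
  [disjoint tail_reach E (tnth lk k) & F] -> ~~ [disjoint tail_reach E (tnth lk k) & J].
Proof.
move=> hJ dk; have QE := cut_off_part (l := l) dk.
have k0 : Q k != set0 by rewrite QE; apply/set0Pn; exists (tnth lk k).1; apply: tail_reachxx.
have [m mP mk] := minimal_part_below eF k0.
have mU : inr m \in open_constraints by rewrite inE.
have /pred0Pn[x /= /andP[xm xJ]] := hJ _ mU.
by apply/pred0Pn; exists x; rewrite /= xJ andbT -QE (subsetP mk).
Qed.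

Lemma hitting_V J (k : 'I_rho) : hitting X open_constraints J -> ~~ [disjoint V k & J].
Proof.
move=> hJ; case: (ltnP k r) => [kr|/cut_link[dk ->]]; last exact: hitting_parts.
by apply: (hJ (inl k)); rewrite inE.
Qed.

Lemma sensitive_index (e : 'I_n * 'I_n) :
  sensitive R A F e -> exists k, e = tnth lk k.
Proof. by have [_ h _ _ _] := lkP => /h /tnthP. Qed.

Lemma hitting_robust (J : {set 'I_n}) : hitting X open_constraints J -> link_robust R A (J :|: F).
Proof.
move=> hJ; apply/(link_robust_above R fP TF eF (subsetUr J F)) => e ee.
have widen (B : {set 'I_n}) : ~~ [disjoint B & J] -> ~~ [disjoint B & J :|: F].
  move=> /pred0Pn[x /= /andP[xB xJ]]; apply/pred0Pn; exists x.
  by rewrite /= xB in_setU xJ.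
split=> h.
  have [|k ek] := @sensitive_index e; first by apply/(sensitiveP R fP TF eF); rewrite h.
  case: (ltnP k r) => kr.
    by have [_ VE] := tip_link kr; rewrite ek -VE; apply/widen/hitting_V.
  have [_ _ _ _ /(_ k kr)] := lkP.
  by rewrite -ek => /(sink_sensitiveE fP TF eF)[]; rewrite h.
have [|k ek] := @sensitive_index e; first by apply/(sensitiveP R fP TF eF); rewrite h orbT.
by rewrite ek in h *; apply/widen/hitting_parts.
Qed.

Lemma hitting_covering (J : {set 'I_n}) : hitting X open_constraints J -> covering A T r lk J.
Proof.
move=> hJ; apply/subsetP=> k _; have /pred0Pn[j /= /andP[jV jJ]] := hitting_V k hJ.
by apply/bigcupP; exists j => //; rewrite inE in jV.
Qed.

(** As the constraints avoid [F], they are met by what [G] adds to [F]. *)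
Lemma robust_hitting (G : {set 'I_n}) :
  F \subset G -> link_robust R A G -> hitting X open_constraints (G :\: F).
Proof.
move=> FG /(link_robust_above R fP TF eF FG) rob i iU.
have /pred0P dF := open_constraint_disjoint iU.
suff /pred0Pn[x /= /andP[xX xG]] : ~~ [disjoint X i & G].
  apply/pred0Pn; exists x; rewrite /= xX inE xG andbT.
  by have := dF x; rewrite /= xX /= => ->.
move: iU; rewrite inE; case: i {dF} => k /=.
  by move=> /tip_link[cr ->]; apply: (rob _ (link_edge k)).1.
by rewrite inE => /andP[/cut_partP[dk -> _] _]; apply: (rob _ (link_edge k)).2.
Qed.

(** The tail of a link lies in its release set and in the part that it cuts off. *)
Lemma tails_robust : link_robust R A (F :|: [set (tnth lk k).1 | k : 'I_rho]).
Proof.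
apply/(link_robust_above R fP TF eF (subsetUl _ _)) => e ee.
have mem k : (tnth lk k).1 \in F :|: [set (tnth lk k).1 | k : 'I_rho].
  by rewrite in_setU; apply/orP; right; apply/imsetP; exists k.
split=> h; have [|k ek] := @sensitive_index e;
    try (by apply/(sensitiveP R fP TF eF); rewrite h ?orbT).
  by apply/pred0Pn; exists e.1; rewrite /= release_setxx ek mem.
by apply/pred0Pn; exists e.1; rewrite /= tail_reachxx ek mem.
Qed.

(** At most [rho] release sets, and one minimal part by disjointness. *)
Lemma coverage_le (v : 'I_n) : coverage X open_constraints v <= rho.+1.
Proof.
rewrite coverage_sum big_split /= -addn1 leq_add //.
  rewrite -[leqRHS]card_ord -sum1_card leq_sum // => k _.
  by case: (_ && _).
pose K := [set k | (inr k \in open_constraints) && (v \in Q k)].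
have -> : \sum_(k < rho) ((inr k \in open_constraints) && (v \in Q k)) = #|K|.
  by rewrite -sum1_card [RHS]big_mkcond; apply: eq_bigr => k _; rewrite /K in_set; case: (_ && _).
have KP k : k \in K -> k \in minimal_parts E F l /\ v \in Q k.
  by rewrite /K in_set [inr k \in _]in_set => /andP[].
apply/card_le1_eqP => j k /KP[jP vj] /KP[kP vk].
exact: (minimal_parts_disjoint eF kP jP vk vj).
Qed.

(** [G] adds at most [rho] elements to [F], since adding the tails of the links
    is enough. *)
Lemma approximate_ratio J U G :
  0 < n -> 0 < rho -> greedy_state R X open_constraints J U ->
  minimal_link_robust_above R A F G ->
  (#|J :|: F|%:R / #|G|%:R <= harmonic_number R rho)%R.
Proof.
move=> n0 rho0 gs [FG robG minG].
have F0 : 0 < #|F|.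
  have [y yF _] := eF (Ordinal n0); apply/card_gt0P; by exists y.
have GE : #|G| = #|F| + #|G :\: F| by rewrite -(cardsID F G) (setIidPr FG).
have g_rho : #|G :\: F| <= rho.
  rewrite -(leq_add2l #|F|) -GE; apply: leq_trans (minG _ (subsetUl _ _) tails_robust) _.
  rewrite cardsU; apply: leq_trans (leq_subr _ _) _; rewrite leq_add2l.
  by apply: leq_trans (leq_imset_card _ _) _; rewrite card_ord.
have Jle := greedy_size gs (robust_hitting FG robG) (fun g _ => coverage_le g).
have ratio := harmonic_ratio F0 rho0 g_rho Jle.
rewrite ler_pdivrMr ?ltr0n ?GE ?addn_gt0 ?F0 //; apply: le_trans ratio.
by rewrite ler_nat cardsU addnC leq_subr.
Qed.

Lemma sem_approximate s :
  stores_digraph s A F T -> stores_covering_problem s A T r lk ->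
  exists J U, [/\ stores_set (sem approximate s) chosen_arr J,
    greedy_state R X open_constraints J U & hitting X open_constraints J].
Proof.
move=> [sn sE sF _] [s1 s2 sl sV].
have sV' : stores_family s cover_arr V by move=> j k; rewrite sV; congr nat_of_bool; rewrite [RHS]in_set.
rewrite /approximate 3!sem_seq.
have sb1 := sem_same_but cut_table s.
have [s1E s1c s1s] := sem_cut_table (l := l) link_edge sn s1 sE sF sl.
set t1 := sem cut_table s in sb1 s1E s1c s1s *.
have t1n : reg t1 0 = n by rewrite sb1.1.
have t11 : reg t1 1 = rho by rewrite sb1.1.
have t12 : reg t1 2 = r by rewrite sb1.1.
have t1l : stores_links l t1 := same_but_links sb1 isT sl.
have t1V := same_but_family (a := cover_arr) sb1 isT sV'.
clearbody t1.
have sb2 := sem_same_but minimal_table t1.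
have t2m := sem_minimal_table t11 t1l s1c s1s.
set t2 := sem minimal_table t1 in sb2 t2m *.
have t2n : reg t2 0 = n by rewrite sb2.1.
have t21 : reg t2 1 = rho by rewrite sb2.1.
have t22 : reg t2 2 = r by rewrite sb2.1.
have t2V := same_but_family (a := cover_arr) sb2 isT t1V.
have t2c := same_but_family (a := cut_arr) sb2 isT s1c.
clearbody t2.
have sb3 := sem_same_but open_tips t2.
have t3t := sem_open_tips t21 t22.
set t3 := sem open_tips t2 in sb3 t3t *.
have t3n : reg t3 0 = n by rewrite sb3.1.
have t31 : reg t3 1 = rho by rewrite sb3.1.
have t3V := same_but_family (a := cover_arr) sb3 isT t2V.
have t3c := same_but_family (a := cut_arr) sb3 isT t2c.
have t3m := same_but_stores (a := cut_open_arr) sb3 isT t2m.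
clearbody t3.
apply: (sem_greedy_cover R t3n t31 t3V t3c); last exact: open_constraint_neq0.
split.
  by apply: stores_set_eq t3t; apply/setP=> k; rewrite !inE.
by apply: stores_set_eq t3m; apply/setP=> k; rewrite !inE.
Qed.

End ApproximateCorrect.

(** * Construction and approximation of the covering problem *)

Theorem theorem8 (R : realType) :
  exists (construct approximate : prog) (c1 c2 : nat),
  forall (n : nat) (A : 'M[bool]_n) (F : {set 'I_n})
         (ps cs : seq (seq 'I_n)) (S : {set 'I_n}),
    (0 < n)%N ->
    minimal_feasible R A F ->
    min_pc_decomposition A ps cs ->
    sink_representatives A (tips ps) S ->
    F = tips ps :|: S ->
    (forall s : machine, stores_digraph s A F (tips ps) ->
       exists (t : nat) (s' : machine)
              (rho r : nat) (lk : rho.-tuple ('I_n * 'I_n)),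
         [/\ exec s construct t s',
             (t <= c1 * n ^ 6)%N,
             sensitive_links R A F r lk
           & stores_covering_problem s' A (tips ps) r lk])
    /\
    (forall (rho r : nat) (lk : rho.-tuple ('I_n * 'I_n)) (s : machine),
       sensitive_links R A F r lk ->
       (exists J : {set 'I_n}, covering A (tips ps) r lk J) ->
       stores_digraph s A F (tips ps) ->
       stores_covering_problem s A (tips ps) r lk ->
       exists (t : nat) (s' : machine) (J : {set 'I_n}),
         let F' := (\bigcup_(j in J) Zset j) :|: F in
         [/\ exec s approximate t s',
             (t <= c2 * n ^ 3)%N,
             stores_set s' 5 J
           & [/\ covering A (tips ps) r lk J,
                 link_robust R A F'
               & (0 < rho)%N ->
                 forall G : {set 'I_n},
                   minimal_link_robust_above R A F G ->
                   #|F'|%:R / #|G|%:R <= harmonic_number R rho]]).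
Proof.
exists (compile construct), (compile approximate), (weight construct), (weight approximate * 8)%N.
move=> n A F ps cs S n0 [Ffeas _] [pc _] _ FE.
have TF : tips ps \subset F by rewrite FE; apply: finset.subsetUl.
have [eF _] : reaches (state_edge A) F /\ matchable (state_edge A) (~: F) by apply/(feasibleP R).
have TP := pc_matching pc.
split=> [s sA|rho r lk s lkP _ sA sC].
  have [rho [r [lk [lkP cP]]]] := construct_correct R TF eF n0 TP sA.
  have [] := @exec_compile [:: 0%N] n construct s isT n0.
    by move=> b; rewrite inE => /eqP->; case: sA => ->.
  move=> t ex tb; exists t, (sem construct s), rho, r, lk; split=> //.
  by apply: leq_trans tb _; rewrite leq_mul2l leq_pexp2l ?orbT.
have [f fP] := TP.
have [J [U [sJ gs hJ]]] := sem_approximate fP TF lkP sA sC.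
have JE : (\bigcup_(j in J) Zset j) = J.
  apply/setP=> x; apply/bigcupP/idP => [[j jJ]|xJ]; last by exists x; rewrite ?set11.
  by rewrite finset.in_set1 => /eqP->.
(* Loops also count up to register 1, that is rho, hence the bound 2 n. *)
have [] := @exec_compile [:: 0%N; 1%N] (2 * n) approximate s isT.
- by rewrite muln_gt0.
- move=> b; rewrite !inE => /orP[] /eqP->.
    by case: sA => -> _ _ _; rewrite leq_pmull.
  by case: sC => -> _ _ _; apply: rho_le2n fP TF eF lkP.
move=> t ex tb; exists t, (sem approximate s), J => F'.
have {F'}-> : F' = J :|: F by rewrite /F' JE.
split; first exact: ex; last split.
- by apply: leq_trans tb _; rewrite expnMn mulnA.
- exact: sJ.
- by have := hitting_covering fP TF eF lkP hJ.
- by have := hitting_robust fP TF eF lkP hJ.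
- by move=> rho0 G; have := approximate_ratio fP TF eF lkP n0 rho0 gs; apply.
Qed.
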